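(* Let $p \geq 2$ be a real number. Let $u$ be a weak solution on $\mathbb{R}_+\times\mathbb{T}^2$ of the Euler equations starting from zero initial data, $$\partial_t u + \nabla \cdot (u \otimes u) = -\nabla \pi, \qquad \operatorname{div} u = 0, \qquad u(0) = 0,$$ and assume that $\omega := \operatorname{curl} u$ belongs to $L^{\infty}(\mathbb{R}_+, L^p(\mathbb{T}^2))$. Then $u$ is identically zero on $\mathbb{R}_+ \times \mathbb{T}^2$.
   Context: $\mathbb{R}_+=[0,\infty)$ and $\mathbb{T}^2$ is the two-dimensional torus; $u$ is an $\mathbb{R}^2$-valued velocity field and $\pi$ is the scalar pressure (a distribution on the torus). For vector fields $f,g$, $(\nabla\cdot(f\otimes g))_i=\sum_j\partial_j(f_ig_j)$, and $\operatorname{curl}u=\partial_1u_2-\partial_2u_1$. A weak solution is one satisfying the equations in the sense of distributions, including the initial condition. *)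

(* Defs.v *)
(* Mathematical Components / MathComp-Analysis. *)
From HB Require Import structures.
From mathcomp Require Import all_boot all_order all_algebra.
From mathcomp Require Import all_classical all_reals all_analysis.

Set Implicit Arguments.
Unset Strict Implicit.
Unset Printing Implicit Defensive.

Import Order.TTheory GRing.Theory Num.Theory numFieldNormedType.Exports.

Local Open Scope classical_set_scope.
Local Open Scope ring_scope.

(* The torus is R^2 / Z^2: a function on it is a function on R * R that is
   1-periodic in each coordinate, and it is integrated over the unit cell.
   A point of R x T^2 is written (t, (x1, x2)). *)

Definition biperiodic (R : realType) (g : R * R -> R) : Prop :=
  forall x1 x2, g (x1 + 1, x2) = g (x1, x2) /\ g (x1, x2 + 1) = g (x1, x2).

Definition cell {R : realType} : set (R * R) := `[0, 1[ `*` `[0, 1[.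

Definition half_cylinder {R : realType} : set (R * (R * R)) :=
  `[0, +oo[ `*` cell.

(* The library does not infer this instance, so it is reproved in order to
   equip Lebesgue measure in dimensions 2 and 3 with it. *)
Lemma product_sigma_finite d1 d2 (T1 : measurableType d1)
    (T2 : measurableType d2) (R : realType)
    (m1 : {sigma_finite_measure set T1 -> \bar R})
    (m2 : {sigma_finite_measure set T2 -> \bar R}) :
  sigma_finite setT (m1 \x m2)%E.
Proof.
have /sigma_finiteP[F [TF ndF Foo]] := sigma_finiteT m1.
have /sigma_finiteP[G [TG ndG Goo]] := sigma_finiteT m2.
exists (fun n => F n `*` G n).
  rewrite -setXTT TF TG predeqE => -[x y]; split.
    move=> [/= [n _ Fnx] [k _ Gky]]; exists (maxn n k) => //; split.
    - by move: x Fnx; exact/subsetPset/ndF/leq_maxl.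
    - by move: y Gky; exact/subsetPset/ndG/leq_maxr.
  by move=> [n _ []/= ? ?]; split; exists n.
move=> k; have [? ?] := Foo k; have [? ?] := Goo k.
split; first exact: measurableX.
by rewrite product_measure1E// lte_mul_pinfty// ge0_fin_numE.
Qed.

Definition leb2 {R : realType} := (@lebesgue_measure R \x @lebesgue_measure R)%E.
HB.instance Definition _ (R : realType) := Measure.on (@leb2 R).
HB.instance Definition _ (R : realType) :=
  Measure_isSigmaFinite.Build _ _ _ (@leb2 R)
    (@product_sigma_finite _ _ _ _ R lebesgue_measure lebesgue_measure).

Definition leb3 {R : realType} := (@lebesgue_measure R \x @leb2 R)%E.
HB.instance Definition _ (R : realType) := Measure.on (@leb3 R).
HB.instance Definition _ (R : realType) :=
  Measure_isSigmaFinite.Build _ _ _ (@leb3 R)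
    (@product_sigma_finite _ _ _ _ R lebesgue_measure leb2).

(* Coordinate 0 is time, coordinates 1 and 2 are space. *)
Definition direction (R : realType) (k : 'I_3) : R * (R * R) :=
  ((k == 0 :> nat)%:R, ((k == 1 :> nat)%:R, (k == 2 :> nat)%:R)).

Definition partial (R : realType) (k : 'I_3) (f : R * (R * R) -> R) :
  R * (R * R) -> R := fun z => 'D_(direction R k) f z.

Definition dt (R : realType) (f : R * (R * R) -> R) := partial ord0 f.
Definition dx (R : realType) (j : 'I_2) (f : R * (R * R) -> R) :=
  partial (lift ord0 j) f.

Definition iter_partial (R : realType) (s : seq 'I_3) (f : R * (R * R) -> R) :=
  foldr (@partial R) f s.

Definition smooth (R : realType) (f : R * (R * R) -> R) : Prop :=
  forall s : seq 'I_3, continuous (iter_partial s f) /\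
    forall k z, derivable (iter_partial s f) z (direction R k).

Definition test_supported (R : realType) (a b : R) (f : R * (R * R) -> R) : Prop :=
  [/\ smooth f,
      forall t, biperiodic (fun x => f (t, x)) &
      forall t x, ~~ (a <= t <= b) -> f (t, x) = 0].

(* The elements of C_c^oo(I x T^2), extended by 0 to R x T^2. *)
Definition test_function (R : realType) (I : set R) (f : R * (R * R) -> R) : Prop :=
  exists a b, `[a, b] `<=` I /\ test_supported a b f.

(* The values of P outside of C_c^oo(I x T^2) are irrelevant. *)
Record is_distribution (R : realType) (I : set R)
    (P : (R * (R * R) -> R) -> R) : Prop := Distribution {
  distribution_linear : forall c f g, test_function I f -> test_function I g ->
    P (fun z => c * f z + g z) = c * P f + P g ;
  distribution_continuous : forall a b, `[a, b] `<=` I ->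
    exists C N, forall f M, test_supported a b f ->
      (forall s, (size s <= N)%N -> forall z, `|iter_partial s f z| <= M) ->
      `|P f| <= C * M }.

Definition divergence (R : realType) (phi : 'I_2 -> R * (R * R) -> R) :
  R * (R * R) -> R := fun z => \sum_(j < 2) dx j (phi j) z.

(* Up to sign, the result of testing d_t u + div (u (x) u) against phi and
   moving all the derivatives onto phi. *)
Definition euler_pairing (R : realType) (u phi : 'I_2 -> R * (R * R) -> R) : R :=
  \int[leb3]_(z in half_cylinder)
    (\sum_(i < 2) u i z * dt (phi i) z +
     \sum_(i < 2) \sum_(j < 2) u i z * u j z * dx j (phi i) z).

(* The equations hold in the sense of distributions on (0, oo) x T^2, for some
   pressure pi. The initial condition is the usual one: the formulation against
   divergence-free fields, where pi disappears, holds up to t = 0, with the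
   boundary term produced by u0. Square integrability up to t = 0 gives
   a meaning to all the integrals. *)
Record weak_euler (R : realType) (u : 'I_2 -> R * (R * R) -> R)
    (u0 : 'I_2 -> R * R -> R) : Prop := WeakEuler {
  weak_euler_periodic : forall i t, biperiodic (fun x => u i (t, x)) ;
  weak_euler_measurable : forall i, measurable_fun half_cylinder (u i) ;
  weak_euler_L2loc : forall i T,
    leb3.-integrable (`[0, T] `*` cell) (fun z => ((u i z) ^+ 2)%:E) ;
  weak_euler_momentum : exists pi, is_distribution `]0, +oo[ pi /\
    forall phi, (forall i, test_function `]0, +oo[ (phi i)) ->
      euler_pairing u phi + pi (divergence phi) = 0 ;
  weak_euler_div : forall f, test_function `]0, +oo[ f ->
    \int[leb3]_(z in half_cylinder) (\sum_(j < 2) u j z * dx j f z) = 0 ;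
  weak_euler_init_periodic : forall i, biperiodic (u0 i) ;
  weak_euler_init_integrable : forall i, leb2.-integrable cell (EFin \o u0 i) ;
  weak_euler_init : forall phi, (forall i, test_function setT (phi i)) ->
    (forall z, divergence phi z = 0) ->
    euler_pairing u phi +
      \int[leb2]_(x in cell) (\sum_(i < 2) u0 i x * phi i (0, x)) = 0 }.

(* omega = d_1 u_2 - d_2 u_1 in the sense of distributions on (0, oo) x T^2;
   in 'I_2, the two components of u are u 0 and u 1. *)
Definition weak_curl (R : realType) (u : 'I_2 -> R * (R * R) -> R)
    (omega : R * (R * R) -> R) : Prop :=
  forall f, test_function `]0, +oo[ f ->
    \int[leb3]_(z in half_cylinder) (omega z * f z) =
    - \int[leb3]_(z in half_cylinder) (u 1 z * dx 0 f z - u 0 z * dx 1 f z).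

(* omega \in L^oo(R_+, L^p(T^2)); restriction to a set is extension by 0. *)
Definition Linfty_Lp (R : realType) (p : R) (omega : R * (R * R) -> R) : Prop :=
  [/\ forall t, biperiodic (fun x => omega (t, x)),
      measurable_fun half_cylinder omega &
      ('N[lebesgue_measure]_+oo[
        (fun t : R => 'N[leb2]_(p%:E)[(fun x => (omega (t, x))%:E) \_ cell])
          \_ `[0%R, +oo[ ] < +oo)%E].

(* Main.v *)
Require Import Defs.
From mathcomp Require Import all_boot all_order all_algebra.
From mathcomp Require Import all_classical all_reals all_analysis.
From mathcomp Require Import measurable_realfun ess_sup_inf.
From mathcomp Require Import ring lra zify.

Set Implicit Arguments.
Unset Strict Implicit.
Unset Printing Implicit Defensive.

Import Order.TTheory GRing.Theory Num.Theory numFieldNormedType.Exports.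

Local Open Scope classical_set_scope.
Local Open Scope ring_scope.


(** The kinetic energy of [u] is conserved, hence stays equal to its initial value
zero. A bounded energy alone would not give this: energy could be carried to
arbitrarily small scales. The vorticity bound excludes it, as follows.

Everything is written in the modes [hart k = cas (2 pi k . x)], where
[cas = cos + sin] and [k] runs over pairs of integers. They are real and
orthonormal on the cell, the partial derivative of one mode is a multiple of the
opposite mode ([dx_mode]), and a product of two modes is a combination of four
modes ([hartM]). Their linear combinations are dense in the square integrable
functions ([trig_dense]), so a function all of whose coefficients vanish is zero
almost everywhere ([coef_eq0_inner]).

As [2 <= p], the [L^p] bound on the vorticity bounds its [L^2] norm uniformly in
time ([ae_enstrophy_bound]). The gradient of a divergence-free field has the same
[L^2] norm as its vorticity, so the velocity is bounded in the Sobolev space [H^1],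
uniformly in time ([h1_bounded_of_curl]).

Testing the equation with the divergence-free field of amplitude [perp k] carried
by the mode [k] removes the pressure; letting the time profile tend to a truncated
affine function, and using that the initial velocity is zero, one finds that the
coefficient [v k] of the velocity along [perp k] satisfies
[v k t = \int_0^t B k s ds] for almost every [t], where [B k] is a quadratic
expression in [u] ([ae_momentum]). Hence [(v k t)^2 = 2 \int_0^t B k s * v k s ds]
([sqr_primitive]), and summing over the modes of a box of size [N], the energy in
these modes is twice the time integral of the flux
[flux N f = \sum_(i, j) \int f_i f_j d_j (P_N f_i)], where [P_N] is the truncation
to the box ([energy_balance], [production_flux]).

It remains to see that the flux is bounded, and that it tends to zero for each fixed
field, as [N] grows. In dimension two the product of two [H^1] functions of mean
zero is in [L^2]: the square of [\int f g phi] is bounded by a constant times the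
product of the squared norms of the gradients of [f] and [g] and of the squared
[L^2] norm of [phi] ([trilinear_bound]). With [phi = d_j (P_N f_i)] this bounds the
flux ([flux_bound]). The flux of the truncated field [P_N f] through the box vanishes
identically, since [\int (w . grad) w . w = 0] for [w] divergence-free
([flux_psum_eq0]); and the difference of the two fluxes is controlled by the tail of
[f] in [H^1] ([flux_cvg0]). By dominated convergence in time the energy of [u t] is
zero for almost every [t]. *)

(** * Square-integrable functions and iterated integrals *)

Section square_integrable.
Context d (T : measurableType d) (R : realType).
Variables (mu : {measure set T -> \bar R}) (D : set T).
Hypothesis mD : measurable D.

Definition sqint (f : T -> R) :=
  measurable_fun D f /\ mu.-integrable D (fun x => (f x ^+ 2)%:E).

Lemma le_integrableR (f g : T -> R) : measurable_fun D f ->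
  (forall x, D x -> `|f x| <= g x) -> mu.-integrable D (EFin \o g) ->
  mu.-integrable D (EFin \o f).
Proof.
move=> mf fg ig; apply: (le_integrable mD _ _ ig); first exact/measurable_EFinP.
by move=> x Dx /=; rewrite lee_fin (le_trans (fg _ Dx))// ler_norm.
Qed.

Lemma integrableDR (f g : T -> R) : mu.-integrable D (EFin \o f) ->
  mu.-integrable D (EFin \o g) -> mu.-integrable D (EFin \o (fun x => f x + g x)).
Proof. by move=> fi gi; have := integrableD mD fi gi; apply: eq_integrable. Qed.

Lemma integrableBR (f g : T -> R) : mu.-integrable D (EFin \o f) ->
  mu.-integrable D (EFin \o g) -> mu.-integrable D (EFin \o (fun x => f x - g x)).
Proof. by move=> fi gi; have := integrableB mD fi gi; apply: eq_integrable. Qed.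

Lemma integrableZR (r : R) (f : T -> R) : mu.-integrable D (EFin \o f) ->
  mu.-integrable D (EFin \o (fun x => r * f x)).
Proof. by move=> fi; have := integrableZl mD r fi; apply: eq_integrable. Qed.

Lemma integrable_sumR I (s : seq I) (f : I -> T -> R) :
  (forall i, mu.-integrable D (EFin \o f i)) ->
  mu.-integrable D (EFin \o (fun x => \sum_(i <- s) f i x)).
Proof.
move=> fi; elim: s => [|a s ih].
  by under eq_fun do rewrite big_nil; exact: integrable0.
by under eq_fun do rewrite big_cons; exact: integrableDR.
Qed.

Lemma Rintegral_sum I (s : seq I) (f : I -> T -> R) :
  (forall i, mu.-integrable D (EFin \o f i)) ->
  \int[mu]_(x in D) (\sum_(i <- s) f i x) = \sum_(i <- s) \int[mu]_(x in D) f i x.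
Proof.
move=> fi; elim: s => [|a s ih].
  by rewrite big_nil; under eq_Rintegral do rewrite big_nil; rewrite Rintegral_cst// mul0r.
rewrite big_cons -ih; under eq_Rintegral do rewrite big_cons.
by rewrite RintegralD//; exact: integrable_sumR.
Qed.

Lemma sqint_mul (f g : T -> R) : sqint f -> sqint g ->
  mu.-integrable D (fun x => (f x * g x)%:E).
Proof.
move=> [mf if2] [mg ig2].
have := integrableD mD if2 ig2.
apply: (@le_integrableR _ (fun x => f x ^+ 2 + g x ^+ 2)).
  exact: measurable_funM.
move=> x _; rewrite normrM -(real_normK (num_real (f x))).
rewrite -(real_normK (num_real (g x))).
have : 0 <= (`|f x| - `|g x|) ^+ 2 by exact: sqr_ge0.
have := normr_ge0 (f x); have := normr_ge0 (g x); nra.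
Qed.

Lemma sqintD (f g : T -> R) : sqint f -> sqint g -> sqint (fun x => f x + g x).
Proof.
move=> sf sg; have ifg := sqint_mul sf sg; move: sf sg => [mf if2] [mg ig2].
split; first exact: measurable_funD.
have := integrableD mD (integrableD mD if2 ig2) (integrableZl mD 2 ifg).
apply: eq_integrable => // x _ /=; congr EFin; ring.
Qed.

Lemma sqintZ (r : R) (f : T -> R) : sqint f -> sqint (fun x => r * f x).
Proof.
move=> [mf if2]; split; first exact: measurable_funM.
have := integrableZl mD (r ^+ 2) if2.
apply: eq_integrable => // x _ /=; congr EFin; ring.
Qed.

Lemma sqintB (f g : T -> R) : sqint f -> sqint g -> sqint (fun x => f x - g x).
Proof.
move=> sf sg; have := sqintD sf (sqintZ (-1) sg).
by under [X in sqint X -> _]eq_fun do rewrite mulN1r.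
Qed.

Lemma sqint0 : sqint (fun=> 0).
Proof.
split=> //; rewrite expr0n/=; exact: integrable0.
Qed.

Lemma sqint_sum I (s : seq I) (f : I -> T -> R) : (forall i, sqint (f i)) ->
  sqint (fun x => \sum_(i <- s) f i x).
Proof.
move=> sf; elim: s => [|a s ih].
  by under eq_fun do rewrite big_nil; exact: sqint0.
by under eq_fun do rewrite big_cons; exact: sqintD.
Qed.

Lemma sqint_mulb (f g : T -> R) (M : R) : sqint f -> measurable_fun D g ->
  (forall x, D x -> `|g x| <= M) -> sqint (fun x => f x * g x).
Proof.
move=> [mf if2] mg gM; split; first exact: measurable_funM.
have := integrableZl mD (M ^+ 2) if2.
apply: le_integrableR; first by apply: measurable_funX; exact: measurable_funM.
move=> x Dx; rewrite normrX normrM exprMn mulrC -!normrX.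
rewrite (ger0_norm (sqr_ge0 (f x))) ler_wpM2r ?sqr_ge0//.
by rewrite normrX lerXn2r ?nnegrE ?(le_trans _ (gM _ Dx)) ?normr_ge0// gM.
Qed.

Lemma integrable_mulb (f g : T -> R) (M : R) : mu.-integrable D (EFin \o f) ->
  measurable_fun D g ->
  (forall x, D x -> `|g x| <= M) -> mu.-integrable D (fun x => (f x * g x)%:E).
Proof.
move=> iF mg gM.
have mf : measurable_fun D f by apply/measurable_EFinP/(measurable_int mu).
have := integrableZl mD M (integrable_norm iF).
apply: le_integrableR; first exact: measurable_funM.
by move=> x Dx; rewrite normrM mulrC ler_wpM2r// gM.
Qed.

Lemma integrable_bmul (f g : T -> R) (M : R) : mu.-integrable D (EFin \o f) ->
  measurable_fun D g -> (forall x, D x -> `|g x| <= M) ->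
  mu.-integrable D (EFin \o (fun x => g x * f x)).
Proof.
move=> iF mg gM; have := integrable_mulb iF mg gM.
by apply: eq_integrable => // x _ /=; rewrite mulrC.
Qed.

Lemma sqint_bounded (f : T -> R) (M : R) : (mu D < +oo)%E ->
  measurable_fun D f -> (forall x, D x -> `|f x| <= M) -> sqint f.
Proof.
move=> Doo mf fM; split => //.
have : mu.-integrable D (EFin \o cst (M ^+ 2)).
  apply: measurable_bounded_integrable => //.
  by exists (M ^+ 2); split; [exact: num_real|move=> x Mx t _ /=;
    rewrite ger0_norm ?sqr_ge0// ltW].
apply: le_integrableR; first exact: measurable_funX.
move=> x Dx; rewrite normrX lerXn2r ?nnegrE ?(le_trans _ (fM _ Dx))//.
Qed.

Lemma sqint_int (f : T -> R) : (mu D < +oo)%E -> sqint f ->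
  mu.-integrable D (EFin \o f).
Proof.
move=> Doo sf.
have s1 : sqint (fun=> 1) by apply: (@sqint_bounded _ 1) => // x _; rewrite normr1.
by have := sqint_mul sf s1; under eq_fun do rewrite mulr1.
Qed.

Lemma eq_sqint f g : {in D, f =1 g} -> sqint f -> sqint g.
Proof.
move=> fg [mf if2]; split; first exact: eq_measurable_fun mf.
by move: if2; apply: eq_integrable => // x Dx; rewrite fg.
Qed.

Lemma Rdominated_cvg (f_ : nat -> T -> R) (f g : T -> R) :
  (forall n, measurable_fun D (f_ n)) -> measurable_fun D f ->
  {ae mu, forall x, D x -> f_ n x @[n --> \oo] --> f x} ->
  mu.-integrable D (EFin \o g) ->
  {ae mu, forall x, D x -> forall n, `|f_ n x| <= g x} ->
  \int[mu]_(x in D) f_ n x @[n --> \oo] --> \int[mu]_(x in D) f x.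
Proof.
move=> mf_ mf f_f gi fg.
have [||||] := @dominated_convergence _ _ R mu D mD
  (fun n x => (f_ n x)%:E) (EFin \o f) (EFin \o g) _ _ _ gi.
- by move=> n; exact/measurable_EFinP.
- exact/measurable_EFinP.
- by move: f_f; apply: filterS => x h Dx; apply/fine_cvgP; split;
    [exact: nearW|exact: h].
- by move: fg; apply: filterS => x h n Dx; rewrite lee_fin; exact: h.
move=> fi _ fcvg; apply: fine_cvg.
rewrite fineK//; exact: integrable_fin_num.
Qed.

End square_integrable.

Section prod_integral.
Context d1 d2 (T1 : measurableType d1) (T2 : measurableType d2) (R : realType).
Variables (m1 : {sigma_finite_measure set T1 -> \bar R})
  (m2 : {sigma_finite_measure set T2 -> \bar R}).
Variables (A : set T1) (B : set T2) (f : T1 * T2 -> R).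
Hypotheses (mA : measurable A) (mB : measurable B).
Hypothesis fi : (m1 \x m2)%E.-integrable (A `*` B) (EFin \o f).

Let g := f \_ (A `*` B).

Let gi : (m1 \x m2)%E.-integrable setT (EFin \o g).
Proof.
by rewrite /g -restrict_EFin; apply/(integrable_mkcond _ (measurableX mA mB)).
Qed.

Let gE x : A x -> (fun y => g (x, y)) = (fun y => f (x, y)) \_ B.
Proof.
move=> Ax; apply/funext => y; rewrite /g !patchE.
have [By|nBy] := pselect (B y); first by rewrite !mem_set.
by rewrite !memNset// => -[].
Qed.

Let inner_fin : {ae m1, forall x, A x ->
  m2.-integrable B (fun y => (f (x, y))%:E)}.
Proof.
have := ae_integrable1 gi; apply: filterS => x + Ax.
change (m2.-integrable setT (EFin \o (fun y => g (x, y))) -> m2.-integrable B (EFin \o (fun y => f (x, y)))).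
by rewrite gE// -restrict_EFin => /(integrable_mkcond _ mB).
Qed.

Lemma ae_integrable_section : {ae m1, forall x, A x ->
  m2.-integrable B (fun y => (f (x, y))%:E)}.
Proof. exact: inner_fin. Qed.

Let F x := \int[m2]_(y in B) f (x, y).

Let fubE x : A x -> (fubini_F m2 (EFin \o g) x = \int[m2]_(y in B) (f (x, y))%:E)%E.
Proof.
move=> Ax; rewrite /fubini_F [RHS]integral_mkcond; apply: eq_integral => y _ /=.
have /(congr1 (fun h => h y)) /= -> := gE Ax.
by rewrite !patchE; case: ifP.
Qed.

Let mfub : measurable_fun A (fubini_F m2 (EFin \o g)).
Proof. by apply: measurable_funTS; apply: measurable_fubini_F gi. Qed.

Let FE : {ae m1, forall x, A x -> (F x)%:E = fubini_F m2 (EFin \o g) x}.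
Proof.
move: inner_fin; apply: filterS => x /[swap] Ax /(_ Ax) xi.
by rewrite /F fubE// fineK//; exact: integrable_fin_num.
Qed.

Let mF : measurable_fun A (EFin \o F).
Proof.
have : measurable_fun A (fun x => (fine (fubini_F m2 (EFin \o g) x))%:E).
  by apply/measurable_EFinP; exact: measurableT_comp.
apply: eq_measurable_fun => x /[!inE] Ax /=.
by rewrite /F fubE.
Qed.

Lemma integrable_section_integral : m1.-integrable A (EFin \o F).
Proof.
have : m1.-integrable A (fubini_F m2 (EFin \o g)).
  by apply: (integrableS measurableT) => //; exact: integrable_fubini_F.
move=> /integrableP[_ Foo]; apply/integrableP; split => //.
rewrite (le_lt_trans _ Foo)//; apply: ae_ge0_le_integral => //.
- exact: measurableT_comp.
- exact: measurableT_comp.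
- by move: FE; apply: filterS => x /[swap] Ax /(_ Ax) Fx; rewrite /comp Fx.
Qed.

Lemma Rintegral_prod :
  \int[(m1 \x m2)%E]_(z in A `*` B) f z = \int[m1]_(x in A) F x.
Proof.
rewrite /Rintegral; congr fine.
rewrite integral_mkcond restrict_EFin -/g -(integral12_prod_meas1 gi).
have -> : (\int[m1]_(x in A) (F x)%:E = \int[m1]_(x in A) fubini_F m2 (EFin \o g) x)%E.
  apply: ae_eq_integral => //.
rewrite [RHS]integral_mkcond; apply: eq_integral => x _.
rewrite patchE; case: ifPn => // /negP xA; rewrite /fubini_F.
rewrite integral0_eq// => y _ /=; rewrite /g patchE memNset// => -[/=].
by move=> /mem_set.
Qed.

End prod_integral.

Section prod_exchange.
Context d1 d2 (T1 : measurableType d1) (T2 : measurableType d2) (R : realType).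
Variables (m1 : {sigma_finite_measure set T1 -> \bar R})
  (m2 : {sigma_finite_measure set T2 -> \bar R}).
Variables (A : set T1) (B : set T2) (f : T1 * T2 -> R).
Hypotheses (mA : measurable A) (mB : measurable B).
Hypothesis fi : (m1 \x m2)%E.-integrable (A `*` B) (EFin \o f).

Let g := f \_ (A `*` B).

Let gi : (m1 \x m2)%E.-integrable setT (EFin \o g).
Proof.
by rewrite /g -restrict_EFin; apply/(integrable_mkcond _ (measurableX mA mB)).
Qed.

Let gE y : B y -> (fun x => g (x, y)) = (fun x => f (x, y)) \_ A.
Proof.
move=> By; apply/funext => x; rewrite /g !patchE.
have [Ax|nAx] := pselect (A x); first by rewrite !mem_set.
by rewrite !memNset// => -[].
Qed.

Let G y := \int[m1]_(x in A) f (x, y).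

Let fubE y : B y -> (fubini_G m1 (EFin \o g) y = \int[m1]_(x in A) (f (x, y))%:E)%E.
Proof.
move=> By; rewrite /fubini_G [RHS]integral_mkcond; apply: eq_integral => x _ /=.
have /(congr1 (fun h => h x)) /= -> := gE By.
by rewrite !patchE; case: ifP.
Qed.

Let mfub : measurable_fun B (fubini_G m1 (EFin \o g)).
Proof. by apply: measurable_funTS; apply: measurable_fubini_G gi. Qed.

Let GE : {ae m2, forall y, B y -> (G y)%:E = fubini_G m1 (EFin \o g) y}.
Proof.
have := ae_integrable2 gi; apply: filterS => y + By.
change (m1.-integrable setT (EFin \o (fun x => g (x, y))) ->
  (G y)%:E = fubini_G m1 (EFin \o g) y).
rewrite gE// -restrict_EFin => /(integrable_mkcond _ mA) yi.
by rewrite /G fubE// fineK//; exact: integrable_fin_num.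
Qed.

Let mG : measurable_fun B (EFin \o G).
Proof.
have : measurable_fun B (fun y => (fine (fubini_G m1 (EFin \o g) y))%:E).
  by apply/measurable_EFinP; exact: measurableT_comp.
apply: eq_measurable_fun => y /[!inE] By /=.
by rewrite /G fubE.
Qed.

Lemma Rintegral_exchange :
  \int[m1]_(x in A) \int[m2]_(y in B) f (x, y) = \int[m2]_(y in B) \int[m1]_(x in A) f (x, y).
Proof.
rewrite -(Rintegral_prod mA mB fi) /Rintegral; congr fine.
rewrite integral_mkcond restrict_EFin -/g -(integral21_prod_meas1 gi).
have -> : (\int[m2]_(y in B) (G y)%:E = \int[m2]_(y in B) fubini_G m1 (EFin \o g) y)%E.
  exact: ae_eq_integral.
rewrite [RHS]integral_mkcond; apply: eq_integral => y _.
rewrite patchE; case: ifPn => // /negP yB; rewrite /fubini_G.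
rewrite integral0_eq// => x _ /=; rewrite /g patchE memNset// => -[/= _].
by move=> /mem_set.
Qed.

End prod_exchange.

Section tensor.
Context d1 d2 (T1 : measurableType d1) (T2 : measurableType d2) (R : realType).
Variables (m1 : {sigma_finite_measure set T1 -> \bar R})
  (m2 : {sigma_finite_measure set T2 -> \bar R}).
Variables (A : set T1) (B : set T2) (f : T1 -> R) (g : T2 -> R).
Hypotheses (mA : measurable A) (mB : measurable B).
Hypotheses (fi : m1.-integrable A (EFin \o f)) (gi : m2.-integrable B (EFin \o g)).

Lemma integrable_tensor : (m1 \x m2)%E.-integrable (A `*` B) (fun z => (f z.1 * g z.2)%:E).
Proof.
apply/(integrable_mkcond _ (measurableX mA mB)).
pose F := f \_ A; pose G := g \_ B.
have mF : measurable_fun setT F.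
  by apply/(measurable_restrictT _ mA)/measurable_EFinP/(measurable_int m1).
have mG : measurable_fun setT G.
  by apply/(measurable_restrictT _ mB)/measurable_EFinP/(measurable_int m2).
have Fi : m1.-integrable setT (EFin \o F).
  by rewrite /F -restrict_EFin; apply/(integrable_mkcond _ mA).
have Gi : m2.-integrable setT (EFin \o G).
  by rewrite /G -restrict_EFin; apply/(integrable_mkcond _ mB).
have -> : (fun z => (f z.1 * g z.2)%:E) \_ (A `*` B) = (fun z => (F z.1 * G z.2)%:E).
  apply/funext => -[x y]; rewrite /F /G !patchE /=.
  have [Ax|nAx] := pselect (A x); have [By|nBy] := pselect (B y).
  - by rewrite !mem_set.
  - by rewrite (memNset nBy) mulr0 memNset// => -[].
  - by rewrite (memNset nAx) mul0r memNset// => -[].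
  - by rewrite (memNset nAx) mul0r memNset// => -[].
have mFG : measurable_fun setT (fun z : T1 * T2 => (F z.1 * G z.2)%:E).
  by apply/measurable_EFinP; apply: measurable_funM; exact: measurableT_comp.
apply/(@integrable12ltyP _ _ _ _ R m1 m2 _ mFG) => /=.
under eq_integral.
  move=> x _; under eq_integral do rewrite normrM EFinM.
  rewrite ge0_integralZl//; last exact/measurable_EFinP/measurableT_comp.
  over.
rewrite /= ge0_integralZr//.
- have /integrableP[_ Foo] := Fi; have /integrableP[_ Goo] := Gi.
  by rewrite lte_mul_pinfty ?integral_ge0// ge0_fin_numE// integral_ge0.
- exact/measurable_EFinP/measurableT_comp.
- exact: integral_ge0.
Qed.

End tensor.

Section tonelli.
Context d1 d2 (T1 : measurableType d1) (T2 : measurableType d2) (R : realType).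
Variables (m1 : {sigma_finite_measure set T1 -> \bar R})
  (m2 : {sigma_finite_measure set T2 -> \bar R}).
Variables (A : set T1) (B : set T2) (f : T1 * T2 -> R).
Hypotheses (mA : measurable A) (mB : measurable B).
Hypothesis mf : measurable_fun (A `*` B) f.

Lemma measurable_section x : A x -> measurable_fun B (fun y => f (x, y)).
Proof.
move=> Ax; have mg := (measurable_restrictT f (measurableX mA mB)).1 mf.
have := measurableT_comp mg (pair1_measurable x).
move=> /(measurable_funS measurableT (@subsetT _ B)).
apply: eq_measurable_fun => y /[!inE] By /=.
by rewrite patchE mem_set.
Qed.

Hypothesis f0 : forall z, (A `*` B) z -> 0 <= f z.

Let fg0 z : (0 <= (EFin \o (f \_ (A `*` B))) z)%E.
Proof. by rewrite /= lee_fin patchE; case: ifPn => // /[!inE]; exact: f0. Qed.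

Let mfg : measurable_fun setT (EFin \o (f \_ (A `*` B))).
Proof. exact/measurable_EFinP/(measurable_restrictT f (measurableX mA mB)). Qed.

Let fubE x : (fubini_F m2 (EFin \o (f \_ (A `*` B))) x =
  ((fun x => \int[m2]_(y in B) (f (x, y))%:E) \_ A) x)%E.
Proof.
rewrite patchE /fubini_F; case: ifPn => [/set_mem Ax|/negP nAx]; last first.
  rewrite (eq_integral (fun=> 0%E)) ?integral0// => y _ /=.
  by rewrite patchE memNset// => -[Ax _]; apply: nAx; exact: mem_set.
rewrite [RHS]integral_mkcond; apply: eq_integral => y _ /=; rewrite !patchE.
have [By|nBy] := pselect (B y); first by rewrite !mem_set.
by rewrite !memNset// => -[].
Qed.

Lemma measurable_section_integral :
  measurable_fun A (fun x => \int[m2]_(y in B) (f (x, y))%:E)%E.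
Proof.
apply/(measurable_restrictT _ mA); have := @measurable_fun_fubini_tonelli_F _ _ _ _ R m2 _ mfg fg0.
by apply: eq_measurable_fun => x _; exact: fubE.
Qed.

(** Tonelli on a rectangle. It serves before integrability is known: to prove it for
the vorticity, and to show that a non-negative function is zero. *)
Lemma integral_prod_ge0 : (\int[(m1 \x m2)%E]_(z in A `*` B) (f z)%:E =
  \int[m1]_(x in A) \int[m2]_(y in B) (f (x, y))%:E)%E.
Proof.
rewrite integral_mkcond.
have -> : (fun z => (f z)%:E) \_ (A `*` B) = EFin \o (f \_ (A `*` B)) by rewrite restrict_EFin.
rewrite (@fubini_tonelli1 _ _ _ _ R m1 m2 _ mfg fg0) [RHS]integral_mkcond.
by apply: eq_integral => x _; exact: fubE.
Qed.

End tonelli.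

Section cell_inner.
Context {R : realType}.
Implicit Types (f g h : R * R -> R).

Lemma measurable_cell :
  measurable (cell : set (measurableTypeR R * measurableTypeR R)).
Proof. exact: measurableX. Qed.

Lemma leb2_cell : leb2 (@cell R) = 1%E.
Proof.
rewrite /leb2 /cell product_measure1E//= lebesgue_measure_itv/= lte_fin ltr01.
by rewrite oppr0 adde0 mule1.
Qed.

Lemma leb2_cell_fin : (leb2 (@cell R) < +oo)%E.
Proof. by rewrite leb2_cell ltry. Qed.

Definition inner f g : R := \int[leb2]_(x in cell) (f x * g x).

Notation sq := (sqint (@leb2 R) cell).

Let mc := measurable_cell.

Lemma innerC f g : inner f g = inner g f.
Proof. by rewrite /inner; apply: eq_Rintegral => x _; rewrite mulrC. Qed.

Lemma eq_inner f f' g g' : {in cell, f =1 f'} -> {in cell, g =1 g'} ->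
  inner f g = inner f' g'.
Proof. by move=> ff gg; apply: eq_Rintegral => x Dx; rewrite ff// gg. Qed.

Lemma innerDl f g h : sq f -> sq g -> sq h ->
  inner (fun x => f x + g x) h = inner f h + inner g h.
Proof.
move=> sf sg sh; rewrite /inner -RintegralD//; try exact: sqint_mul.
by apply: eq_Rintegral => x _; rewrite mulrDl.
Qed.

Lemma innerZl r f h : sq f -> sq h ->
  inner (fun x => r * f x) h = r * inner f h.
Proof.
move=> sf sh; rewrite /inner -RintegralZl//; last exact: sqint_mul.
by apply: eq_Rintegral => x _; rewrite mulrA.
Qed.

Lemma innerBl f g h : sq f -> sq g -> sq h ->
  inner (fun x => f x - g x) h = inner f h - inner g h.
Proof.
move=> sf sg sh; rewrite /inner -RintegralB//; try exact: sqint_mul.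
by apply: eq_Rintegral => x _; rewrite mulrBl.
Qed.

Lemma inner0l h : inner (fun=> 0) h = 0.
Proof.
rewrite /inner; under eq_Rintegral do rewrite mul0r.
by rewrite Rintegral_cst// mul0r.
Qed.

Lemma inner_suml I (s : seq I) (f : I -> R * R -> R) h :
  (forall i, sq (f i)) -> sq h ->
  inner (fun x => \sum_(i <- s) f i x) h = \sum_(i <- s) inner (f i) h.
Proof.
move=> sf sh; elim: s => [|a s ih].
  by rewrite big_nil; under eq_fun do rewrite big_nil; exact: inner0l.
rewrite big_cons -ih; under eq_fun do rewrite big_cons.
by rewrite innerDl//; exact: sqint_sum.
Qed.

Lemma inner_ge0 f : 0 <= inner f f.
Proof. by apply: Rintegral_ge0 => x _; rewrite -expr2 sqr_ge0. Qed.

Lemma innerBB f g : sq f -> sq g ->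
  inner (fun x => f x - g x) (fun x => f x - g x) =
  inner f f - 2 * inner f g + inner g g.
Proof.
move=> sf sg; have sfg := sqintB mc sf sg.
by rewrite innerBl// ![inner _ (fun x => _ - _)]innerC !innerBl// (innerC g f); ring.
Qed.

Lemma innerDD f g : sq f -> sq g ->
  inner (fun x => f x + g x) (fun x => f x + g x) =
  inner f f + 2 * inner f g + inner g g.
Proof.
move=> sf sg; have sfg := sqintD mc sf sg.
by rewrite innerDl// ![inner _ (fun x => _ + _)]innerC !innerDl// (innerC g f); ring.
Qed.

Lemma inner_add_le f g : sq f -> sq g ->
  inner (fun x => f x + g x) (fun x => f x + g x) <= 2 * inner f f + 2 * inner g g.
Proof.
move=> sf sg; have := inner_ge0 (fun x => f x - g x).
rewrite innerBB// innerDD//; lra.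
Qed.

Lemma inner_triangle f g h : sq f -> sq g -> sq h ->
  inner (fun x => f x - h x) (fun x => f x - h x) <=
  2 * inner (fun x => f x - g x) (fun x => f x - g x) +
  2 * inner (fun x => g x - h x) (fun x => g x - h x).
Proof.
move=> sf sg sh.
have := inner_add_le (sqintB mc sf sg) (sqintB mc sg sh).
by under [X in inner X _]eq_fun do rewrite addrA subrK;
   under [X in inner _ X]eq_fun do rewrite addrA subrK.
Qed.

(** The quadratic [s |-> |f - s g|^2] is non-negative; it is evaluated at its
minimum, and when [g] has norm zero, at a value of [s] where the affine function
that remains would be negative. *)
Lemma cauchy_schwarz f g : sq f -> sq g ->
  inner f g ^+ 2 <= inner f f * inner g g.
Proof.
move=> sf sg.
have H (s : R) : 0 <= inner f f - 2 * s * inner f g + s ^+ 2 * inner g g.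
  have sg' := sqintZ mc s sg.
  have := inner_ge0 (fun x => f x - s * g x); rewrite innerBB//.
  rewrite (innerC f (fun x => s * g x)) !innerZl//.
  by rewrite (innerC g (fun x => s * g x)) innerZl// (innerC g f); lra.
have [g0|] := eqVneq (inner g g) 0; last first.
  rewrite neq_lt ltNge inner_ge0/= => g0.
  have := H (inner f g / inner g g).
  set c := inner f g; set b := inner g g; rewrite -(pmulr_lge0 _ g0).
  have -> : (inner f f - 2 * (c / b) * c + (c / b) ^+ 2 * b) * b =
    inner f f * b - c ^+ 2 by field; rewrite gt_eqF.
  by rewrite subr_ge0.
rewrite g0 mulr0; have [->|c0] := eqVneq (inner f g) 0; first by rewrite expr0n.
exfalso; have := H ((inner f f + 1) / (2 * inner f g)); rewrite g0 mulr0 addr0.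
have -> : 2 * ((inner f f + 1) / (2 * inner f g)) * inner f g = inner f f + 1.
  by field.
lra.
Qed.

End cell_inner.

(** * The Hartley modes *)

Section hartley.
Context {R : realType}.
Implicit Types (k a b : int * int) (x : R * R).

Definition phase k x : R := 2 * pi * (k.1%:~R * x.1 + k.2%:~R * x.2).

(** The function cas of the Hartley transform: the sum of cosine and sine gives one
real mode for each [k], so that [k] and [- k] together span the same plane as the
cosine and the sine of [phase k]. *)
Definition hart k x : R := cos (phase k x) + sin (phase k x).

Lemma phaseD a b x : phase (a + b) x = phase a x + phase b x.
Proof. by rewrite /phase /= !rmorphD /=; ring. Qed.

Lemma phaseN a x : phase (- a) x = - phase a x.
Proof. by rewrite /phase /= !rmorphN /=; ring. Qed.

Lemma hartM a b x : hart a x * hart b x =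
  2^-1 * (hart (a - b) x + hart (b - a) x + hart (a + b) x - hart (- (a + b)) x).
Proof.
rewrite /hart !(phaseD, phaseN) !(cosD, sinD, cosN, sinN); by field.
Qed.

Lemma hart0 x : hart 0 x = 1.
Proof. by rewrite /hart /phase /= !mul0r addr0 mulr0 cos0 sin0 addr0. Qed.

Lemma hart_bound k x : `|hart k x| <= 2.
Proof.
rewrite (le_trans (ler_normD _ _))// (_ : 2 = 1 + 1)//.
apply: lerD; rewrite ler_norml; [rewrite cos_geN1 cos_le1|rewrite sin_geN1 sin_le1] => //.
Qed.

Lemma measurable_phase k : measurable_fun setT (phase k).
Proof.
by apply: measurable_funM => //; apply: measurable_funD; apply: measurable_funM.
Qed.

Lemma measurable_hart k (D : set (measurableTypeR R * measurableTypeR R)) :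
  measurable_fun D (hart k).
Proof.
apply: measurable_funTS; apply: measurable_funD.
  apply: measurableT_comp (measurable_phase k).
  by apply: continuous_measurable_fun; exact: continuous_cos.
apply: measurableT_comp (measurable_phase k).
by apply: continuous_measurable_fun; exact: continuous_sin.
Qed.

Lemma sqint_hart k : sqint leb2 cell (hart k).
Proof.
have H := @sqint_bounded _ _ R leb2 cell measurable_cell (hart k) 2.
apply: H => //.
- exact: leb2_cell_fin.
- exact: measurable_hart.
- by move=> x _; exact: hart_bound.
Qed.

Lemma integrable_hart k : leb2.-integrable cell (EFin \o hart k).
Proof.
apply: sqint_int (sqint_hart k); first exact: measurable_cell.
exact: leb2_cell_fin.
Qed.

End hartley.

Lemma periodic_int (R : realType) (g : R -> R) (m : int) (x : R) : periodic g (pi *+ 2) ->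
  g (x + 2 * pi * m%:~R) = g x.
Proof.
move=> gp; have -> : 2 * pi * m%:~R = pi *+ 2 *~ m :> R.
  by rewrite -[RHS]mulrzr -[pi *+ 2]mulr_natl.
have H (n : nat) t : g (t + pi *+ 2 *~ n) = g t.
  elim: n => [|n ih]; first by rewrite mulr0z addr0.
  by rewrite intS mulrzDr addrA mulr1z addrAC gp ih.
case: m => n; first exact: H.
by rewrite NegzE mulrNz -{2}(subrK (pi *+ 2 *~ n.+1) x) H.
Qed.

(** The integrand is the derivative of [(sin - cos) / (2 pi m)], which takes the same
value at [0] and [1]. *)
Lemma cas_integral0 (R : realType) (m : int) (th : R) : m != 0 ->
  \int[lebesgue_measure]_(x in `[0, 1[)
    (cos (2 * pi * (m%:~R * x) + th) + sin (2 * pi * (m%:~R * x) + th)) = 0.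
Proof.
move=> m0; pose c : R := 2 * pi * m%:~R.
have c0 : c != 0 by rewrite !mulf_neq0// ?intr_eq0// gt_eqF// pi_gt0.
pose f (x : R) : R := cos (c * x + th) + sin (c * x + th).
pose F (x : R) : R := c^-1 * (sin (c * x + th) - cos (c * x + th)).
have dF (x : R) : is_derive x (1 : R) F (f x).
  rewrite /F /f; apply: is_derive_eq.
  by rewrite /GRing.scale/= !(mulr1, mul1r, mulr0, addr0, add0r); field.
have cf : continuous f.
  move=> x; apply: differentiable_continuous; apply/derivable1_diffP.
  by apply: ex_derive.
have intf : lebesgue_measure.-integrable `[0, 1] (EFin \o f).
  apply: continuous_compact_integrable; first exact: segment_compact.
  exact: continuous_subspaceT.
transitivity (\int[lebesgue_measure]_(x in `[0, 1[) f x).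
  by apply: eq_Rintegral => x _; rewrite /f /c !mulrA.
rewrite Rintegral_itv_bndo_bndc; last first.
  by apply: integrableS intf => //; apply: subset_itvl; rewrite bnd_simp.
rewrite /Rintegral (@continuous_FTC2 _ f F)//=.
- have -> : F 1 = F 0; last by rewrite subrr.
  have c1 : c * 1 + th = th + 2 * pi * m%:~R by rewrite mulr1 addrC.
  rewrite /F mulr0 add0r c1.
  by rewrite !periodic_int//; [exact: cosD2pi|exact: sinD2pi].
- exact: continuous_subspaceT.
- have cF : continuous F.
    by move=> x; apply: differentiable_continuous; apply/derivable1_diffP; apply: ex_derive.
  split; first by move=> x _; apply: ex_derive.
  + by apply: cvg_at_right_filter; exact: cF.
  + by apply: cvg_at_left_filter; exact: cF.
- by move=> x _; rewrite derive1E; exact: derive_val.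
Qed.

Lemma hart_integral (R : realType) (k : int * int) :
  \int[leb2]_(x in cell) hart k x = (k == 0)%:R :> R.
Proof.
have I1 (r : R) : \int[lebesgue_measure]_(y in `[0%R, 1%R[) r = r.
  by rewrite Rintegral_cst//= lebesgue_measure_itv/= lte_fin ltr01 oppr0 adde0 mulr1.
have /= -> := @Rintegral_prod _ _ _ _ R lebesgue_measure lebesgue_measure
  `[0, 1[ `[0, 1[ (hart k) (measurable_itv _) (measurable_itv _) (integrable_hart k).
case: k => k1 k2.
have [k20|k20] := eqVneq k2 0.
  have [k10|k10] := eqVneq k1 0.
    rewrite k10 k20 eqxx; under eq_Rintegral do under eq_Rintegral do rewrite hart0.
    by rewrite !I1.
  rewrite xpair_eqE (negbTE k10) -[RHS](@cas_integral0 R k1 0 k10).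
  apply: eq_Rintegral => x _; rewrite -[RHS]I1.
  by apply: eq_Rintegral => y _; rewrite /hart /phase/= k20 mul0r !addr0.
rewrite xpair_eqE (negbTE k20) andbF -[RHS](I1 0).
apply: eq_Rintegral => x _.
rewrite -[RHS](@cas_integral0 R k2 (2 * pi * (k1%:~R * x)) k20).
by apply: eq_Rintegral => y _; rewrite /hart /phase/= mulrDr [_ * (_%:~R * x) + _]addrC.
Qed.

Section trigonometric.
Context {R : realType}.
Implicit Types (k a b : int * int) (f g : R * R -> R) (s : seq (int * int)).

Notation sq := (sqint (@leb2 R) cell).
Notation ip := (@inner R).

Definition coef f k : R := ip f (hart k).

Definition tpoly s (c : int * int -> R) (x : R * R) : R :=
  \sum_(k <- s) c k * hart k x.

Let mc := @measurable_cell R.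

Lemma integral_hartMM f a b : leb2.-integrable cell (EFin \o f) ->
  \int[leb2]_(x in cell) (f x * (hart a x * hart b x)) =
  2^-1 * (coef f (a - b) + coef f (b - a) + coef f (a + b) - coef f (- (a + b))).
Proof.
move=> fi.
have H k : leb2.-integrable cell (fun x => (f x * hart k x)%:E).
  by apply: (@integrable_mulb _ _ R leb2 cell mc f (hart k) 2 fi) => [|x _]; [exact: measurable_hart|exact: hart_bound].
transitivity (\int[leb2]_(x in cell) (2^-1 *
    (f x * hart (a - b) x + f x * hart (b - a) x + f x * hart (a + b) x -
     f x * hart (- (a + b)) x)) : R).
  by apply: eq_Rintegral => x _; rewrite hartM; ring.
rewrite RintegralZl// ?RintegralB// ?RintegralD//.
all: by do ?[apply: integrableBR => //]; do ?[apply: integrableDR => //]; exact: H.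
Qed.

(** By the product formula the inner product is half a sum of four integrals of
modes. For [a = b] the first two contribute [1] each; the last two always cancel,
as [a + b] and [- (a + b)] vanish together. *)
Lemma hart_ortho a b : ip (hart a) (hart b) = (a == b)%:R.
Proof.
have i1 : leb2.-integrable (@cell R) (EFin \o (fun=> 1 : R)).
  by apply: eq_integrable (integrable_hart 0) => // x _; rewrite /= hart0.
have c1 k : coef (fun=> 1) k = (k == 0)%:R.
  by rewrite -hart_integral; apply: eq_Rintegral => x _; rewrite mul1r.
transitivity (\int[leb2]_(x in cell) (1 * (hart a x * hart b x)) : R).
  by apply: eq_Rintegral => x _; rewrite mul1r.
rewrite integral_hartMM// !c1 !subr_eq0 oppr_eq0 (eq_sym b) addrK.
by case: eqP => _ /=; field.
Qed.

Lemma sqint_tpoly s c : sq (tpoly s c).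
Proof. by apply: sqint_sum => // k; apply: sqintZ => //; exact: sqint_hart. Qed.

Lemma inner_tpolyr f s c : sq f -> ip f (tpoly s c) = \sum_(k <- s) c k * coef f k.
Proof.
move=> sf; rewrite innerC inner_suml//; last first.
  by move=> k; apply: sqintZ => //; exact: sqint_hart.
apply: eq_bigr => k _; rewrite innerZl//; last exact: sqint_hart.
by rewrite innerC.
Qed.

Lemma coef_tpoly s c k : uniq s -> coef (tpoly s c) k = if k \in s then c k else 0.
Proof.
move=> us; rewrite /coef innerC inner_tpolyr; last exact: sqint_hart.
under eq_bigr do rewrite /coef hart_ortho.
case: ifPn => ks.
  rewrite (bigD1_seq k)//= eqxx mulr1 big1 ?addr0// => i ik.
  by rewrite eq_sym (negbTE ik) mulr0.
rewrite big_seq big1// => i is_; case: eqP => [ki|]; last by rewrite mulr0.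
by rewrite ki is_ in ks.
Qed.

Lemma coef_diff f g k : sq f -> sq g -> coef (fun x => f x - g x) k = coef f k - coef g k.
Proof. by move=> sf sg; rewrite /coef innerBl//; exact: sqint_hart. Qed.

Lemma norm_tpoly s c : uniq s -> ip (tpoly s c) (tpoly s c) = \sum_(k <- s) c k ^+ 2.
Proof.
move=> us; rewrite inner_tpolyr; last exact: sqint_tpoly.
by rewrite big_seq [RHS]big_seq; apply: eq_bigr => k ks; rewrite coef_tpoly// ks -expr2.
Qed.

Lemma defect_tpoly f s : uniq s -> sq f ->
  ip (fun x => f x - tpoly s (coef f) x) (fun x => f x - tpoly s (coef f) x) =
  ip f f - \sum_(k <- s) coef f k ^+ 2.
Proof.
move=> us sf; rewrite innerBB//; last exact: sqint_tpoly.
rewrite norm_tpoly// inner_tpolyr//.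
by under eq_bigr do rewrite -expr2; ring.
Qed.

Lemma bessel f s : uniq s -> sq f -> \sum_(k <- s) coef f k ^+ 2 <= ip f f.
Proof. by move=> us sf; rewrite -subr_ge0 -defect_tpoly//; exact: inner_ge0. Qed.

(** [f] minus its partial sum is orthogonal to all combinations of the modes in [s],
in particular to the difference between this partial sum and [tpoly s' c]. *)
Lemma best_approximation f s s' c : uniq s -> {subset s' <= s} -> sq f ->
  ip (fun x => f x - tpoly s (coef f) x) (fun x => f x - tpoly s (coef f) x) <=
  ip (fun x => f x - tpoly s' c x) (fun x => f x - tpoly s' c x).
Proof.
move=> us ss sf; set D := tpoly s (coef f); set P := tpoly s' c.
have sD : sq D by exact: sqint_tpoly.
have sP : sq P by exact: sqint_tpoly.
have fP : ip f P = ip D P.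
  rewrite !inner_tpolyr// !big_seq; apply: eq_bigr => k ks'.
  by rewrite coef_tpoly// ss.
have fD : ip f D = ip D D.
  rewrite [RHS]inner_tpolyr// inner_tpolyr//.
  by rewrite !big_seq; apply: eq_bigr => k ks; rewrite coef_tpoly// ks.
have := inner_ge0 (fun x => D x - P x).
rewrite !innerBB// fP fD; lra.
Qed.

End trigonometric.

(** * Density of the trigonometric polynomials *)

Section density.
Context {R : realType}.
Implicit Types (k a b : int * int) (f g : R * R -> R) (s : seq (int * int)).

Notation sq := (sqint (@leb2 R) cell).
Notation ip := (@inner R).

Let mc := @measurable_cell R.

(** The algebra of trigonometric polynomials, as an inductive predicate so that its
properties follow by induction without handling lists of coefficients. *)
Inductive trig : (R * R -> R) -> Prop :=
| trig_hart k : trig (hart k)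
| trigD f g : trig f -> trig g -> trig (fun x => f x + g x)
| trigZ (r : R) f : trig f -> trig (fun x => r * f x).

Lemma trig_sqint f : trig f -> sq f.
Proof.
elim=> [k|{}f g _ sf _ sg|r {}f _ sf]; [exact: sqint_hart|exact: sqintD|exact: sqintZ].
Qed.

Lemma trig_bounded f : trig f -> exists M, forall x, `|f x| <= M.
Proof.
elim=> [k|{}f g _ [M fM] _ [N gN]|r {}f _ [M fM]].
- by exists 2 => x; exact: hart_bound.
- by exists (M + N) => x; rewrite (le_trans (ler_normD _ _))// lerD.
- by exists (`|r| * M) => x; rewrite normrM ler_wpM2l.
Qed.

Lemma trigM f g : trig f -> trig g -> trig (fun x => f x * g x).
Proof.
move=> tf tg; elim: tf => [a|{}f f' _ ih1 _ ih2|r {}f _ ih].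
- elim: tg => [b|{}g g' _ ih1 _ ih2|r {}g _ ih].
  + have -> : (fun x : R * R => hart a x * hart b x) = (fun x : R * R => 2^-1 *
      (hart (a - b) x + hart (b - a) x + hart (a + b) x + (- 1) * hart (- (a + b)) x)).
      by apply/funext => x; rewrite hartM mulN1r.
    by apply: trigZ; apply: trigD; [apply: trigD; [apply: trigD|]|apply: trigZ];
      exact: trig_hart.
  + by under eq_fun do rewrite mulrDr; exact: trigD.
  + by under eq_fun do rewrite mulrCA; exact: trigZ.
- by under eq_fun do rewrite mulrDl; exact: trigD.
- by under eq_fun do rewrite -mulrA; exact: trigZ.
Qed.

Lemma trig_cst (r : R) : trig (fun=> r).
Proof.
by have := trigZ r (trig_hart 0); under eq_fun do rewrite hart0 mulr1.
Qed.

(** The list of modes may be enlarged at will: this makes it possible to compare a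
polynomial with the partial sums over large boxes. *)
Lemma trig_tpoly f : trig f ->
  exists s, forall s', uniq s' -> {subset s <= s'} -> f =1 tpoly s' (coef f).
Proof.
elim=> [k|{}f g tf [s1 h1] tg [s2 h2]|r {}f tf [s h]].
- exists [:: k] => s' us' ss' x; rewrite /tpoly.
  have ks' : k \in s' by rewrite ss' ?inE.
  rewrite (bigD1_seq k)//= /coef hart_ortho eqxx mul1r big1 ?addr0// => i ik.
  by rewrite hart_ortho eq_sym (negbTE ik) mul0r.
- exists (s1 ++ s2) => s' us' ss' x; rewrite /tpoly.
  rewrite (h1 s')// => [|k ks]; last by rewrite ss'// mem_cat ks.
  rewrite (h2 s')// => [|k ks]; last by rewrite ss'// mem_cat ks orbT.
  rewrite -big_split; apply: eq_bigr => k _ /=.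
  by rewrite /coef innerDl ?mulrDl//; [exact: trig_sqint|exact: trig_sqint|exact: sqint_hart].
- exists s => s' us' ss' x; rewrite /tpoly (h s')// mulr_sumr.
  apply: eq_bigr => k _; rewrite /coef innerZl ?mulrA//; [exact: trig_sqint|exact: sqint_hart].
Qed.

Definition trig_limit f := sq f /\ forall e, 0 < e ->
  exists2 P, trig P & ip (fun x => f x - P x) (fun x => f x - P x) < e.

Lemma trig_limit_trig f : trig f -> trig_limit f.
Proof.
move=> tf; split; first exact: trig_sqint.
move=> e e0; exists f => //; rewrite /inner.
by under eq_Rintegral do rewrite subrr mulr0; rewrite Rintegral_cst// mul0r.
Qed.

Lemma trig_limit_closed f : sq f -> (forall e, 0 < e -> exists2 g, trig_limit g &
  ip (fun x => f x - g x) (fun x => f x - g x) < e) -> trig_limit f.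
Proof.
move=> sf H; split=> // e e0.
have e4 : 0 < e / 4 by rewrite divr_gt0.
have [g [sg gl] fg] := H _ e4; have [P tP gP] := gl _ e4; exists P => //.
apply: le_lt_trans (inner_triangle sf sg (trig_sqint tP)) _; lra.
Qed.

Lemma eq_trig_limit f g : {in cell, f =1 g} -> trig_limit f -> trig_limit g.
Proof.
move=> fg tf; apply: trig_limit_closed.
  by case: tf => sf _; exact: (eq_sqint mc fg sf).
move=> e e0; exists f => //; rewrite (_ : ip _ _ = 0)//.
rewrite (@eq_inner _ _ (fun=> 0) _ (fun=> 0)) ?inner0l// => x xc.
  by rewrite fg// subrr.
by rewrite fg// subrr.
Qed.

Lemma trig_limitD f g : trig_limit f -> trig_limit g -> trig_limit (fun x => f x + g x).
Proof.
move=> [sf lf] [sg lg]; split=> [|e e0]; first exact: sqintD.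
have e4 : 0 < e / 4 by rewrite divr_gt0.
have [P tP fP] := lf _ e4; have [Q tQ gQ] := lg _ e4.
exists (fun x => P x + Q x); first exact: trigD.
have sP := trig_sqint tP; have sQ := trig_sqint tQ.
have H := inner_add_le (sqintB mc sf sP) (sqintB mc sg sQ).
have -> : (fun x => f x + g x - (P x + Q x)) = (fun x => (f x - P x) + (g x - Q x)).
  by apply/funext => x; ring.
by apply: (le_lt_trans H); lra.
Qed.

(** Multiplication by a bounded [g] is continuous in [L^2], so it is enough to treat
polynomials. Used twice, it gives products of bounded limits: one factor is first
reduced to a polynomial, then the other. *)
Lemma trig_limit_mulb f g (M : R) : trig_limit f -> sq (fun x => f x * g x) ->
  measurable_fun cell g ->
  (forall x, cell x -> `|g x| <= M) ->
  (forall P, trig P -> trig_limit (fun x => P x * g x)) ->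
  trig_limit (fun x => f x * g x).
Proof.
move=> [sf lf] sfg mg gM H; apply: trig_limit_closed => // e e0.
have M0 : 0 < M ^+ 2 + 1 by rewrite ltr_pwDr ?sqr_ge0.
have [P tP fP] := lf _ (divr_gt0 e0 M0).
exists (fun x => P x * g x); first exact: H.
have sfP := sqintB mc sf (trig_sqint tP).
rewrite ltr_pdivlMr// mulrC in fP; apply: le_lt_trans fP.
rewrite /inner -RintegralZl//; last exact: sqint_mul.
apply: le_Rintegral => //.
- have := sqint_mulb mc sfP mg gM => sfPg.
  have := sqint_mul mc sfPg sfPg.
  by apply: eq_integrable => // x _ /=; congr EFin; ring.
- by apply: integrableZR => //; exact: sqint_mul.
- move=> x xc; rewrite -mulrBl mulrACA mulrC ler_wpM2r -?expr2 ?sqr_ge0//.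
  have := gM x xc; have := normr_ge0 (g x); rewrite -(real_normK (num_real (g x))); nra.
Qed.

Lemma trig_limitM f g (M N : R) : trig_limit f -> trig_limit g ->
  (forall x, cell x -> `|f x| <= M) -> (forall x, cell x -> `|g x| <= N) ->
  trig_limit (fun x => f x * g x).
Proof.
move=> tf tg fM gN; have [[mf _] _] := tf; have [[mg _] _] := tg.
have sf := tf.1; have sg := tg.1.
apply: (@trig_limit_mulb _ _ N) => //; first exact: (sqint_mulb mc sf mg gN).
move=> P tP; have [K PK] := trig_bounded tP; have [mP _] := trig_sqint tP.
under eq_fun do rewrite mulrC.
apply: (@trig_limit_mulb _ _ K) => //; first by apply: (sqint_mulb mc sg mP) => x _; exact: PK.
by move=> Q tQ; apply: trig_limit_trig; exact: trigM.
Qed.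

End density.

Section step.
Context {R : realType}.

Lemma bernoulli_sub (t : R) (m : nat) : 0 <= t <= 1 -> 1 - m%:R * t <= (1 - t) ^+ m.
Proof.
move=> /andP[t0 t1]; elim: m => [|m ih]; first by rewrite mul0r subr0 expr0.
rewrite exprS; have : (1 - t) * (1 - m%:R * t) <= (1 - t) * (1 - t) ^+ m.
  by rewrite ler_wpM2l// subr_ge0.
apply: le_trans; have : 0 <= m%:R * t * t by rewrite !mulr_ge0.
rewrite -natr1; lra.
Qed.

Lemma bernoulli_add (t : R) (m : nat) : 0 <= t -> 1 + m%:R * t <= (1 + t) ^+ m.
Proof.
move=> t0; elim: m => [|m ih]; first by rewrite mul0r addr0 expr0.
rewrite exprS; have : (1 + t) * (1 + m%:R * t) <= (1 + t) * (1 + t) ^+ m.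
  by rewrite ler_wpM2l// addr_ge0.
apply: le_trans; have : 0 <= m%:R * t * t by rewrite !mulr_ge0.
rewrite -natr1; lra.
Qed.

Lemma natr_exp_bound (q : R) (n : nat) : 0 <= q < 1 -> n%:R * q ^+ n <= (1 - q)^-1.
Proof.
move=> /andP[q0 q1]; rewrite -[leRHS]mul1r ler_pdivlMr ?subr_gt0//.
suff : n%:R * q ^+ n * (1 - q) <= 1 - q ^+ n.
  by move=> /le_trans; apply; rewrite gerBl exprn_ge0.
elim: n => [|n ih]; first by rewrite !mul0r expr0 subrr.
have qn : 0 <= q ^+ n by rewrite exprn_ge0.
have nq : 0 <= n%:R * q ^+ n by rewrite mulr_ge0.
have -> : n.+1%:R * q ^+ n.+1 * (1 - q) = q * (n%:R * q ^+ n * (1 - q)) + q * q ^+ n * (1 - q).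
  by rewrite exprS -natr1; ring.
rewrite exprS; have : q * (n%:R * q ^+ n * (1 - q)) <= q * (1 - q ^+ n).
  by rewrite ler_wpM2l.
have : 0 <= (1 - q) * (1 - q * q ^+ n).
  by rewrite -exprS mulr_ge0 ?subr_ge0 ?exprn_ile1// ltW.
nra.
Qed.

(** Polynomials in [y] that converge to the indicator of [y < 1/2] on the unit
interval. Where [2 y < 1], the total exponent [n * 4 ^ n] is compensated by
[y ^ (2 n)]; where [2 y >= 1], the power [4 ^ n] brings the base down to at most
[1/2], and the outer power [n] sends it to zero, including at [y = 1/2]. *)
Definition step (n : nat) (y : R) : R := ((1 - y ^+ (2 * n)) ^+ (4 ^ n)) ^+ n.

Lemma step_cvg (y : R) : 0 <= y <= 1 -> step n y @[n --> \oo] --> ((y < 2^-1)%R%:R : R).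
Proof.
move=> /andP[y0 y1].
have yn n : 0 <= y ^+ n <= 1 by rewrite exprn_ge0//= exprn_ile1.
have y1n n : 0 <= 1 - y ^+ n <= 1 by have := yn n; lra.
have [y2|y2] := ltP y 2^-1.
- pose q := 2 * y; have q01 : 0 <= q < 1 by rewrite /q; lra.
  have lb n : 1 - (1 - q)^-1 * q ^+ n <= step n y.
    rewrite /step -exprM; apply: le_trans (bernoulli_sub _ (yn _)).
    rewrite lerD2l lerN2.
    have -> : (4 ^ n * n)%:R * y ^+ (2 * n) = n%:R * q ^+ n * q ^+ n.
      transitivity (n%:R * (4 * y ^+ 2) ^+ n).
        by rewrite natrM natrX exprMn (exprM y) mulrCA mulrA.
      by rewrite -mulrA -exprMn /q; congr (_ * _ ^+ _); ring.
    by rewrite ler_wpM2r ?natr_exp_bound// exprn_ge0//; case/andP: q01.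
  have ub n : step n y <= 1.
    by rewrite /step !exprn_ile1 ?exprn_ge0//; case/andP: (y1n (2 * n)%N).
  apply: (@squeeze_cvgr _ _ _ _ (fun n => 1 - (1 - q)^-1 * q ^+ n) (cst 1)); last exact: cvg_cst.
  + by apply: nearW => n; apply/andP; split; [exact: lb|exact: ub].
  + rewrite -[X in _ --> X]subr0; apply: cvgB; first exact: cvg_cst.
    rewrite -[X in _ --> X](mulr0 (1 - q)^-1); apply: cvgM; first exact: cvg_cst.
    by apply: cvg_expr; rewrite ger0_norm; case/andP: q01.
- have ub n : step n y <= (2^-1) ^+ n.
    rewrite /step lerXn2r ?nnegrE ?exprn_ge0//; try by case/andP: (y1n (2 * n)%N).
    set t := y ^+ (2 * n); have t01 := yn (2 * n)%N.
    have t4 : 1 <= (4 ^ n)%:R * t.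
      rewrite /t exprM natrX -exprMn exprn_ege1//; nra.
    have H1 : (1 - t) ^+ (4 ^ n) * (1 + t) ^+ (4 ^ n) <= 1.
      rewrite -exprMn exprn_ile1//; move: t01; rewrite -/t; nra.
    have H2 : 2 <= (1 + t) ^+ (4 ^ n).
      by apply: le_trans (bernoulli_add _ _); [lra|case/andP: t01].
    have H3 : 0 <= (1 - t) ^+ (4 ^ n) by rewrite exprn_ge0//; case/andP: (y1n (2 * n)%N).
    nra.
  have lb n : 0 <= step n y.
    by rewrite /step !exprn_ge0//; case/andP: (y1n (2 * n)%N).
  apply: (@squeeze_cvgr _ _ _ _ (cst 0) (fun n => 2^-1 ^+ n)); last first.
  + by apply: cvg_expr; rewrite ger0_norm// invf_lt1// ltr1n.
  + exact: cvg_cst.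
  + by apply: nearW => n; rewrite lb ub.
Qed.

Lemma step_bound n (y : R) : 0 <= y <= 1 -> 0 <= step n y <= 1.
Proof.
move=> /andP[y0 y1].
have : 0 <= y ^+ (2 * n) <= 1 by rewrite exprn_ge0//= exprn_ile1.
move=> /andP[h0 h1]; have h2 : 0 <= 1 - y ^+ (2 * n) <= 1 by lra.
by rewrite /step !exprn_ge0//= ?exprn_ile1 ?exprn_ge0//; case/andP: h2.
Qed.

(** On a circle of length one parametrized from [0], the arc from [a] to [1] is cut
out by half-planes: the lower half-plane and a half-plane bounded by the vertical
line through the point [a]. If [a <= 1/2] the arc is their union, and otherwise
their intersection. *)
Lemma le_arc (a x : R) : 0 < a < 1 -> 0 <= x < 1 ->
  (a <= x) = if a <= 2^-1
    then (sin (2 * pi * x) < 0) || (cos (2 * pi * x) <= cos (2 * pi * a))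
    else (sin (2 * pi * x) < 0) && (cos (2 * pi * a) <= cos (2 * pi * x)).
Proof.
move=> a01 x01; have p0 := pi_gt0 R.
have sx : (sin (2 * pi * x) < 0) = (2^-1 < x).
  have [xl|xg] := leP x 2^-1.
    apply/negbTE; rewrite -leNgt sin_ge0_pi//; apply/andP; split; first nra.
    have -> : 2 * pi * x = pi * (2 * x) by ring.
    by rewrite ger_pMr//; lra.
  rewrite -[2 * pi * x](subrK pi) sinDpi oppr_lt0 sin_gt0_pi//; apply/andP; split; nra.
have cE (b c : R) : 0 <= b <= 2^-1 -> 0 <= c <= 2^-1 ->
    (cos (2 * pi * b) <= cos (2 * pi * c)) = (c <= b).
  move=> b2 c2; rewrite !leNgt ltr_cos ?in_itv/=.
  - by rewrite ltr_pM2l// mulr_gt0.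
  - by apply/andP; split; nra.
  - by apply/andP; split; nra.
have cN (b : R) : cos (2 * pi * b) = cos (2 * pi * (1 - b)).
  by rewrite -[RHS]cosN -[RHS]cosD2pi; congr cos; rewrite -mulr_natl; ring.
rewrite sx; case: ifPn => [al|]; last first.
  rewrite -ltNge => ag; have [xg|xl] /= := ltP 2^-1 x; last by apply/negbTE; lra.
  rewrite (cN a) (cN x) cE; lra.
have [xg|xl] /= := ltP 2^-1 x; first by lra.
by rewrite cE//; lra.
Qed.

End step.

Section measurable_density.
Context {R : realType}.
Implicit Types (f g : R * R -> R) (A B : set (R * R)).

Notation sq := (sqint (@leb2 R) cell).
Notation ip := (@inner R).

Let mc := @measurable_cell R.

(** Bounded pointwise limits stay in the closure, by dominated convergence. *)
Lemma trig_limit_dom (f_ : nat -> R * R -> R) f (M : R) :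
  (forall n, trig_limit (f_ n)) ->
  (forall x, cell x -> f_ n x @[n --> \oo] --> f x) ->
  (forall n x, cell x -> `|f_ n x| <= M) -> trig_limit f.
Proof.
move=> tf f_f fM.
have mf : measurable_fun (cell : set (measurableTypeR R * measurableTypeR R)) f.
  by apply: (measurable_fun_cvg _ f_f) => // n; case: (tf n) => -[].
have fM' x : cell x -> `|f x| <= M.
  move=> xc; have c : `|f_ n x| @[n --> \oo] --> `|f x| by apply: cvg_norm; exact: f_f.
  rewrite -(cvg_lim _ c)//; apply: limr_le; first exact: (cvgP _ c).
  by apply: nearW => n; exact: fM.
have sf : sq f by exact: (sqint_bounded mc leb2_cell_fin mf fM').
apply: trig_limit_closed => // e e0.
have : ip (fun x => f x - f_ n x) (fun x => f x - f_ n x) @[n --> \oo] --> (0 : R).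
  have -> : (0 : R) = \int[leb2]_(x in cell) 0 by rewrite Rintegral_cst// mul0r.
  apply: (@Rdominated_cvg _ _ R leb2 cell mc _ _ (fun=> (M + M) ^+ 2)).
  - move=> n; have sd := sqintB mc sf (tf n).1.
    by apply: measurable_funM; case: sd.
  - exact: measurable_cst.
  - apply: aeW => x xc; rewrite -[X in _ --> X](mulr0 0) -(subrr (f x)).
    by apply: cvgM; apply: cvgB; [exact: cvg_cst|exact: f_f|exact: cvg_cst|exact: f_f].
  - have [] : sq (fun=> M + M); last by [].
    apply: (@sqint_bounded _ _ R leb2 cell mc _ `|M + M|) => //.
    exact: leb2_cell_fin.
  - apply: aeW => x xc n; rewrite -expr2 normrX lerXn2r ?nnegrE//.
      by rewrite (le_trans _ (lerD (fM' _ xc) (fM' _ xc)))// addr_ge0.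
    by rewrite (le_trans (ler_normB _ _))// lerD// ?fM'// fM.
move=> /cvgrPdist_lt/(_ e e0)[n _ /(_ n (leqnn n))].
rewrite sub0r normrN ger0_norm ?inner_ge0// => H.
by exists (f_ n).
Qed.

Lemma trig_limit_cst (r : R) : trig_limit (fun=> r).
Proof. exact/trig_limit_trig/trig_cst. Qed.

Lemma trig_limitZ (r : R) f : trig_limit f -> trig_limit (fun x => r * f x).
Proof.
move=> tf; have sf := tf.1.
under eq_fun do rewrite mulrC.
apply: (@trig_limit_mulb _ _ _ `|r|) => //.
- by under eq_fun do rewrite mulrC; exact: sqintZ.
- by move=> P tP; apply: trig_limit_trig; under eq_fun do rewrite mulrC; exact: trigZ.
Qed.

Lemma trig_limitX f n : trig_limit f -> (forall x, cell x -> `|f x| <= 1) ->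
  trig_limit (fun x => f x ^+ n).
Proof.
move=> tf f1; elim: n => [|n ih]; first exact: trig_limit_cst.
under eq_fun do rewrite exprS; apply: (trig_limitM tf ih f1) (_ : forall x, _ -> _ <= 1).
by move=> x xc; rewrite normrX exprn_ile1// f1.
Qed.

Lemma trig_limit_below f : trig_limit f -> (forall x, cell x -> 0 <= f x <= 1) ->
  trig_limit (\1_[set x | f x < 2^-1] : R * R -> R).
Proof.
move=> tf f01.
have f1 x : cell x -> `|f x| <= 1 by move=> /f01 /andP[? ?]; rewrite ger0_norm.
apply: (@trig_limit_dom (fun n x => step n (f x)) _ 1).
- move=> n; rewrite /step; apply: trig_limitX.
    apply: trig_limitX.
      have := trig_limitD (trig_limit_cst 1) (trig_limitZ (-1) (trig_limitX (2 * n) tf f1)).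
      by under eq_fun do rewrite mulN1r.
    move=> x /f01 /andP[h0 h1].
    by rewrite ger0_norm ?subr_ge0 ?exprn_ile1// gerBl exprn_ge0.
  move=> x /f01 /andP[h0 h1]; rewrite normrX exprn_ile1//.
  by rewrite ger0_norm ?subr_ge0 ?exprn_ile1// gerBl exprn_ge0.
- move=> x /f01 h; rewrite indicE.
  have -> : (x \in [set x | f x < 2^-1]) = (f x < 2^-1) by apply/idP/idP; rewrite inE.
  exact: step_cvg.
- by move=> n x /f01 h; have /andP[h0 h1] := step_bound n h; rewrite ger0_norm.
Qed.

Definition trig_set A := trig_limit (\1_A : R * R -> R).

Let indic1 A x : `|\1_A x : R| <= 1.
Proof. by rewrite indicE normr_nat; case: (_ \in _). Qed.

Lemma trig_setC A : trig_set A -> trig_set (~` A).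
Proof.
move=> tA; have := trig_limitD (trig_limit_cst 1) (trig_limitZ (-1) tA).
apply: eq_trig_limit => x _; rewrite !indicE in_setC mulN1r.
by case: (_ \in _); rewrite ?subrr ?subr0.
Qed.

Lemma trig_setI A B : trig_set A -> trig_set B -> trig_set (A `&` B).
Proof.
move=> tA tB; have := trig_limitM tA tB (fun x _ => indic1 A x) (fun x _ => indic1 B x).
apply: eq_trig_limit => x _; rewrite !indicE in_setI.
by case: (_ \in A); rewrite ?mul1r ?mul0r.
Qed.

Lemma trig_setU A B : trig_set A -> trig_set B -> trig_set (A `|` B).
Proof.
move=> tA tB; rewrite -(setCK (A `|` B)) setCU.
by apply: trig_setC; apply: trig_setI; exact: trig_setC.
Qed.

Lemma trig_set0 : trig_set set0.
Proof. by apply: eq_trig_limit (trig_limit_cst 0) => x _; rewrite indic0. Qed.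

(** The sets whose indicator is a limit of trigonometric polynomials form a
sigma-algebra: intersections are products, and countable unions are bounded
pointwise limits of finite ones. It contains the sets cut out by a trigonometric
inequality, thanks to [step], hence the half-lines in each coordinate by [le_arc],
hence all Borel sets. *)
Lemma trig_set_sigma : sigma_algebra setT trig_set.
Proof.
split; first exact: trig_set0.
- by move=> A tA; rewrite setTD; exact: trig_setC.
- move=> A tA; pose F n := \big[setU/set0]_(i < n) A i.
  have tF n : trig_set (F n).
    rewrite /F; elim: n => [|n ih]; first by rewrite big_ord0; exact: trig_set0.
    by rewrite big_ord_recr; exact: trig_setU.
  apply: (@trig_limit_dom (fun n => \1_(F n)) _ 1) => [//|x xc|n x _]; last exact: indic1.
  have [[i _ Aix]|nx] := pselect ((\bigcup_k A k) x).
    rewrite indicE mem_set//; last by exists i.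
    apply: cvg_near_cst; exists i.+1 => // n /= ni; rewrite indicE mem_set//.
    by rewrite /F -bigcup_mkord; exists i.
  rewrite indicE memNset//; apply: cvg_near_cst; apply: nearW => n.
  rewrite indicE memNset//= /F -bigcup_mkord => -[i _ Aix]; apply: nx; by exists i.
Qed.

Lemma trig_set_lt f (c : R) : trig f -> (forall x, `|f x| <= 1) -> -1 <= c <= 1 ->
  trig_set [set x | f x < c].
Proof.
move=> tf f1 c1.
(* This affine change sends values in [-1, 1] to [0, 1], and [c] to [1/2]. *)
have tg : trig (fun x => 4^-1 * (f x + (2 - c))).
  by apply: trigZ; apply: trigD => //; exact: trig_cst.
have := trig_limit_below (trig_limit_trig tg) _.
rewrite /trig_set (_ : [set x | 4^-1 * (f x + (2 - c)) < 2^-1] = [set x | f x < c]).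
  apply => x _; have := f1 x; rewrite ler_norml; lra.
by apply/seteqP; split => x /=; lra.
Qed.

Section coordinate.
Variables (pr : R * R -> R) (e : int * int).
Hypothesis pr_phase : forall x, phase e x = 2 * pi * pr x.
Hypothesis pr_cell : forall x, cell x -> 0 <= pr x < 1.

Let tcos : trig (fun x => cos (2 * pi * pr x)).
Proof.
have -> : (fun x => cos (2 * pi * pr x)) = (fun x => 2^-1 * (hart e x + hart (- e) x)).
  by apply/funext => x; rewrite -pr_phase /hart phaseN cosN sinN; field.
by apply: trigZ; apply: trigD; exact: trig_hart.
Qed.

Let tsin : trig (fun x => sin (2 * pi * pr x)).
Proof.
have -> : (fun x => sin (2 * pi * pr x)) = (fun x => 2^-1 * (hart e x + (-1) * hart (- e) x)).
  by apply/funext => x; rewrite -pr_phase /hart phaseN cosN sinN; field.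
by apply: trigZ; apply: trigD; [|apply: trigZ]; exact: trig_hart.
Qed.

Let tle : forall a, trig_set (pr @^-1` `[a, +oo[).
Proof.
move=> a.
have [a0|a0] := leP a 0.
  apply: eq_trig_limit (trig_limit_cst 1) => x /[!inE] xc.
  rewrite indicE mem_set//= in_itv/= andbT (le_trans a0)//.
  by case/andP: (pr_cell xc).
have [a1|a1] := leP 1 a.
  apply: eq_trig_limit (trig_limit_cst 0) => x /[!inE] xc.
  rewrite indicE memNset//= in_itv/= andbT => /(le_trans a1).
  by apply/negP; rewrite -ltNge; case/andP: (pr_cell xc).
have c1 (t : R) : -1 <= cos t <= 1 by rewrite cos_geN1 cos_le1.
have s1 (t : R) : -1 <= sin t <= 1 by rewrite sin_geN1 sin_le1.
have tS : trig_set [set x | sin (2 * pi * pr x) < 0].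
  by apply: trig_set_lt => // [x|]; rewrite ?ler_norml ?s1//; lra.
have tC : trig_set [set x | cos (2 * pi * pr x) < cos (2 * pi * a)].
  by apply: trig_set_lt => // x; rewrite ler_norml.
have tC' : trig_set [set x | -1 * cos (2 * pi * pr x) < - cos (2 * pi * a)].
  apply: trig_set_lt => [|x|]; first exact: trigZ.
    by rewrite mulN1r normrN ler_norml.
  by have := c1 (2 * pi * a); lra.
have E x : cell x -> (a <= pr x) = if a <= 2^-1
    then (sin (2 * pi * pr x) < 0) || (cos (2 * pi * pr x) <= cos (2 * pi * a))
    else (sin (2 * pi * pr x) < 0) && (cos (2 * pi * a) <= cos (2 * pi * pr x)).
  by move=> /pr_cell xc; apply: le_arc => //; rewrite a0 a1.
have [al|al] := boolP (a <= 2^-1).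
- rewrite al in E.
  apply: eq_trig_limit (trig_setU tS (trig_setC tC')) => x /[!inE] xc.
  rewrite !indicE; congr ((nat_of_bool _)%:R); apply/idP/idP; rewrite !inE /= in_itv/= andbT E//.
    by move=> [->//|]; rewrite mulN1r ltrN2 => /negP; rewrite -leNgt => ->; rewrite orbT.
  by move=> /orP[|h]; [left|right; rewrite mulN1r ltrN2; apply/negP; rewrite -leNgt].
- rewrite (negbTE al) in E.
  apply: eq_trig_limit (trig_setI tS (trig_setC tC)) => x /[!inE] xc.
  rewrite !indicE; congr ((nat_of_bool _)%:R); apply/idP/idP; rewrite !inE /= in_itv/= andbT E//.
    by move=> [-> /negP]; rewrite -leNgt.
  by move=> /andP[? h]; split => //; apply/negP; rewrite -leNgt.
Qed.

(** The sets of reals with this property form a sigma-algebra, which is generated by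
the half-lines [a, +oo[. *)
Lemma trig_set_coordinate (B : set R) : measurable B -> trig_set (pr @^-1` B).
Proof.
have [s0 sC sU] := trig_set_sigma.
move=> mB; have : (@RGenCInfty.G R).-sigma.-measurable B.
  by rewrite -RGenCInfty.measurableE; exact: mB.
suff : (@RGenCInfty.G R).-sigma.-measurable `<=` [set C | trig_set (pr @^-1` C)] by apply.
apply: smallest_sub.
  split.
  - by rewrite /= preimage_set0.
  - by move=> A /= tA; rewrite setTD preimage_setC -setTD; exact: sC.
  - by move=> A /= tA; rewrite preimage_bigcup; exact: sU.
by move=> _ [a ->]; exact: tle.
Qed.

End coordinate.

Lemma trig_set_measurable A :
  measurable (A : set (measurableTypeR R * measurableTypeR R)) -> trig_set A.
Proof.
move: A; suff : (@measurable _ (measurableTypeR R * measurableTypeR R)%type) `<=` trig_set by [].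
apply: smallest_sub; first exact: trig_set_sigma.
move=> B [[C mC <-]|[C mC <-]]; rewrite setTI.
- apply: (@trig_set_coordinate _ (1, 0)) mC => [x|[x1 x2] [/=]]; first by rewrite /phase/=; ring.
  by rewrite in_itv.
- apply: (@trig_set_coordinate _ (0, 1)) mC => [x|[x1 x2] [/= _]]; first by rewrite /phase/=; ring.
  by rewrite in_itv.
Qed.

End measurable_density.

Section square_density.
Context {R : realType}.
Implicit Types (f g : R * R -> R).

Notation sq := (sqint (@leb2 R) cell).
Notation ip := (@inner R).
Notation plane := (measurableTypeR R * measurableTypeR R)%type.

Let mc := @measurable_cell R.

Import HBNNSimple.

Lemma trig_limit_nnsfun (g : {nnsfun plane >-> R}) : trig_limit (g : plane -> R).
Proof.
have /funext -> := fimfunEord g.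
elim: (index_enum _) => [|i r ih].
  by under eq_fun do rewrite big_nil; exact: trig_limit_cst.
under eq_fun do rewrite big_cons; apply: trig_limitD => //.
apply: trig_limitZ; apply: trig_set_measurable; exact: measurable_sfunP.
Qed.

(** [f] is a limit of an increasing sequence of simple functions, in [L^2] by
dominated convergence, and simple functions are combinations of indicators. *)
Lemma trig_dense_ge0 f : sq f -> (forall x, 0 <= f x) -> trig_limit f.
Proof.
move=> sf f0; have [mf if2] := sf.
have mF : measurable_fun (cell : set plane) (EFin \o f) by exact/measurable_EFinP.
pose a := nnsfun_approx mc mF.
have acvg x : cell x -> a n x @[n --> \oo] --> f x.
  move=> xc; have /fine_cvg := cvg_nnsfun_approx mc mF (fun x _ => (f0 x : (0 <= (EFin \o f) x)%E)) xc.
  exact.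
have ale n x : cell x -> 0 <= a n x <= f x.
  move=> xc; apply/andP; split; first by [].
  have nd : nondecreasing_seq (fun n => a n x).
    by move=> i j ij; have /lefP := nd_nnsfun_approx mc mF ij; exact.
  have /cvg_lim <- // := acvg x xc.
  by apply: nondecreasing_cvgn_le => //; apply: cvgP; exact: acvg.
apply: trig_limit_closed => // e e0.
have : ip (fun x => f x - a n x) (fun x => f x - a n x) @[n --> \oo] --> (0 : R).
  have -> : (0 : R) = \int[leb2]_(x in cell) 0 by rewrite Rintegral_cst// mul0r.
  apply: (@Rdominated_cvg _ _ R leb2 cell mc _ _ (fun x => f x ^+ 2)) => //.
  - move=> n; have sd := sqintB mc sf (trig_limit_nnsfun (a n)).1.
    by apply: measurable_funM; case: sd.
  - apply: aeW => x xc; rewrite -[X in _ --> X](mulr0 0) -(subrr (f x)).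
    by apply: cvgM; apply: cvgB; [exact: cvg_cst|exact: acvg|exact: cvg_cst|exact: acvg].
  - apply: aeW => x xc n; have /andP[a0 af] := ale n x xc.
    by rewrite -expr2 normrX ger0_norm ?subr_ge0// lerXn2r ?nnegrE ?subr_ge0// gerBl.
move=> /cvgrPdist_lt/(_ e e0)[n _ /(_ n (leqnn n))].
rewrite sub0r normrN ger0_norm ?inner_ge0// => H.
by exists (a n) => //; exact: trig_limit_nnsfun.
Qed.

Lemma trig_dense f : sq f -> trig_limit f.
Proof.
move=> sf; have [mf if2] := sf.
have sa : sq (fun x => `|f x|).
  split; first exact: measurableT_comp.
  by move: if2; apply: eq_integrable => // x _; rewrite real_normK ?num_real.
have tp : trig_limit (fun x => `|f x| + f x).
  apply: trig_dense_ge0 => [|x]; first exact: sqintD.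
  by rewrite -lerBlDr sub0r -normrN ler_norm.
have tm : trig_limit (fun x => `|f x| - f x).
  by apply: trig_dense_ge0 => [|x]; [exact: sqintB|rewrite subr_ge0 ler_norm].
have := trig_limitD (trig_limitZ 2^-1 tp) (trig_limitZ (- 2^-1) tm).
by apply: eq_trig_limit => x _; field.
Qed.

End square_density.

Section partial_sums.
Context {R : realType}.
Implicit Types (f g : R * R -> R) (k : int * int).

Notation sq := (sqint (@leb2 R) cell).
Notation ip := (@inner R).

Let mc := @measurable_cell R.

Definition segment (N : nat) : seq int := [seq m%:Z - N%:Z | m <- iota 0 (2 * N).+1].

Definition box (N : nat) : seq (int * int) := [seq (i, j) | i <- segment N, j <- segment N].

Lemma mem_segment N (i : int) : (i \in segment N) = (`|i| <= N)%N.
Proof.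
apply/mapP/idP => [[m]|iN]; first by rewrite mem_iota => ? ->; lia.
by exists (absz (i + N%:Z)); [rewrite mem_iota|]; lia.
Qed.

Lemma uniq_segment N : uniq (segment N).
Proof. by rewrite map_inj_uniq ?iota_uniq// => i j; lia. Qed.

Lemma mem_box N k : (k \in box N) = (`|k.1| <= N)%N && (`|k.2| <= N)%N.
Proof.
case: k => i j; rewrite -!mem_segment; apply/allpairsP/andP => /=.
  by move=> [[a b] [/= ha hb [-> ->]]].
by move=> [hi hj]; exists (i, j).
Qed.

Lemma uniq_box N : uniq (box N).
Proof.
by apply: allpairs_uniq; [exact: uniq_segment|exact: uniq_segment|move=> [? ?] [? ?]].
Qed.

Lemma box_oppr N k : (- k \in box N) = (k \in box N).
Proof. by rewrite !mem_box !abszN. Qed.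

Lemma box_sub M N : (M <= N)%N -> {subset box M <= box N}.
Proof.
move=> MN k; rewrite !mem_box => /andP[h1 h2].
by rewrite (leq_trans h1)// (leq_trans h2).
Qed.

Lemma box_exhausts (s : seq (int * int)) :
  exists N0, forall N, (N0 <= N)%N -> {subset s <= box N}.
Proof.
elim: s => [|a s [N1 h]]; first by exists 0%N.
exists (maxn (maxn `|a.1| `|a.2|) N1) => N; rewrite !geq_max => /andP[/andP[h1 h2] hN] k.
by rewrite inE => /predU1P[->|/h]; [rewrite mem_box h1 h2|exact].
Qed.

Definition psum (N : nat) f := tpoly (box N) (coef f).

(** The partial sum over a box is the best approximation of [f] among the
combinations of its modes, and any given polynomial is such a combination once the
box is large. *)
Lemma psum_cvg f : sq f ->
  ip (fun x => f x - psum N f x) (fun x => f x - psum N f x) @[N --> \oo] --> (0 : R).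
Proof.
move=> sf; apply/cvgrPdist_lt => e e0.
have [_ /(_ e e0)[P tP fP]] := trig_dense sf.
have [s hs] := trig_tpoly tP; have [N0 hN] := box_exhausts s.
exists N0 => // N /= N0N.
rewrite sub0r normrN ger0_norm ?inner_ge0//; apply: le_lt_trans fP.
have -> : P = tpoly (box N) (coef P).
  by apply/funext => x; apply: hs; [exact: uniq_box|exact: hN].
by apply: best_approximation => //; exact: uniq_box.
Qed.

Lemma inner_psum_cvg f g : sq f -> sq g ->
  ip (psum N f) g @[N --> \oo] --> ip f g.
Proof.
move=> sf sg; apply/cvgrPdist_lt => e e0.
have g0 : 0 < ip g g + 1 by rewrite ltr_pwDr// inner_ge0.
have e1 : 0 < e ^+ 2 / (ip g g + 1) by rewrite divr_gt0// exprn_gt0.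
move: (psum_cvg sf) => /cvgrPdist_lt/(_ _ e1); apply: filterS => N.
have sp : sq (psum N f) by exact: sqint_tpoly.
rewrite sub0r normrN ger0_norm ?inner_ge0// ltr_pdivlMr// => H.
rewrite -innerBl// -(ltr_pXn2r (n := 2))// ?nnegrE ?ltW//.
rewrite real_normK ?num_real//; apply: le_lt_trans H.
apply: le_trans (cauchy_schwarz (sqintB mc sf sp) sg) _.
by rewrite ler_wpM2l ?inner_ge0// lerDl.
Qed.

Lemma coef_eq0_inner f : sq f -> (forall k, coef f k = 0) -> ip f f = 0.
Proof.
move=> sf f0; have := inner_psum_cvg sf sf.
have -> : (fun N => ip (psum N f) f) = (fun=> 0).
  apply/funext => N; rewrite innerC inner_tpolyr//.
  by rewrite big1// => k _; rewrite f0 mul0r.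
by move=> /cvg_lim <-//; rewrite lim_cst.
Qed.

End partial_sums.

(** * Products of H^1 functions *)

Section finite_cauchy_schwarz.
Context {R : realType} {I : eqType}.

Lemma double_le_of_sqr_le (p q c : R) : 0 <= p -> 0 <= q -> c ^+ 2 <= p * q -> 2 * c <= p + q.
Proof. by move=> p0 q0 h; rewrite leNgt; apply/negP => h2; have := sqr_ge0 (p - q); nra. Qed.

(** By induction on the list. The step is the inequality between arithmetic and
geometric means for the two cross terms. *)
Lemma weighted_cauchy_schwarz (s : seq I) (w x y : I -> R) :
  {in s, forall i, 0 < w i} ->
  (\sum_(i <- s) x i * y i) ^+ 2 <=
  (\sum_(i <- s) w i * x i ^+ 2) * (\sum_(i <- s) y i ^+ 2 / w i).
Proof.
elim: s => [|a s ih] w0; first by rewrite !big_nil expr0n mul0r.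
have wa : 0 < w a by rewrite w0// mem_head.
have ws : {in s, forall i, 0 < w i} by move=> i is_; rewrite w0// inE is_ orbT.
rewrite !big_cons; move: (ih ws).
set A := \sum_(i <- s) _; set X := \sum_(i <- s) w i * _; set Y := \sum_(i <- s) _ / _.
move=> AXY.
have X0 : 0 <= X by rewrite /X big_seq sumr_ge0// => i /ws wi; rewrite mulr_ge0 ?sqr_ge0 ?ltW.
have Y0 : 0 <= Y by rewrite /Y big_seq sumr_ge0// => i /ws wi; rewrite divr_ge0 ?sqr_ge0 ?ltW.
have H : 2 * (A * (x a * y a)) <= X * (y a ^+ 2 / w a) + Y * (w a * x a ^+ 2).
  apply: double_le_of_sqr_le.
  - by rewrite mulr_ge0// divr_ge0 ?sqr_ge0 ?ltW.
  - by rewrite mulr_ge0// mulr_ge0 ?sqr_ge0 ?ltW.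
  - have -> : X * (y a ^+ 2 / w a) * (Y * (w a * x a ^+ 2)) = X * Y * (x a * y a) ^+ 2.
      by field; rewrite gt_eqF.
    by rewrite exprMn ler_wpM2r ?sqr_ge0.
have -> : (w a * x a ^+ 2 + X) * (y a ^+ 2 / w a + Y) =
  (x a * y a) ^+ 2 + (X * (y a ^+ 2 / w a) + Y * (w a * x a ^+ 2)) + X * Y.
  by field; rewrite gt_eqF.
rewrite sqrrD; lra.
Qed.

End finite_cauchy_schwarz.

Section wave_numbers.
Context {R : realType}.
Implicit Types (k a b c : int * int) (j : 'I_2).

Lemma sum_ord2 (F : 'I_2 -> R) : \sum_(i < 2) F i = F 0 + F 1.
Proof.
rewrite big_ord_recl big_ord1; congr (_ + F _).
exact/val_inj.
Qed.

Definition wave j k : R := (if j == 0 then k.1 else k.2)%:~R.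

Definition wave_sq k : R := k.1%:~R ^+ 2 + k.2%:~R ^+ 2.

Lemma waveD j a b : wave j (a + b) = wave j a + wave j b.
Proof. by rewrite /wave -rmorphD; case: ifP. Qed.

Lemma waveN j a : wave j (- a) = - wave j a.
Proof. by rewrite /wave -rmorphN; case: ifP. Qed.

Lemma wave_sq_ge0 k : 0 <= wave_sq k.
Proof. by rewrite addr_ge0 ?sqr_ge0. Qed.

Lemma wave_le_sq j k : wave j k ^+ 2 <= wave_sq k.
Proof. by rewrite /wave /wave_sq; case: ifP => _; rewrite ?lerDl ?lerDr sqr_ge0. Qed.

Lemma wave_sq_ge1 k : k != 0 -> 1 <= wave_sq k.
Proof.
case: k => i l; have sq1 (m : int) : m != 0 -> 1 <= m%:~R ^+ 2 :> R.
  by move=> m0; rewrite -rmorphXn /= ler1z; nia.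
rewrite xpair_eqE negb_and => /orP[/sq1|/sq1] h; rewrite /wave_sq /=.
  by rewrite (le_trans h)// lerDl sqr_ge0.
by rewrite (le_trans h)// lerDr sqr_ge0.
Qed.

Lemma perm_segmentS N :
  perm_eq (segment N.+1) [:: N.+1%:Z, - N.+1%:Z & segment N].
Proof.
apply: uniq_perm; first exact: uniq_segment.
  by rewrite 2!cons_uniq uniq_segment in_cons !mem_segment; lia.
by move=> i; rewrite mem_segment 2!in_cons mem_segment; lia.
Qed.

(** The correction [4 / (N + 1)] makes the induction work: the two new terms are
bounded by the telescoping difference [4 / n - 4 / (n + 1)]. *)
Lemma sum_segment_le N :
  \sum_(i <- segment N) (1 + i%:~R ^+ 2)^-1 <= 5 - 4 / N.+1%:R :> R.
Proof.
elim: N => [|N ih].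
  by rewrite /segment /= big_seq1 subrr expr0n /= addr0 invr1; lra.
rewrite (perm_big _ (perm_segmentS N)) 2!big_cons mulrNz sqrrN -[N.+1%:~R]/(N.+1%:R : R).
have n1 : 1 <= N.+1%:R :> R by rewrite ler1n.
rewrite -[N.+2%:R]natr1; move: n1 ih; set n : R := N.+1%:R.
set S := \sum_(i <- _) _ => n1 ih.
have h : 2 * (1 + n ^+ 2)^-1 <= 4 / n - 4 / (n + 1).
  have -> : 4 / n - 4 / (n + 1) = 4 / (n * (n + 1)) by field; lra.
  have d1 : 0 < n * (n + 1) by nra.
  have d2 : 0 < 1 + n ^+ 2 by nra.
  by rewrite ler_pdivlMr// mulrAC ler_pdivrMr//; nra.
rewrite /=; move: h ih; set a := (1 + _)^-1; set b := n^-1; set c := (n + 1)^-1; lra.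
Qed.

(** Convergence of the sum of [|k|^-4] over non-zero [k], which is where dimension
two enters. It follows from [|k|^4 >= (1 + k_1^2) (1 + k_2^2) / 4] and the
one-dimensional bound by [5]; the constant is [4 * 5 * 5]. *)
Lemma sum_wave_sq_le N (s : seq (int * int)) : uniq s -> {subset s <= box N} -> 0 \notin s ->
  \sum_(k <- s) (wave_sq k ^+ 2)^-1 <= 100.
Proof.
move=> us sN s0; pose g (i : int) : R := (1 + i%:~R ^+ 2)^-1.
have g0 i : 0 <= g i by rewrite invr_ge0 addr_ge0 ?sqr_ge0.
have S5 : \sum_(i <- segment N) g i <= 5.
  by rewrite (le_trans (sum_segment_le N))// gerBl divr_ge0.
have S0 : 0 <= \sum_(i <- segment N) g i by rewrite sumr_ge0.
have h k : k \in s -> (wave_sq k ^+ 2)^-1 <= 4 * (g k.1 * g k.2).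
  move=> ks; have k0 : k != 0 by apply: contraNneq s0 => <-.
  have := wave_sq_ge1 k0; rewrite /wave_sq /g.
  have := sqr_ge0 (k.1%:~R : R); have := sqr_ge0 (k.2%:~R : R).
  set x : R := k.1%:~R ^+ 2; set y : R := k.2%:~R ^+ 2 => y0 x0 xy.
  have -> : 4 * ((1 + x)^-1 * (1 + y)^-1) = 4 / ((1 + x) * (1 + y)) by rewrite invfM.
  rewrite -div1r ler_pdivrMr; last by nra.
  by rewrite mulrAC ler_pdivlMr; nra.
apply: (@le_trans _ _ (\sum_(k <- s) 4 * (g k.1 * g k.2))).
  by rewrite big_seq [leRHS]big_seq ler_sum.
apply: (@le_trans _ _ (\sum_(k <- box N) 4 * (g k.1 * g k.2))).
  rewrite [leLHS](_ : _ = \sum_(k <- [seq k <- box N | k \in s]) 4 * (g k.1 * g k.2)).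
    by rewrite big_filter big_mkcond ler_sum// => k _; case: ifP => // _; rewrite !mulr_ge0.
  apply: perm_big; apply: uniq_perm; [by []|by rewrite filter_uniq// uniq_box|].
  by move=> k; rewrite mem_filter; case: (boolP (k \in s)) => // /sN ->.
rewrite /box big_allpairs_dep /=.
under eq_bigr do rewrite -mulr_sumr -mulr_sumr.
rewrite -mulr_sumr -mulr_suml; nra.
Qed.

End wave_numbers.

Section trilinear.
Context {R : realType}.
Implicit Types (k a b c : int * int) (f g phi : R * R -> R) (s t : seq (int * int)).

Notation sq := (sqint (@leb2 R) cell).
Notation ip := (@inner R).

Let mc := @measurable_cell R.

(** The coefficients of the matrix of multiplication by [phi]; see
[inner_hartM]. *)
Definition hart2 phi a b : R := 2^-1 *
  (coef phi (a - b) + coef phi (b - a) + coef phi (a + b) - coef phi (- (a + b))).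

Lemma inner_hartM phi a b : sq phi -> ip phi (fun x => hart a x * hart b x) = hart2 phi a b.
Proof.
move=> sphi; rewrite /inner integral_hartMM//.
exact: (sqint_int mc leb2_cell_fin sphi).
Qed.

Lemma sqint_hartM phi a : sq phi -> sq (fun x => hart a x * phi x).
Proof.
move=> sp; under eq_fun do rewrite mulrC.
apply: (sqint_mulb (M := 2) mc sp) => [|x _]; [exact: measurable_hart|exact: hart_bound].
Qed.

Lemma sqint_tpolyM s (al : int * int -> R) phi : sq phi -> sq (fun x => tpoly s al x * phi x).
Proof.
move=> sp; rewrite /tpoly; under eq_fun do rewrite mulr_suml.
apply: sqint_sum => // k; under eq_fun do rewrite -mulrA.
by apply: sqintZ => //; exact: sqint_hartM.
Qed.

Lemma inner_tpoly2 s t (al be : int * int -> R) phi : sq phi ->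
  ip (tpoly s al) (fun x => tpoly t be x * phi x) =
  \sum_(a <- s) \sum_(b <- t) al a * be b * hart2 phi a b.
Proof.
move=> sp; rewrite /tpoly inner_suml.
- apply: eq_bigr => a _; rewrite innerZl; [|exact: sqint_hart|exact: sqint_tpolyM].
  rewrite innerC (_ : (fun x => _) =
    (fun x => \sum_(b <- t) be b * (hart b x * phi x))); last first.
    by apply/funext => x; rewrite mulr_suml; apply: eq_bigr => b _; rewrite mulrA.
  rewrite inner_suml; last exact: sqint_hart; last first.
    by move=> b; apply: sqintZ => //; exact: sqint_hartM.
  rewrite mulr_sumr; apply: eq_bigr => b _.
  rewrite innerZl; [|exact: sqint_hartM|exact: sqint_hart].
  rewrite -inner_hartM// mulrA; congr (_ * _).
  by apply: eq_Rintegral => x _; ring.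
- by move=> a; apply: sqintZ => //; exact: sqint_hart.
- exact: sqint_tpolyM.
Qed.

Lemma hart2C phi a b : hart2 phi a b = hart2 phi b a.
Proof. by rewrite /hart2 (addrC a b); congr (_ * _); ring. Qed.

(** Each of the four terms of [hart2 phi a b] runs over distinct coefficients of
[phi] as [b] varies, so that Bessel's inequality applies to each of them. *)
Lemma sum_hart2_sq_le phi a t : sq phi -> uniq t ->
  \sum_(b <- t) hart2 phi a b ^+ 2 <= 4 * ip phi phi.
Proof.
move=> sp ut.
have B (h : int * int -> int * int) : injective h ->
    \sum_(b <- t) coef phi (h b) ^+ 2 <= ip phi phi.
  move=> hi; rewrite -(big_map h predT (fun k => coef phi k ^+ 2)).
  by apply: bessel => //; rewrite map_inj_uniq.
have i1 : injective (fun b => a - b) by move=> x y /addrI /oppr_inj.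
have i2 : injective (fun b => b - a) by move=> x y /addIr.
have i3 : injective (fun b => a + b) by move=> x y /addrI.
have i4 : injective (fun b => - (a + b)) by move=> x y /oppr_inj /addrI.
have := lerD (lerD (B _ i1) (B _ i2)) (lerD (B _ i3) (B _ i4)).
rewrite -!big_split /= => H.
apply: (@le_trans _ _ (ip phi phi + ip phi phi + (ip phi phi + ip phi phi))); last lra.
apply: le_trans H; apply: ler_sum => b _; rewrite /hart2.
set x := coef _ _; set y := coef _ (b - a); set z := coef _ (a + b); set w := coef _ (- _).
have := sqr_ge0 (x - y); have := sqr_ge0 (x - z); have := sqr_ge0 (x + w).
have := sqr_ge0 (y - z); have := sqr_ge0 (y + w); have := sqr_ge0 (z + w).
lra.
Qed.

(** The weight is split by [1 / (|a|^2 |b|^2) <= (1 / |a|^4 + 1 / |b|^4) / 2]. In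
the first half the sum over [b] is bounded by Bessel's inequality and the sum over
[a] by the sum of [|a|^-4], hence the constant [4 * 100]; the other half is
symmetric. *)
Lemma weighted_sum_hart2_le phi s t M N : sq phi ->
  uniq s -> {subset s <= box M} -> 0 \notin s ->
  uniq t -> {subset t <= box N} -> 0 \notin t ->
  \sum_(a <- s) \sum_(b <- t) hart2 phi a b ^+ 2 / (wave_sq a * wave_sq b)
    <= 400 * ip phi phi.
Proof.
move=> sp us sM s0 ut tN t0; have P0 := inner_ge0 phi.
have half s' t' M' : uniq s' -> {subset s' <= box M'} -> 0 \notin s' -> uniq t' ->
    \sum_(a <- s') \sum_(b <- t') hart2 phi a b ^+ 2 / wave_sq a ^+ 2 <= 400 * ip phi phi.
  move=> us' sM' s0' ut'.
  apply: (@le_trans _ _ (\sum_(a <- s') (wave_sq a ^+ 2)^-1 * (4 * ip phi phi))).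
    apply: ler_sum => a _; rewrite -mulr_suml mulrC ler_wpM2l ?invr_ge0 ?sqr_ge0//.
    exact: sum_hart2_sq_le.
  rewrite -mulr_suml; have : \sum_(a <- s') (wave_sq a ^+ 2)^-1 <= 100 :> R.
    exact: sum_wave_sq_le us' sM' s0'.
  by move=> h; apply: (@le_trans _ _ (100 * (4 * ip phi phi))); [rewrite ler_wpM2r ?mulr_ge0|lra].
have h1 := half s t M us sM s0 ut; have h2 := half t s N ut tN t0 us.
rewrite exchange_big in h2; have {h1 h2} := lerD h1 h2; rewrite -big_split /=.
under eq_bigr do rewrite -big_split /=.
move=> H; have {H} : 2^-1 * (\sum_(a <- s) \sum_(b <- t) (hart2 phi a b ^+ 2 / wave_sq a ^+ 2 +
   hart2 phi b a ^+ 2 / wave_sq b ^+ 2)) <= 400 * ip phi phi by lra.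
apply: le_trans; rewrite mulr_sumr big_seq [leRHS]big_seq ler_sum// => a ai.
rewrite mulr_sumr big_seq [leRHS]big_seq ler_sum// => b bi.
have wa : 0 < wave_sq a :> R.
  by rewrite (lt_le_trans ltr01)// wave_sq_ge1//; apply: contraNneq s0 => <-.
have wb : 0 < wave_sq b :> R.
  by rewrite (lt_le_trans ltr01)// wave_sq_ge1//; apply: contraNneq t0 => <-.
rewrite (hart2C phi b a) -mulrDr mulrCA ler_wpM2l ?sqr_ge0// invfM -!exprVn.
have := sqr_ge0 ((wave_sq a)^-1 - (wave_sq b)^-1 : R); lra.
Qed.

(** Cauchy-Schwarz over the pairs of modes with the weight [|a|^2 |b|^2]. The zero
mode, where the weight vanishes, is discarded first. *)
Lemma tpoly2_bound s t (al be : int * int -> R) phi M N : sq phi ->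
  uniq s -> {subset s <= box M} -> uniq t -> {subset t <= box N} ->
  al 0 = 0 -> be 0 = 0 ->
  ip (tpoly s al) (fun x => tpoly t be x * phi x) ^+ 2 <=
  (\sum_(a <- s) wave_sq a * al a ^+ 2) * (\sum_(b <- t) wave_sq b * be b ^+ 2) *
  (400 * ip phi phi).
Proof.
move=> sp us sM ut tN al0 be0.
pose s' := [seq a <- s | a != 0]; pose t' := [seq b <- t | b != 0].
have red (r : seq (int * int)) (F : int * int -> R) : F 0 = 0 ->
    \sum_(a <- r) F a = \sum_(a <- [seq a <- r | a != 0]) F a.
  move=> F0; rewrite big_filter [RHS]big_mkcond; apply: eq_bigr => a _.
  by case: eqP => // ->.
rewrite inner_tpoly2// (red s); last first.
  by rewrite big1// => b _; rewrite al0 !mul0r.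
under eq_bigr do rewrite (red t) ?be0 ?mulr0 ?mul0r//.
rewrite (red s _ (_ : wave_sq 0 * al 0 ^+ 2 = 0)); last by rewrite al0 expr0n mulr0.
rewrite (red t _ (_ : wave_sq 0 * be 0 ^+ 2 = 0)); last by rewrite be0 expr0n mulr0.
rewrite -/s' -/t'.
have mem_s' a : a \in s' -> a \in s by rewrite mem_filter => /andP[].
have mem_t' a : a \in t' -> a \in t by rewrite mem_filter => /andP[].
have s0 : 0 \notin s' by rewrite mem_filter eqxx.
have t0 : 0 \notin t' by rewrite mem_filter eqxx.
have H := weighted_sum_hart2_le sp (filter_uniq _ us) (fun a h => sM a (mem_s' a h)) s0
  (filter_uniq _ ut) (fun a h => tN a (mem_t' a h)) t0.
pose I := [seq (a, b) | a <- s', b <- t'].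
have E (F : int * int -> int * int -> R) :
    \sum_(a <- s') \sum_(b <- t') F a b = \sum_(p <- I) F p.1 p.2.
  by rewrite /I big_allpairs_dep.
have wpos : {in I, forall p, 0 < (wave_sq p.1 * wave_sq p.2 : R)}.
  move=> p /allpairsP [[a b] /= [ai bi ->]] /=.
  rewrite mulr_gt0// (lt_le_trans ltr01)// wave_sq_ge1//.
    by apply: contraNneq s0 => <-.
  by apply: contraNneq t0 => <-.
have := weighted_cauchy_schwarz (fun p => al p.1 * be p.2) (fun p => hart2 phi p.1 p.2) wpos.
rewrite -(E (fun a b => al a * be b * hart2 phi a b)).
rewrite -(E (fun a b => hart2 phi a b ^+ 2 / (wave_sq a * wave_sq b))).
rewrite -(E (fun a b => wave_sq a * wave_sq b * (al a * be b) ^+ 2)).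
have -> : \sum_(a <- s') \sum_(b <- t') wave_sq a * wave_sq b * (al a * be b) ^+ 2 =
  (\sum_(a <- s') wave_sq a * al a ^+ 2) * (\sum_(b <- t') wave_sq b * be b ^+ 2).
  rewrite mulr_suml; apply: eq_bigr => a _; rewrite mulr_sumr; apply: eq_bigr => b _; ring.
move=> /le_trans; apply; rewrite ler_wpM2l//.
by rewrite mulr_ge0// sumr_ge0// => a _; rewrite mulr_ge0 ?wave_sq_ge0 ?sqr_ge0.
Qed.

(** Up to the factor [(2 pi)^2], [A] bounds the squared [L^2] norm of the gradient of
[f], whose coefficients are read off from those of [f]. *)
Definition h1_bounded (A : R) f :=
  forall N, \sum_(k <- box N) wave_sq k * coef f k ^+ 2 <= A.

Lemma sqr_cvg_le (u_ : nat -> R) (l K : R) : u_ n @[n --> \oo] --> l ->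
  (forall n, u_ n ^+ 2 <= K) -> l ^+ 2 <= K.
Proof.
move=> ul uK; have c : u_ n ^+ 2 @[n --> \oo] --> l ^+ 2 by exact: cvgM.
rewrite -(cvg_lim _ c)//; apply: limr_le; first exact: (cvgP _ c).
by apply: nearW.
Qed.

Lemma sqint_mul_trig f phi : sq f -> trig phi -> sq (fun x => f x * phi x).
Proof.
move=> sf tp; have [K pK] := trig_bounded tp.
by apply: (sqint_mulb (M := K) mc sf) => [|x _]; [case: (trig_sqint tp)|exact: pK].
Qed.

(** The two-dimensional Sobolev inequality for products. It passes to the limit from
partial sums, first in [f] for fixed [g], then in [g], since [phi] is bounded. *)
Lemma trilinear_bound f g phi A B : sq f -> sq g -> trig phi ->
  coef f 0 = 0 -> coef g 0 = 0 -> h1_bounded A f -> h1_bounded B g ->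
  (\int[leb2]_(x in cell) (f x * g x * phi x)) ^+ 2 <= A * B * (400 * ip phi phi).
Proof.
move=> sf sg tp f0 g0 fA gB; have sp := trig_sqint tp.
have sgp := sqint_mul_trig sg tp.
have -> : \int[leb2]_(x in cell) (f x * g x * phi x) = ip f (fun x => g x * phi x).
  by apply: eq_Rintegral => x _; rewrite mulrA.
apply: sqr_cvg_le (inner_psum_cvg sf sgp) _ => M.
have sfp : sq (fun x => psum M f x * phi x) by exact: sqint_tpolyM.
have -> : ip (psum M f) (fun x => g x * phi x) = ip g (fun x => psum M f x * phi x).
  by apply: eq_Rintegral => x _; ring.
apply: sqr_cvg_le (inner_psum_cvg sg sfp) _ => N.
have sub n : {subset box n <= box n} by [].
apply: (le_trans (tpoly2_bound sp (uniq_box N) (sub N) (uniq_box M) (sub M) g0 f0)).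
have W0 (h : R * R -> R) n : 0 <= \sum_(k <- box n) wave_sq k * coef h k ^+ 2.
  by rewrite sumr_ge0// => k _; rewrite mulr_ge0 ?wave_sq_ge0 ?sqr_ge0.
apply: ler_wpM2r; first by apply: mulr_ge0; [exact: ler0n|exact: inner_ge0].
rewrite [leRHS]mulrC; apply: ler_pM; [exact: W0|exact: W0|exact: gB|exact: fA].
Qed.

End trilinear.

(** * The energy flux through a box of modes *)

Section energy_flux.
Context {R : realType}.
Implicit Types (k a b c : int * int) (i j : 'I_2) (N M : nat).
Implicit Types f : R * R -> R.

Notation sq := (sqint (@leb2 R) cell).
Notation ip := (@inner R).

Lemma sum_box_oppr N (F : int * int -> R) :
  \sum_(k <- box N) F (- k) = \sum_(k <- box N) F k.
Proof.
rewrite -(big_map (fun k => - k) predT F); apply: perm_big; apply: uniq_perm.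
- by rewrite map_inj_uniq ?uniq_box//; exact: oppr_inj.
- exact: uniq_box.
- by move=> k; rewrite -[k in LHS]opprK mem_map ?box_oppr//; exact: oppr_inj.
Qed.

Lemma sum_box_split M N (F : int * int -> R) : (M <= N)%N ->
  \sum_(k <- box N) F k = \sum_(k <- box M) F k + \sum_(k <- box N | k \notin box M) F k.
Proof.
move=> MN; rewrite (bigID (fun k => k \in box M)) /=; congr (_ + _).
rewrite -big_filter; apply: perm_big; apply: uniq_perm.
- by rewrite filter_uniq// uniq_box.
- exact: uniq_box.
- by move=> k; rewrite mem_filter; case: (boolP (k \in box M)) => // /(box_sub MN) ->.
Qed.

Definition h1 N (f : R * R -> R) : R := \sum_(k <- box N) wave_sq k * coef f k ^+ 2.

Lemma h1_ge0 N f : 0 <= h1 N f.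
Proof. by rewrite /h1 sumr_ge0// => k _; rewrite mulr_ge0 ?wave_sq_ge0 ?sqr_ge0. Qed.

Lemma h1_nondecreasing f : nondecreasing_seq (h1 ^~ f).
Proof.
move=> M N MN; rewrite /h1 (sum_box_split _ MN) lerDl sumr_ge0// => k _.
by rewrite mulr_ge0 ?wave_sq_ge0 ?sqr_ge0.
Qed.

Lemma coef_psum N f k : coef (psum N f) k = if k \in box N then coef f k else 0.
Proof. by rewrite coef_tpoly// uniq_box. Qed.

Lemma h1_bounded_psum N f (A : R) : h1_bounded A f -> h1_bounded A (psum N f).
Proof.
move=> fA M; apply: le_trans (fA M); apply: ler_sum => k _; rewrite coef_psum.
by case: ifP => // _; rewrite expr0n mulr0 mulr_ge0 ?wave_sq_ge0 ?sqr_ge0.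
Qed.

(** What the truncation has taken from the sum over all modes is no longer available
to the tail. *)
Lemma h1_bounded_tail N f (A : R) : sq f -> h1_bounded A f ->
  h1_bounded (A - h1 N f) (fun x => f x - psum N f x).
Proof.
move=> sf fA M; have -> : \sum_(k <- box M) wave_sq k * coef (fun x => f x - psum N f x) k ^+ 2 =
    \sum_(k <- box M | k \notin box N) wave_sq k * coef f k ^+ 2.
  rewrite [RHS]big_mkcond; apply: eq_bigr => k _.
  rewrite coef_diff//; last exact: sqint_tpoly.
  by rewrite coef_psum; case: ifP => _ /=; rewrite ?subr0// subrr expr0n mulr0.
rewrite lerBrDl; have [MN|NM] := leqP M N.
  rewrite big_seq_cond big1 ?addr0 => [|k /andP[/(box_sub MN) ->]//]; exact: fA.
by rewrite -(sum_box_split (fun k => wave_sq k * coef f k ^+ 2) (ltnW NM)); exact: fA.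
Qed.

Lemma trig_of_tpoly s (al : int * int -> R) : trig (tpoly s al).
Proof.
elim: s => [|a s ih].
  have -> : tpoly [::] al = (fun=> 0) by apply/funext => x; rewrite /tpoly big_nil.
  exact: trig_cst.
have -> : tpoly (a :: s) al = (fun x => al a * hart a x + tpoly s al x).
  by apply/funext => x; rewrite /tpoly big_cons.
by apply: trigD => //; apply: trigZ; exact: trig_hart.
Qed.

(** The derivative of [psum N f] in direction [j]: the derivative of [hart k] is
[2 pi k_j hart (- k)], and the sum is reindexed by [k |-> - k]. *)
Definition dpsum N j f : R * R -> R :=
  tpoly (box N) (fun k => - (2 * pi * wave j k * coef f (- k))).

Lemma norm_dpsum N j f (A : R) : sq f -> h1_bounded A f ->
  ip (dpsum N j f) (dpsum N j f) <= (2 * pi) ^+ 2 * A.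
Proof.
move=> sf fA; rewrite norm_tpoly ?uniq_box//.
rewrite (eq_bigr (fun k => (2 * pi) ^+ 2 * (wave j (- k) ^+ 2 * coef f (- k) ^+ 2))); last first.
  by move=> k _; rewrite waveN; ring.
rewrite (sum_box_oppr N (fun k => (2 * pi) ^+ 2 * (wave j k ^+ 2 * coef f k ^+ 2))).
rewrite -mulr_sumr ler_wpM2l ?sqr_ge0//; apply: le_trans (fA N).
by apply: ler_sum => k _; rewrite ler_wpM2r ?sqr_ge0// wave_le_sq.
Qed.

(** The integral of [f_i f_j] against the derivative in direction [j] of the
truncation of [f_i], summed over [i] and [j]: the rate at which the nonlinear term
feeds the modes of the box. *)
Definition flux N (f : 'I_2 -> R * R -> R) : R :=
  \sum_(i < 2) \sum_(j < 2)
    \int[leb2]_(x in cell) (f i x * f j x * dpsum N j (f i) x).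

Lemma sqr_sum22_le (F : 'I_2 -> 'I_2 -> R) (K : R) : (forall i j, F i j ^+ 2 <= K) ->
  (\sum_(i < 2) \sum_(j < 2) F i j) ^+ 2 <= 16 * K.
Proof.
move=> FK; rewrite !big_ord_recl !big_ord0 !addr0.
move: (FK ord0 ord0) (FK ord0 (lift ord0 ord0)) (FK (lift ord0 ord0) ord0).
move: (FK (lift ord0 ord0) (lift ord0 ord0)).
set x := F _ _; set y := F _ _; set z := F _ _; set w := F _ _.
have := sqr_ge0 (x - y); have := sqr_ge0 (x - z); have := sqr_ge0 (x - w).
have := sqr_ge0 (y - z); have := sqr_ge0 (y - w); have := sqr_ge0 (z - w).
lra.
Qed.

Section velocity.
Variables (f : 'I_2 -> R * R -> R) (A : R).
Hypotheses (sf : forall i, sq (f i)) (f0 : forall i, coef (f i) 0 = 0).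
Hypothesis fA : forall i, h1_bounded A (f i).

Lemma h1_bound_ge0 : 0 <= A.
Proof. exact: le_trans (h1_ge0 0 (f 0)) (fA 0 0). Qed.

Lemma flux_bound N : flux N f ^+ 2 <= 16 * (A * A * (400 * ((2 * pi) ^+ 2 * A))).
Proof.
apply: sqr_sum22_le => i j; have A0 := h1_bound_ge0.
apply: le_trans (trilinear_bound (sf i) (sf j) (trig_of_tpoly _ _) (f0 i) (f0 j) (fA i) (fA j)) _.
apply: ler_wpM2l; first by rewrite mulr_ge0.
by apply: ler_wpM2l; [exact: ler0n|exact: norm_dpsum].
Qed.

End velocity.

(** The integral of the product of three modes. *)
Definition hart3 a b c : R := hart2 (hart c) a b.

Lemma hart3E a b c : hart3 a b c = 2^-1 *
  ((a - b == c)%:R + (b - a == c)%:R + (a + b == c)%:R - (- (a + b) == c)%:R).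
Proof. by rewrite /hart3 /hart2 /coef !hart_ortho !(eq_sym c). Qed.

(** The integral of the derivative of a product of three modes is zero. Each of the
four Kronecker symbols in [hart3E] gets a linear combination of the three wave
numbers as coefficient, which vanishes where the symbol does not. *)
Lemma hart3_leibniz j a b c : wave j a * hart3 (- a) b c +
  wave j b * hart3 a (- b) c + wave j c * hart3 a b (- c) = 0.
Proof.
rewrite !hart3E !opprD !opprK.
have eN (x y : int * int) : (x == - y) = (- x == y) :> bool by rewrite eqr_oppLR.
rewrite !eN !opprB !opprD !opprK.
rewrite (addrC (- a) b) (addrC b a) (addrC (- b) (- a)).
have D (x y : int * int) (w : R) : (x = y -> w = 0) -> (x == y)%:R * w = 0.
  by case: eqP => [e ->//|_ _]; rewrite ?mulr0 ?mul0r.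
have h1 := D (a + b) c (wave j a + wave j b - wave j c).
have h2 := D (- a - b) c (wave j a + wave j b + wave j c).
have h3 := D (a - b) c (- wave j a + wave j b + wave j c).
have h4 := D (b - a) c (wave j a - wave j b + wave j c).
move: h1 h2 h3 h4.
set p := (a + b == c)%:R; set q := (- a - b == c)%:R.
set r := (a - b == c)%:R; set s := (b - a == c)%:R.
set u := wave j a; set v := wave j b; set w := wave j c.
move=> h1 h2 h3 h4.
have {}h1 : p * (u + v - w) = 0 by apply: h1 => e; rewrite /u /v /w -e waveD; ring.
have {}h2 : q * (u + v + w) = 0 by apply: h2 => e; rewrite /u /v /w -e waveD !waveN; ring.
have {}h3 : r * (- u + v + w) = 0 by apply: h3 => e; rewrite /u /v /w -e waveD !waveN; ring.
have {}h4 : s * (u - v + w) = 0 by apply: h4 => e; rewrite /u /v /w -e waveD !waveN; ring.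
transitivity (2^-1 * (p * (u + v - w) + q * (u + v + w) + r * (- u + v + w) + s * (u - v + w))).
  ring.
by rewrite h1 h2 h3 h4 !addr0 mulr0.
Qed.

End energy_flux.

Section flux_limit.
Context {R : realType}.
Implicit Types (k a b c : int * int) (i j : 'I_2) (N M : nat).
Notation sq := (sqint (@leb2 R) cell).
Notation ip := (@inner R).

Let mc := @measurable_cell R.

Variables (f : 'I_2 -> R * R -> R) (A : R).
Hypotheses (sf : forall i, sq (f i)) (f0 : forall i, coef (f i) 0 = 0).
Hypothesis fA : forall i, h1_bounded A (f i).
Hypothesis divf : forall k, \sum_(j < 2) wave j k * coef (f j) k = 0.

Lemma hart2_tpoly s (al : int * int -> R) a b :
  hart2 (tpoly s al) a b = \sum_(c <- s) al c * hart3 a b c.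
Proof.
have sh : sq (fun x => hart a x * hart b x) by apply: sqint_hartM; exact: sqint_hart.
rewrite -inner_hartM; last exact: sqint_tpoly.
rewrite innerC inner_tpolyr//; apply: eq_bigr => c _; rewrite /hart3 -inner_hartM.
  by rewrite /coef innerC.
exact: sqint_hart.
Qed.

Lemma hart3_rev a b c : hart3 a b c = hart3 c b a :> R.
Proof.
rewrite /hart3 -!inner_hartM; [|exact: sqint_hart|exact: sqint_hart].
by apply: eq_Rintegral => x _; ring.
Qed.

Lemma sum3_rev I (s : seq I) (F : I -> I -> I -> R) :
  \sum_(a <- s) \sum_(b <- s) \sum_(c <- s) F a b c =
  \sum_(a <- s) \sum_(b <- s) \sum_(c <- s) F c b a.
Proof.
rewrite exchange_big /=; under eq_bigr do rewrite exchange_big /=.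
by rewrite exchange_big.
Qed.

(** Integration by parts turns the sum over [j] of
[\int w_i w_j d_j w_i] into minus half the integral of [w_i ^ 2] times the
divergence of [w]. On coefficients: the expression is symmetrized in the two modes [a] and [c] of
[w_i], and [hart3_leibniz] moves the derivative to [w_j]. *)
Lemma flux_psum_eq0 N : flux N (fun i => psum N (f i)) = 0.
Proof.
set B := box N; set al := fun i => coef (f i).
have E i j : \int[leb2]_(x in cell) (psum N (f i) x * psum N (f j) x * dpsum N j (psum N (f i)) x)
  = 2 * pi * \sum_(a <- B) \sum_(b <- B) \sum_(c <- B)
      al i a * al i c * (al j b * wave j c) * hart3 a b (- c).
  transitivity (ip (psum N (f i)) (fun x => psum N (f j) x * dpsum N j (psum N (f i)) x)).
    by apply: eq_Rintegral => x _; rewrite mulrA.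
  rewrite inner_tpoly2; last exact: sqint_tpoly.
  rewrite mulr_sumr; apply: eq_bigr => a _; rewrite mulr_sumr; apply: eq_bigr => b _.
  rewrite hart2_tpoly -sum_box_oppr mulr_sumr mulr_sumr big_seq [RHS]big_seq.
  by apply: eq_bigr => c cB; rewrite waveN opprK coef_psum cB /al; ring.
rewrite /flux; under eq_bigr do under eq_bigr do rewrite E.
rewrite big1// => i _; rewrite -mulr_sumr.
pose G j a b c := al i a * al i c * (al j b * wave j c) * hart3 a b (- c).
suff : 2 * (\sum_(j < 2) \sum_(a <- B) \sum_(b <- B) \sum_(c <- B) G j a b c) = 0.
  by move=> /eqP; rewrite mulf_eq0 (_ : 2 == 0 = false) ?pnatr_eq0//= => /eqP ->; rewrite mulr0.
rewrite mulr_natl mulr2n.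
under [X in _ + X]eq_bigr do rewrite sum3_rev.
rewrite -big_split /=; under eq_bigr do rewrite -big_split /=.
under eq_bigr do under eq_bigr do rewrite -big_split /=.
under eq_bigr do under eq_bigr do under eq_bigr do rewrite -big_split /=.
rewrite exchange_big /= big1// => a _; rewrite exchange_big /= big1// => b _.
rewrite exchange_big /= big1// => c _.
transitivity (\sum_(j < 2) (- (al i a * al i c * hart3 a (- b) c)) * (wave j b * al j b)).
  apply: eq_bigr => j _; rewrite /G.
  have H := hart3_leibniz (R := R) j a b c.
  rewrite (hart3_rev c b); move: H => /eqP; rewrite addrAC addr_eq0 => /eqP H.
  transitivity (al i a * al i c * al j b *
    (wave j a * hart3 (- a) b c + wave j c * hart3 a b (- c))); first by ring.
  by rewrite H; ring.
by rewrite -mulr_sumr divf mulr0.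
Qed.

Lemma dpsum_psum N j (g : R * R -> R) : dpsum N j (psum N g) = dpsum N j g.
Proof.
apply/funext => x; rewrite /dpsum /tpoly big_seq [RHS]big_seq; apply: eq_bigr => k kB.
by rewrite coef_psum box_oppr kB.
Qed.

Let tail N i := fun x => f i x - psum N (f i) x.

(** The flux of the truncation, which is zero, is subtracted, and the difference of
the two products [f_i f_j] is written with one tail in each term. *)
Lemma flux_split N : flux N f =
  \sum_(i < 2) \sum_(j < 2)
    \int[leb2]_(x in cell) (tail N i x * f j x * dpsum N j (f i) x) +
  \sum_(i < 2) \sum_(j < 2)
    \int[leb2]_(x in cell) (tail N j x * psum N (f i) x * dpsum N j (f i) x).
Proof.
rewrite -[LHS]subr0 -[X in _ - X](flux_psum_eq0 N) /flux -sumrB -[RHS]big_split /=.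
apply: eq_bigr => i _; rewrite -sumrB -[RHS]big_split /=; apply: eq_bigr => j _.
rewrite dpsum_psum; set phi := dpsum N j (f i).
have tphi : trig phi by exact: trig_of_tpoly.
have sp h : sq (psum N h) by exact: sqint_tpoly.
have E (g h : R * R -> R) : \int[leb2]_(x in cell) (g x * h x * phi x) = ip g (fun x => h x * phi x).
  by apply: eq_Rintegral => x _; rewrite mulrA.
have sm g : sq g -> sq (fun x => g x * phi x) by move=> sg; exact: sqint_mul_trig.
have swap : ip (psum N (f i)) (fun x => psum N (f j) x * phi x) =
    ip (psum N (f j)) (fun x => psum N (f i) x * phi x).
  by apply: eq_Rintegral => x _; ring.
have swap' : ip (psum N (f i)) (fun x => f j x * phi x) =
    ip (f j) (fun x => psum N (f i) x * phi x).
  by apply: eq_Rintegral => x _; ring.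
have s1 : sq (fun x => f j x * phi x) by exact: sm.
have s2 : sq (fun x => psum N (f i) x * phi x) by apply: sm; exact: sp.
have d1 : ip (tail N i) (fun x => f j x * phi x) =
    ip (f i) (fun x => f j x * phi x) - ip (psum N (f i)) (fun x => f j x * phi x).
  exact: innerBl (sf i) (sp _) s1.
have d2 : ip (tail N j) (fun x => psum N (f i) x * phi x) =
    ip (f j) (fun x => psum N (f i) x * phi x) - ip (psum N (f j)) (fun x => psum N (f i) x * phi x).
  exact: innerBl (sf j) (sp _) s2.
rewrite (E (f i) (f j)) (E (psum N (f i)) (psum N (f j))) (E (tail N i) (f j)).
rewrite (E (tail N j) (psum N (f i))) d1 d2 swap swap' addrA subrK.
by [].
Qed.

Lemma cvg0_of_sqr (u_ v_ : nat -> R) : (forall n, u_ n ^+ 2 <= v_ n) ->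
  v_ n @[n --> \oo] --> (0 : R) -> u_ n @[n --> \oo] --> (0 : R).
Proof.
move=> uv v0; apply/cvgrPdist_lt => e e0.
have e2 : 0 < e ^+ 2 by rewrite exprn_gt0.
move: v0 => /cvgrPdist_lt/(_ _ e2); apply: filterS => n.
rewrite !sub0r !normrN => vn; rewrite -(ltr_pXn2r (n := 2))// ?nnegrE ?ltW//.
rewrite real_normK ?num_real//; apply: le_lt_trans (uv n) _.
by apply: le_lt_trans vn; exact: ler_norm.
Qed.

(** In each term of [flux_split] one factor is a tail, whose [H^1] norm tends to
zero, and the others are bounded. *)
Lemma flux_cvg0 : flux N f @[N --> \oo] --> (0 : R).
Proof.
have A0 : 0 <= A by exact: h1_bound_ge0 fA.
pose L i : R := limn (h1 ^~ (f i)).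
have cL i : h1 N (f i) @[N --> \oo] --> L i.
  apply: nondecreasing_is_cvgn; first exact: h1_nondecreasing.
  by exists A => _ [N _ <-]; exact: fA.
have leL i : h1_bounded (L i) (f i).
  move=> N; apply: nondecreasing_cvgn_le; first exact: h1_nondecreasing.
  exact: cvgP (cL i).
pose tau N : R := \sum_(i < 2) (L i - h1 N (f i)).
have tau_i N i : L i - h1 N (f i) <= tau N.
  rewrite /tau (bigD1 i)//= lerDl sumr_ge0// => j _; rewrite subr_ge0; exact: leL.
have tail_b N i : h1_bounded (tau N) (tail N i).
  by move=> M; apply: le_trans (tau_i N i); exact: h1_bounded_tail.
have tau0 N : 0 <= tau N by apply: sumr_ge0 => i _; rewrite subr_ge0; exact: leL.
have st N i : sq (tail N i) by apply: sqintB => //; exact: sqint_tpoly.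
have t0 N i : coef (tail N i) 0 = 0.
  by rewrite coef_diff ?coef_psum ?f0 ?if_same ?subrr//; exact: sqint_tpoly.
have tauc : tau N @[N --> \oo] --> (0 : R).
  have c0 i : L i - h1 N (f i) @[N --> \oo] --> (0 : R).
    by rewrite -(subrr (L i)); apply: cvgB; [exact: cvg_cst|exact: cL].
  rewrite /tau; under eq_fun do rewrite big_ord_recl big_ord1.
  by rewrite -(addr0 (0 : R)); apply: cvgD; exact: c0.
pose K : R := 400 * ((2 * pi) ^+ 2 * A).
have b1 N i j : (\int[leb2]_(x in cell) (tail N i x * f j x * dpsum N j (f i) x)) ^+ 2 <= tau N * A * K.
  apply: le_trans (trilinear_bound (st N i) (sf j) (trig_of_tpoly _ _) (t0 N i) (f0 j) (tail_b N i) (fA j)) _.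
  apply: ler_wpM2l; first by rewrite mulr_ge0.
  by apply: ler_wpM2l; [exact: ler0n|exact: norm_dpsum].
have b2 N i j : (\int[leb2]_(x in cell) (tail N j x * psum N (f i) x * dpsum N j (f i) x)) ^+ 2 <= tau N * A * K.
  have p0 : coef (psum N (f i)) 0 = 0 by rewrite coef_psum f0 if_same.
  have sp : sq (psum N (f i)) by exact: sqint_tpoly.
  have pA := @h1_bounded_psum _ N _ _ (fA i).
  apply: (le_trans (trilinear_bound (st N j) sp (trig_of_tpoly _ _) (t0 N j) p0 (tail_b N j) pA)).
  apply: ler_wpM2l; first by rewrite mulr_ge0.
  by apply: ler_wpM2l; [exact: ler0n|exact: norm_dpsum].
apply: (@cvg0_of_sqr _ (fun N => 64 * (tau N * A * K))) => [N|].
  rewrite flux_split; have := sqr_sum22_le (b1 N); have := sqr_sum22_le (b2 N).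
  set x := \sum_(i < 2) _; set y := \sum_(i < 2) _ => h1 h2.
  have := sqr_ge0 (x - y); lra.
have -> : (0 : R) = 64 * (0 * A * K) by rewrite !mul0r mulr0.
apply: cvgMr; apply: cvgMl; exact: cvgMl.
Qed.

End flux_limit.

(** * Divergence-free fields in terms of their vorticity *)

Section stream_function.
Context {R : realType}.
Implicit Types (k : int * int).
Notation sq := (sqint (@leb2 R) cell).

(** The wave vector rotated by a right angle: the direction of a divergence-free
mode. *)
Definition perp i k : R := if i == 0 :> 'I_2 then - wave 1 k else wave 0 k.

Lemma sum_perp_wave k : \sum_(j < 2) perp j k * wave j k = 0.
Proof.
rewrite sum_ord2 /perp /=; ring.
Qed.

Lemma sqr_perp k : \sum_(i < 2) perp i k ^+ 2 = wave_sq k.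
Proof.
rewrite sum_ord2 /perp /wave_sq /wave /=; ring.
Qed.

Variable f : 'I_2 -> R * R -> R.
Hypothesis sf : forall i, sq (f i).
Hypothesis f0 : forall i, coef (f i) 0 = 0.
Hypothesis divf : forall k, \sum_(j < 2) wave j k * coef (f j) k = 0.

(** Up to the factor [2 pi], the coefficient at [- k] of the vorticity of [f]. *)
Definition circulation k : R := \sum_(i < 2) perp i k * coef (f i) k.

Let divE k : wave 0 k * coef (f 0) k + wave 1 k * coef (f 1) k = 0.
Proof. by rewrite -[RHS](divf k) sum_ord2. Qed.

Let circE k : circulation k = wave 0 k * coef (f 1) k - wave 1 k * coef (f 0) k.
Proof. rewrite /circulation sum_ord2 /perp /=; ring. Qed.

Lemma coef_circulation i k : wave_sq k * coef (f i) k = perp i k * circulation k.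
Proof.
have := divE k; rewrite circE /perp; set a := wave 0 k; set b := wave 1 k => ab.
have -> : wave_sq k = a ^+ 2 + b ^+ 2 by [].
case: ifPn => [/eqP ->|].
  have -> : (a ^+ 2 + b ^+ 2) * coef (f 0) k = a * (a * coef (f 0) k + b * coef (f 1) k) -
    b * (a * coef (f 1) k - b * coef (f 0) k) by ring.
  by rewrite ab; ring.
case: i => [[|[|//]]] //= h _.
have -> : Ordinal h = 1 by apply/val_inj.
have -> : (a ^+ 2 + b ^+ 2) * coef (f 1) k = b * (a * coef (f 0) k + b * coef (f 1) k) +
    a * (a * coef (f 1) k - b * coef (f 0) k) by ring.
by rewrite ab; ring.
Qed.

(** A coefficient orthogonal to [k] is parallel to [perp k]. For [k = 0] both sides
vanish, the left one since the mean is zero. *)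
Lemma coef_perp i k : coef (f i) k = perp i k * (circulation k / wave_sq k).
Proof.
have [->|k0] := eqVneq k 0.
  by rewrite f0 /perp /wave /= oppr0 if_same mul0r.
have w0 : wave_sq k != 0 :> R by rewrite gt_eqF// (lt_le_trans ltr01)// wave_sq_ge1.
by rewrite mulrA -coef_circulation mulrAC divff// mul1r.
Qed.

Lemma sum_sqr_coef k : \sum_(i < 2) coef (f i) k ^+ 2 = circulation k ^+ 2 / wave_sq k.
Proof.
transitivity (\sum_(i < 2) perp i k ^+ 2 * (circulation k / wave_sq k) ^+ 2).
  by apply: eq_bigr => i _; rewrite coef_perp exprMn.
rewrite -mulr_suml sqr_perp.
have [->|w0] := eqVneq (wave_sq k : R) 0; first by rewrite invr0 !mulr0 mul0r.
by field.
Qed.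

Lemma wave_sq_coef_le i k : wave_sq k * coef (f i) k ^+ 2 <= circulation k ^+ 2.
Proof.
have [w0|w0] := eqVneq (wave_sq k : R) 0; first by rewrite w0 mul0r sqr_ge0.
have w1 : 0 < wave_sq k :> R by rewrite lt_def w0 wave_sq_ge0.
apply: (@le_trans _ _ (wave_sq k * \sum_(j < 2) coef (f j) k ^+ 2)).
  apply: ler_wpM2l; first exact: ltW.
  by rewrite (bigD1 i)//= lerDl sumr_ge0// => j _; exact: sqr_ge0.
by rewrite sum_sqr_coef mulrCA divff// mulr1.
Qed.

(** The coefficient of the vorticity at [- k] is [2 pi] times the circulation at
[k], whose square bounds [|k|^2] times the square of the coefficient of [f i]. The
sum is bounded by Bessel's inequality; the factor [2 pi >= 1] is simply dropped. *)
Lemma h1_bounded_of_curl (g : R * R -> R) : sq g ->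
  (forall k, coef g k = - (2 * pi * (wave 0 k * coef (f 1) (- k) - wave 1 k * coef (f 0) (- k)))) ->
  forall i, h1_bounded (inner g g) (f i).
Proof.
move=> sg gE i N; apply: (@le_trans _ _ (\sum_(k <- box N) coef g (- k) ^+ 2)).
  apply: ler_sum => k _; apply: le_trans (wave_sq_coef_le i k) _.
  have -> : coef g (- k) = 2 * pi * circulation k.
    by rewrite gE opprK !waveN circE; ring.
  rewrite exprMn ler_peMl ?sqr_ge0// exprn_ege1//.
  by have := @pi_ge2 R; lra.
rewrite (sum_box_oppr N (fun k => coef g k ^+ 2)).
by apply: bessel => //; exact: uniq_box.
Qed.

(** The derivative in [dpsum] is expanded, and [coef_perp] is used for the coefficient
it falls on. The factor of the circulation on the right is the nonlinear term in the
evolution equation of this circulation, which links the flux to the energy. *)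
Lemma flux_circulation N : flux N f = \sum_(k <- box N) circulation k / wave_sq k *
  \sum_(i < 2) \sum_(j < 2) perp i k * (2 * pi * wave j k) * coef (fun x => f i x * f j x) (- k).
Proof.
have mc := @measurable_cell R.
have E i j : \int[leb2]_(x in cell) (f i x * f j x * dpsum N j (f i) x) =
  \sum_(k <- box N) 2 * pi * wave j k * coef (f i) k * coef (fun x => f i x * f j x) (- k).
  have ih k : leb2.-integrable cell (EFin \o (fun x => f i x * f j x * hart k x)).
    have H := @integrable_mulb _ _ R leb2 cell mc _ (hart k) 2 (sqint_mul mc (sf i) (sf j)).
    by apply: H; [exact: measurable_hart|move=> x _; exact: hart_bound].
  transitivity (\int[leb2]_(x in cell) (\sum_(k <- box N)
      - (2 * pi * wave j k * coef (f i) (- k)) * (f i x * f j x * hart k x))).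
    apply: eq_Rintegral => x _; rewrite /dpsum /tpoly mulr_sumr; apply: eq_bigr => k _; ring.
  rewrite Rintegral_sum; [|exact: mc|by move=> k; apply: integrableZR; [exact: mc|exact: ih]].
  rewrite -sum_box_oppr; apply: eq_bigr => k _.
  by rewrite RintegralZl; [rewrite opprK waveN /coef /inner; ring|exact: mc|exact: ih].
rewrite /flux; under eq_bigr do under eq_bigr do rewrite E.
under eq_bigr do rewrite exchange_big.
rewrite exchange_big /=; apply: eq_bigr => k _; rewrite mulr_sumr.
apply: eq_bigr => i _; rewrite mulr_sumr; apply: eq_bigr => j _.
rewrite [in LHS]coef_perp; ring.
Qed.

End stream_function.

(** * Smooth test functions *)

Section smooth_line.
Context {R : realType}.

Definition smooth1 (g : R -> R) := forall n x, derivable g^`(n)%classic x 1.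

(** By induction, all the iterated derivatives stay in the family. *)
Lemma smooth1_family (F : (R -> R) -> Prop) :
  (forall g, F g -> exists2 g', F g' & forall x : R, is_derive x 1 g (g' x)) ->
  forall g, F g -> smooth1 g.
Proof.
move=> HF g Fg n; have [h Fh ->] : exists2 h, F h & g^`(n)%classic = h.
  elim: n => [|n [h Fh nh]]; first by exists g.
  have [h' Fh' dh] := HF _ Fh; exists h' => //.
  by rewrite derive1nS nh; apply/funext => x; rewrite derive1E; exact: derive_val.
by move=> x; have [h' _ dh] := HF _ Fh; apply: ex_derive.
Qed.

Lemma smooth1_derive g : smooth1 g -> smooth1 g^`()%classic.
Proof. by move=> sg n x; rewrite -derive1Sn; exact: sg. Qed.

Lemma smooth1_is_derive g : smooth1 g -> forall x : R, is_derive x 1 g (g^`()%classic x).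
Proof. by move=> sg x; apply: DeriveDef; [exact: (sg 0%N)|rewrite derive1E]. Qed.

Lemma smooth1_affine (a b : R) : smooth1 (fun x => a * x + b).
Proof.
apply: (@smooth1_family (fun g => exists c d, g = (fun x => c * x + d))); last by exists a, b.
move=> _ [c [d ->]]; exists (fun=> c); first by exists 0, c; apply/funext => x; rewrite mul0r add0r.
by move=> x; apply: is_derive_eq; rewrite /GRing.scale/=; ring.
Qed.

Lemma smooth1_cos_sin (a b : R) : smooth1 (fun x => a * cos x + b * sin x).
Proof.
apply: (@smooth1_family (fun g => exists c d, g = (fun x => c * cos x + d * sin x))); last by exists a, b.
move=> _ [c [d ->]]; exists (fun x => d * cos x + - c * sin x); first by exists d, (- c).
by move=> x; apply: is_derive_eq; rewrite /GRing.scale/=; ring.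
Qed.

(** Functions [P(1/x) exp(- al / x)], extended by zero to [x <= 0]: a family of smooth
functions that contains the standard cut-off and is closed under differentiation,
with [dflat] giving the new polynomial. *)
Definition flat (al : R) (P : {poly R}) (x : R) : R :=
  if 0 < x then P.[x^-1] * expR (- (al * x^-1)) else 0.

Definition dflat (al : R) (P : {poly R}) : {poly R} := 'X^2 * (al *: P - P^`()).

(** The derivative at zero exists thanks to this quadratic bound. The exponential beats
[y ^ m] in [y = 1/x], with [m] two more than the number of coefficients of [P]. *)
Lemma flat_le_sqr al P : 0 < al ->
  exists C, forall x, `|x| <= 1 -> `|flat al P x| <= C * x ^+ 2.
Proof.
move=> al0; pose d := size P; pose C0 : R := \sum_(i < d) `|P`_i|.
pose m := d.+2; exists (C0 * (m`!%:R / al ^+ m)) => x x1; rewrite /flat.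
have C00 : 0 <= C0 by rewrite /C0 sumr_ge0.
have C10 : 0 <= m`!%:R / al ^+ m by rewrite divr_ge0// exprn_ge0// ltW.
case: ifPn => x0; last by rewrite normr0 mulr_ge0 ?sqr_ge0// mulr_ge0.
rewrite gtr0_norm// in x1; set y := x^-1.
have y1 : 1 <= y by rewrite /y invf_ge1.
have y0 : 0 < y by rewrite (lt_le_trans ltr01).
have Py : `|P.[y]| <= C0 * y ^+ d.
  rewrite horner_coef (le_trans (ler_norm_sum _ _ _))// mulr_suml ler_sum// => i _.
  rewrite normrM normrX (gtr0_norm y0) ler_wpM2l//.
  by rewrite ler_weXn2l// ltnW.
have ey : expR (- (al * y)) <= m`!%:R / al ^+ m * y ^- m.
  have := @expR_ge1Dxn _ (al * y) d.+1 (mulr_ge0 (ltW al0) (ltW y0)).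
  rewrite -/m => H; rewrite expRN.
  have -> : m`!%:R / al ^+ m * y ^- m = ((al * y) ^+ m / m`!%:R)^-1.
    by rewrite invf_div exprMn (invfM (al ^+ m)) mulrA.
  have p0 : 0 < (al * y) ^+ m / m`!%:R.
    by rewrite divr_gt0 ?ltr0n ?fact_gt0// exprn_gt0// mulr_gt0.
  by rewrite lef_pV2 ?posrE ?expR_gt0//; apply: le_trans H; rewrite lerDr.
rewrite normrM (gtr0_norm (expR_gt0 _)).
apply: (le_trans (ler_pM (normr_ge0 _) (expR_ge0 _) Py ey)).
have -> : C0 * y ^+ d * (m`!%:R / al ^+ m * y ^- m) =
    C0 * (m`!%:R / al ^+ m) * (y ^+ d * y ^- m) by ring.
have yd : y ^+ d != 0 by rewrite expf_neq0// gt_eqF.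
have -> : y ^+ d * y ^- m = x ^+ 2.
  rewrite /m -addn2 exprD (invfM (y ^+ d)) mulrA divff// mul1r.
  by rewrite -exprVn /y invrK.
by [].
Qed.

Lemma is_derive_flat al P (x : R) : 0 < al -> is_derive x 1 (flat al P) (flat al (dflat al P) x).
Proof.
move=> al0; have [x0|x0|->] := ltgtP x 0.
- have E : {near x, cst 0 =1 flat al P}.
    near=> y; rewrite /flat ifF//; apply/negbTE; rewrite -leNgt.
    by apply: ltW; near: y; exact: lt_nbhsl.
  rewrite {2}/flat ifF; last by apply/negbTE; rewrite -leNgt ltW.
  by apply: near_eq_is_derive E _; exact: is_derive_cst.
- have E : {near x, (fun y => P.[y^-1] * expR (- (al * y^-1))) =1 flat al P}.
    near=> y; rewrite /flat ifT//.
    by near: y; exact: lt_nbhsr.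
  rewrite {2}/flat ifT//; apply: near_eq_is_derive E _.
  have xn0 : x != 0 by rewrite gt_eqF.
  have dV : is_derive x 1 (fun y : R => y^-1) (- x ^- 2).
    have := @is_deriveV _ (fun y => y) x 1 1 xn0 (is_derive_id _ _).
    by rewrite /GRing.scale/= mulr1.
  have dP : is_derive x 1 (fun y => P.[y^-1]) (P^`().[x^-1] * - x ^- 2).
    exact: (@is_derive1_comp _ (horner P) (fun y => y^-1)).
  have dE : is_derive x 1 (fun y => expR (- (al * y^-1))) (expR (- (al * x^-1)) * (al * x ^- 2)).
    apply: (@is_derive1_comp _ expR (fun y => - (al * y^-1))).
    have -> : al * x ^- 2 = - (al *: - x ^- 2) by rewrite /GRing.scale/= mulrN opprK.
    exact: is_deriveN.
  apply: (is_derive_eq (is_deriveM dP dE)).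
  rewrite /dflat !hornerE /GRing.scale/= -exprVn; ring.
- have [C HC] := flat_le_sqr P al0.
  have f0 Q : flat al Q 0 = 0 by rewrite /flat ltxx.
  have c : (fun h => h^-1 *: ((flat al P \o shift (0 : R)) (h *: (1 : R)) - flat al P 0)) @ 0^' --> (0 : R).
    apply/cvgrPdist_lt => e e0; near=> h.
    have h0 : h != 0 by near: h; exact: nbhs_dnbhs_neq.
    have h1 : `|h| <= 1 by near: h; apply: dnbhs0_le.
    have he : `|h| < e / (`|C| + 1).
      by near: h; apply: dnbhs0_lt; rewrite divr_gt0// ltr_pwDr.
    rewrite sub0r normrN f0 subr0 /= /GRing.scale/= mulr1 addr0 normrM normfV.
    rewrite mulrC ltr_pdivrMr ?normr_gt0//; apply: le_lt_trans (HC h h1) _.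
    rewrite ltr_pdivlMr ?ltr_pwDr// in he.
    have hp : 0 < `|h| by rewrite normr_gt0.
    rewrite -(real_normK (num_real h)); have := ler_norm C; nra.
  by rewrite f0; apply: DeriveDef; [exact: cvgP c|exact: cvg_lim c].
Unshelve. all: by end_near.
Qed.

Lemma smooth1_flat al P : 0 < al -> smooth1 (flat al P).
Proof.
move=> al0; apply: (@smooth1_family (fun g => exists Q, g = flat al Q)); last by exists P.
move=> _ [Q ->]; exists (flat al (dflat al Q)); first by exists (dflat al Q).
by move=> x; exact: is_derive_flat.
Qed.

End smooth_line.

Section test_functions.
Context {R : realType}.
Notation space_time := (R * (R * R))%type.

(** Reduces the partial derivatives of explicit functions to one-variable calculus. *)
Lemma is_derive_line (f : space_time -> R) (z v : space_time) (g : R -> R) (d : R) :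
  (forall h : R, f (h *: v + z) = g h) -> is_derive (0 : R) 1 g d -> is_derive z v f d.
Proof.
move=> fg [dg <-].
have E : (fun h : R => h^-1 *: ((f \o shift z) (h *: v) - f z)) =
    (fun h : R => h^-1 *: ((g \o shift (0 : R)) (h *: (1 : R)) - g 0)).
  apply/funext => h; congr (_ *: (_ - _)).
    by rewrite /= fg addr0; congr g; rewrite /GRing.scale/= mulr1.
  by rewrite -fg scale0r add0r.
by apply: DeriveDef; rewrite /derivable /derive E.
Qed.

Definition affine (al be ga de : R) (z : space_time) : R :=
  al * z.1 + be * z.2.1 + ga * z.2.2 + de.

Definition slope (al be ga : R) (k : 'I_3) : R :=
  al * (k == 0 :> nat)%:R + be * (k == 1 :> nat)%:R + ga * (k == 2 :> nat)%:R.

(** A class of functions of three variables that contains the test functions needed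
below, is closed under partial derivatives, and consists of continuous functions;
its members are then smooth. *)
Inductive elementary : (space_time -> R) -> Prop :=
| elementary_comp g al be ga de : smooth1 g -> elementary (g \o affine al be ga de)
| elementaryD f g : elementary f -> elementary g -> elementary (f + g)
| elementaryM f g : elementary f -> elementary g -> elementary (f * g).

Lemma elementary_cst (c : R) : elementary (fun=> c).
Proof.
have -> : (fun=> c) = (fun x => 0 * x + c) \o affine 0 0 0 0.
  by apply/funext => z; rewrite /= mul0r add0r.
by apply: elementary_comp; exact: smooth1_affine.
Qed.

Lemma is_derive_affine (g : R -> R) (dg : R) al be ga de (k : 'I_3) z :
  is_derive (affine al be ga de z) 1 g dg ->
  is_derive z (direction R k) (g \o affine al be ga de) (slope al be ga k * dg).
Proof.
move=> H; apply: (@is_derive_line _ _ _ (g \o (fun h => slope al be ga k * h + affine al be ga de z))).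
  by move=> h; rewrite /= /affine /slope /direction /= /GRing.scale /=; congr g; ring.
rewrite mulrC; apply: is_derive1_comp.
  by rewrite mulr0 add0r.
by apply: is_derive_eq; rewrite /GRing.scale/=; ring.
Qed.

Lemma elementary_partial (f : space_time -> R) (k : 'I_3) : elementary f ->
  exists2 f', elementary f' & forall z, is_derive z (direction R k) f (f' z).
Proof.
elim=> [g al be ga de sg|{}f g _ [f' ef df] _ [g' eg dg]|{}f g ef0 [f' ef df] eg0 [g' eg dg]].
- exists ((fun=> slope al be ga k) * (g^`()%classic \o affine al be ga de)).
    apply: elementaryM; first exact: elementary_cst.
    by apply: elementary_comp; exact: smooth1_derive.
  by move=> z; apply: is_derive_affine; exact: smooth1_is_derive.
- by exists (f' + g'); [exact: elementaryD|move=> z; exact: is_deriveD].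
- exists (f * g' + g * f'); first by apply: elementaryD; exact: elementaryM.
  by move=> z; exact: is_deriveM.
Qed.

Lemma elementary_continuous (f : space_time -> R) : elementary f -> continuous f.
Proof.
elim=> [g al be ga de sg|{}f g _ cf _ cg|{}f g _ cf _ cg] z.
- apply: continuous_comp; last first.
    by apply: differentiable_continuous; apply/derivable1_diffP; exact: (sg 0%N).
  have c1 : {for z, continuous (fun z : space_time => z.1)} by exact: cvg_fst.
  have c2 : {for z, continuous (fun z : space_time => z.2)} by exact: cvg_snd.
  have c21 : {for z, continuous (fun z : space_time => z.2.1)}.
    by apply: (continuous_comp c2); exact: cvg_fst.
  have c22 : {for z, continuous (fun z : space_time => z.2.2)}.
    by apply: (continuous_comp c2); exact: cvg_snd.
  rewrite /affine; apply: cvgD; last exact: cvg_cst.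
  by apply: cvgD; [apply: cvgD|]; apply: cvgM; (exact: cvg_cst || assumption).
- by apply: cvgD; [exact: cf|exact: cg].
- by apply: cvgM; [exact: cf|exact: cg].
Qed.

Lemma elementary_smooth (f : space_time -> R) : elementary f -> smooth f.
Proof.
move=> ef s; have {f ef}[f' ef' ->] : exists2 f', elementary f' & iter_partial s f = f'.
  elim: s => [|k s [g eg /= gE]]; first by exists f.
  have [g' eg' dg] := elementary_partial k eg; exists g' => //.
  by rewrite gE; apply/funext => z; rewrite /partial; exact: derive_val.
split; first exact: elementary_continuous.
by move=> k z; have [g' _ dg] := elementary_partial k ef'; apply: ex_derive.
Qed.

Lemma biperiodic_hart (k : int * int) : biperiodic (@hart R k).
Proof.
move=> x1 x2; rewrite /hart.
have -> : phase k (x1 + 1, x2) = phase k (x1, x2) + 2 * pi * k.1%:~R by rewrite /phase/=; ring.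
have -> : phase k (x1, x2 + 1) = phase k (x1, x2) + 2 * pi * k.2%:~R by rewrite /phase/=; ring.
by rewrite !periodic_int//; (exact: cosD2pi || exact: sinD2pi).
Qed.

Definition mode (eta : R -> R) (k : int * int) (z : space_time) : R := eta z.1 * hart k z.2.

Lemma elementary_hart (k : int * int) : elementary (fun z => hart k z.2).
Proof.
have -> : (fun z : space_time => hart k z.2) =
    (fun y => 1 * cos y + 1 * sin y) \o affine 0 (2 * pi * k.1%:~R) (2 * pi * k.2%:~R) 0.
  apply/funext => z; rewrite /= !mul1r /hart.
  have -> : phase k z.2 = affine 0 (2 * pi * k.1%:~R) (2 * pi * k.2%:~R) 0 z => //.
  by rewrite /phase /affine; ring.
by apply: elementary_comp; exact: smooth1_cos_sin.
Qed.

Lemma test_mode (I : set R) (a b : R) (eta : R -> R) (k : int * int) : `[a, b] `<=` I ->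
  elementary (fun z => eta z.1) -> (forall t, ~~ (a <= t <= b) -> eta t = 0) ->
  test_function I (mode eta k).
Proof.
move=> abI ee eta0; exists a, b; split => //; split.
- by apply: elementary_smooth; apply: (elementaryM ee (elementary_hart k)).
- by move=> t x1 x2; rewrite /mode/=; have [-> ->] := biperiodic_hart k x1 x2.
- by move=> t x /eta0; rewrite /mode /= => ->; rewrite mul0r.
Qed.

Lemma dt_mode (eta eta' : R -> R) (k : int * int) z : (forall t : R, is_derive t 1 eta (eta' t)) ->
  dt (mode eta k) z = eta' z.1 * hart k z.2.
Proof.
move=> deta; rewrite /dt /partial; apply: derive_val.
apply: (@is_derive_line _ _ _ (fun h => eta (h + z.1) * hart k z.2)).
  move=> h; rewrite /mode /= /direction /= /GRing.scale /= /scale_pair /= /GRing.scale /= !mulr0 !add0r mulr1.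
  by case: z => t [x1 x2].
have d1 : is_derive (0 : R) 1 (fun h => eta (h + z.1)) (eta' z.1).
  rewrite -[eta' _]mulr1; apply: (@is_derive1_comp _ eta (fun h => h + z.1)).
    by rewrite add0r.
  by apply: is_derive_eq; rewrite /GRing.scale/=; ring.
apply: (is_derive_eq (is_deriveM d1 (is_derive_cst _ _ _))).
by rewrite scaler0 add0r /GRing.scale/= mulrC.
Qed.

(** The derivative of cas is [cos - sin], which is cas at the opposite point. *)
Lemma dx_mode (eta : R -> R) (j : 'I_2) (k : int * int) z :
  dx j (mode eta k) z = 2 * pi * wave j k * (eta z.1 * hart (- k) z.2).
Proof.
rewrite /dx /partial; apply: derive_val.
pose g y : R := cos y + sin y.
have dg (y : R) : is_derive y 1 g (cos y - sin y).
  by apply: is_derive_eq; rewrite /GRing.scale/=; ring.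
apply: (@is_derive_line _ _ _ (fun h => eta z.1 * g (2 * pi * wave j k * h + phase k z.2))).
  move=> h; rewrite /mode /= /direction /= /GRing.scale /= /scale_pair /= /GRing.scale /= !mulr0 !add0r.
  congr (_ * g _); rewrite /phase /wave /=.
  by case: j => [[|[|//]] ?] /=; ring.
have d1 : is_derive (0 : R) 1 (fun h => g (2 * pi * wave j k * h + phase k z.2))
    (hart (- k) z.2 * (2 * pi * wave j k)).
  apply: (@is_derive1_comp _ g (fun h => 2 * pi * wave j k * h + phase k z.2)).
    rewrite mulr0 add0r /hart phaseN cosN sinN; exact: dg.
  by apply: is_derive_eq; rewrite /GRing.scale/=; ring.
by apply: (is_derive_eq (is_deriveM (is_derive_cst _ _ _) d1)); rewrite /GRing.scale/=; ring.
Qed.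

End test_functions.

(** * Primitives of integrable functions of time *)

Section triangle.
Context {R : realType}.
Notation mu := (@lebesgue_measure R).
Variables (b : R) (f g : R -> R).
Hypothesis fi : mu.-integrable `[0, b] (EFin \o f).
Hypothesis gi : mu.-integrable `[0, b] (EFin \o g).

Let I : set (measurableTypeR R) := `[0, b].

Let mI : measurable I.
Proof. exact: measurable_itv. Qed.

Let h (z : R * R) : R := f z.1 * g z.2 * (z.2 <= z.1)%R%:R.

Let mle : measurable_fun setT (fun z : measurableTypeR R * measurableTypeR R => (z.2 <= z.1)%R%:R : R).
Proof.
have -> : (fun z : measurableTypeR R * measurableTypeR R => (z.2 <= z.1)%R%:R : R) =
   \1_[set z | z.2 <= z.1].
  apply/funext => z; rewrite indicE; congr ((nat_of_bool _)%:R).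
  by apply/idP/idP; rewrite inE.
apply: measurable_indic; rewrite -[X in measurable X]setTI.
exact: measurable_fun_le.
Qed.

Let hi : (mu \x mu)%E.-integrable (I `*` I) (EFin \o h).
Proof.
apply: (@integrable_mulb _ _ _ _ _ _ _ _ 1).
- exact: measurableX.
- apply: (@integrable_tensor _ _ _ _ R mu mu I I f g mI mI fi gi).
- exact: measurable_funTS mle.
- by move=> z _; rewrite normr_nat lern1 leq_b1.
Qed.

Let below s : I s -> \int[mu]_(r in I) h (s, r) = f s * \int[mu]_(r in `[0, s]) g r.
Proof.
rewrite /I /= in_itv/= => /andP[s0 sb].
have gs : mu.-integrable `[0, s] (EFin \o g).
  by apply: integrableS gi => //; apply: subset_itvl; rewrite bnd_simp.
rewrite -RintegralZl//.
rewrite [LHS]Rintegral_mkcond [RHS]Rintegral_mkcond; apply: eq_Rintegral => r _.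
rewrite !patchE /h /= !mem_setE /= !in_itv /=.
have [r0|] := leP 0 r; rewrite ?andbF//=.
have [rs|] := leP r s; rewrite ?mulr1 ?mulr0 ?if_same//=.
by rewrite (le_trans rs sb).
Qed.

Let above r : I r -> \int[mu]_(s in I) h (s, r) = g r * \int[mu]_(s in `[r, b]) f s.
Proof.
rewrite /I /= in_itv/= => /andP[r0 rb].
have fr : mu.-integrable `[r, b] (EFin \o f).
  by apply: integrableS fi => //; apply: subset_itvr; rewrite bnd_simp.
rewrite -RintegralZl//.
rewrite [LHS]Rintegral_mkcond [RHS]Rintegral_mkcond; apply: eq_Rintegral => s _.
rewrite !patchE /h /= !mem_setE /= !in_itv /=.
have [sb|] := leP s b; rewrite ?andbF//= ?andbT.
have [rs|] := leP r s; rewrite ?mulr1 ?mulr0 ?if_same//= (mulrC (g r)).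
by rewrite (le_trans r0 rs).
Qed.

(** Exchange of the order of integration over the triangle [r <= s], written as the
square [0, b]^2 with the indicator of the triangle as a factor. *)
Lemma Rintegral_triangle :
  \int[mu]_(s in `[0, b]) (f s * \int[mu]_(r in `[0, s]) g r) =
  \int[mu]_(r in `[0, b]) (g r * \int[mu]_(s in `[r, b]) f s).
Proof.
transitivity (\int[mu]_(s in I) \int[mu]_(r in I) h (s, r)).
  by apply: eq_Rintegral => s; rewrite inE => sI; rewrite below.
rewrite (Rintegral_exchange mI mI hi).
by apply: eq_Rintegral => r; rewrite inE => rI; rewrite above.
Qed.

Lemma integrable_triangle :
  mu.-integrable `[0, b] (fun s => (f s * \int[mu]_(r in `[0, s]) g r)%:E).
Proof.
have := integrable_section_integral mI mI hi.
by apply: eq_integrable => // s; rewrite inE => sI /=; rewrite below.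
Qed.

End triangle.

Section primitive.
Context {R : realType}.
Notation mu := (@lebesgue_measure R).
Implicit Types (q B : R -> R).

(** Integrability up to time zero: the primitive from [0] makes sense. *)
Definition loc_integrable q := forall b, mu.-integrable `[0, b] (EFin \o q).

Lemma lebesgue_itv_fin (b : R) : (mu [set` `[0%R, b]] < +oo)%E.
Proof.
have := @lebesgue_measure_itv R `[0, b]; rewrite /= => ->.
by case: ifP => _; rewrite -?EFinB ltry.
Qed.

Lemma loc_integrable_cst (c : R) : loc_integrable (fun=> c).
Proof.
move=> b; apply: measurable_bounded_integrable.
- exact: measurable_itv.
- exact: lebesgue_itv_fin.
- exact: measurable_cst.
- by exists `|c|; split => // x cx t _; rewrite /= ltW.
Qed.

Lemma loc_integrable_oc q a b : loc_integrable q -> 0 <= a ->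
  mu.-integrable `]a, b] (EFin \o q).
Proof.
move=> /(_ b) qb a0.
have H := @integrableS _ _ R mu `[0, b] `]a, b] (EFin \o q).
apply: H; [exact: measurable_itv|exact: measurable_itv| |exact: qb].
by apply: subset_itvr; rewrite bnd_simp; exact: a0.
Qed.

Lemma ae_eq_Rintegral (D : set (measurableTypeR R)) (f g : R -> R) : measurable D ->
  measurable_fun D f -> measurable_fun D g ->
  {ae mu, forall t, D t -> f t = g t} ->
  \int[mu]_(t in D) f t = \int[mu]_(t in D) g t.
Proof.
move=> mD mf mg fg; congr fine; apply: ae_eq_integral => //.
- exact/measurable_EFinP.
- exact/measurable_EFinP.
- by move: fg; apply: filterS => t /[apply] ->.
Qed.

(** Lebesgue's differentiation theorem applied to the extension of [q] by zero to
negative times. *)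
Lemma ae_eq0_of_primitive q : loc_integrable q ->
  (forall b, 0 < b -> \int[mu]_(t in `[0, b]) q t = 0) ->
  {ae mu, forall t, 0 <= t -> q t = 0}.
Proof.
move=> iq q0; pose q' := q \_ `[0, +oo[.
have rE (b : R) : (EFin \o q') \_ `]-oo, b] = (EFin \o q) \_ `[0, b].
  apply/funext => t; rewrite !patchE /q' /= !mem_setE !in_itv /= patchE mem_setE in_itv /= andbT.
  by case: (0 <= t); case: (t <= b).
have iq' b : mu.-integrable `]-oo, b] (EFin \o q').
  have [_] := @integrable_mkcond _ _ R mu `]-oo, b] (EFin \o q') (measurable_itv _).
  apply; rewrite rE.
  have [H _] := @integrable_mkcond _ _ R mu `[0, b] (EFin \o q) (measurable_itv _).
  exact: H (iq b).
have F0 b : \int[mu]_(t in `]-oo, b]) q' t = 0.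
  transitivity (\int[mu]_(t in `[0, b]) q t).
    by rewrite /Rintegral [in LHS]integral_mkcond [in RHS]integral_mkcond rE.
  have [/q0//|b0] := ltP 0 b; have [->|/eqP bn0] := eqVneq b 0.
    by rewrite set_itv1 Rintegral_set1.
  rewrite set_itv_ge ?Rintegral_set0// bnd_simp -ltNge lt_neqAle b0 andbT.
  exact/eqP.
have mb (b : R) : measurable_fun `]-oo, b] q'.
  by apply/measurable_EFinP; have /integrableP[] := iq' b.
have mq' : measurable_fun setT q'.
  have -> : setT = \bigcup_n ([set` `]-oo, (n%:R : R)]]).
    apply/seteqP; split => // t _; exists (Num.bound `|t|) => //=.
    by rewrite in_itv/= (le_trans (ler_norm t))// ltW// archi_boundP.
  apply/measurable_fun_bigcup => n; [exact: measurable_itv|exact: mb].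
have lq : locally_integrable setT q'.
  split; [exact: mq'|exact: openT|move=> K _ cK].
  have mK : measurable K by exact: compact_measurable.
  have [M [_ KM]] := compact_bounded cK.
  have Kb : K `<=` `]-oo, M + 1].
    have M1 : M < M + 1 by rewrite ltrDl.
    move=> t /(KM (M + 1) M1)/=.
    by rewrite in_itv/= => /(le_trans (ler_norm _)).
  have /integrableP[_] := iq' (M + 1); apply: le_lt_trans.
  apply: ge0_subset_integral => //.
  by apply/measurable_EFinP; apply: measurableT_comp => //; exact: mb.
have := FTC1Ny iq' lq; apply: filterS; first exact: (ae_filter_ringOfSetsType mu).
move=> t [_ dF] t0.
have -> : q t = q' t by rewrite /q' patchE mem_setE in_itv/= t0.
rewrite -dF (_ : (fun x => _) = cst 0); first by rewrite derive1_cst.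
by apply/funext => x; exact: F0.
Qed.

(** The derivative of [V^2] is [2 V V']. As [V] is only a primitive of an integrable
function, this is proved by Fubini: the square of the integral is an integral over a
square, and its two halves on each side of the diagonal are equal. *)
Lemma sqr_primitive B b : loc_integrable B -> 0 <= b ->
  (\int[mu]_(t in `[0, b]) B t) ^+ 2 =
  2 * \int[mu]_(t in `[0, b]) (B t * \int[mu]_(s in `[0, t]) B s).
Proof.
move=> iB b0; have iBb := iB b; have tri := Rintegral_triangle iBb iBb.
have itri := integrable_triangle iBb iBb.
set V := \int[mu]_(t in _) B t; set W := \int[mu]_(t in _) (B t * _) in tri *.
have : W = V * V - W.
  rewrite [LHS]tri.
  transitivity (\int[mu]_(t in `[0, b]) (V * B t - B t * \int[mu]_(s in `[0, t]) B s)).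
    apply: eq_Rintegral => t; rewrite inE/= in_itv/= => /andP[t0 tb].
    have itb := loc_integrable_oc b iB t0.
    have c0 : (BLeft 0 <= BRight t)%O by rewrite bnd_simp; exact: t0.
    have cb : (BRight t <= BRight b)%O by rewrite bnd_simp; exact: tb.
    rewrite -(Rintegral_itv_obnd_cbnd itb) -(Rintegral_itvB iBb c0 cb).
    by rewrite -/V; ring.
  rewrite RintegralB; [|exact: measurable_itv| |exact: itri].
    by rewrite RintegralZl; [|exact: measurable_itv|exact: iBb].
  by apply: integrableZR; [exact: measurable_itv|exact: iBb].
lra.
Qed.

Lemma double_primitive B b : loc_integrable B ->
  \int[mu]_(t in `[0, b]) (\int[mu]_(s in `[0, t]) B s) =
  \int[mu]_(s in `[0, b]) ((b - s) * B s).
Proof.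
move=> iB.
have i1 := loc_integrable_cst 1 b.
have iBb := iB b.
transitivity (\int[mu]_(t in `[0, b]) (1 * \int[mu]_(s in `[0, t]) B s)).
  by apply: eq_Rintegral => t _; rewrite mul1r.
rewrite (Rintegral_triangle i1 iBb); apply: eq_Rintegral => s.
rewrite inE/= in_itv/= => /andP[s0 sb].
rewrite mulrC; congr (_ * _); rewrite Rintegral_cst; last exact: measurable_itv.
rewrite mul1r /= lebesgue_measure_itv/= lte_fin.
by case: ltgtP sb => // -> _; rewrite subrr.
Qed.

End primitive.

(** * Cut-offs in time *)

Section cutoffs.
Context {R : realType}.
Implicit Types (n : nat) (b t x : R).

Definition width n : R := n.+1%:R^-1.

Lemma width_gt0 n : 0 < width n.
Proof. by rewrite invr_gt0 ltr0n. Qed.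

Lemma width_le1 n : width n <= 1.
Proof. by rewrite invf_le1 ?ler1n ?ltr0n. Qed.

Lemma width_cvg0 : width n @[n --> \oo] --> (0 : R).
Proof. exact: cvg_harmonic. Qed.

(** [exp (- w / x)] for [x > 0] with a width [w] tending to zero: a smooth
approximation of the indicator of the positive half-line. *)
Definition cut n : R -> R := flat (width n) 1.

Definition dcut n : R -> R := flat (width n) (dflat (width n) 1).

Lemma cutE n x : 0 < x -> cut n x = expR (- (width n * x^-1)).
Proof. by move=> x0; rewrite /cut /flat x0 hornerC mul1r. Qed.

Lemma cut_eq0 n x : x <= 0 -> cut n x = 0.
Proof. by move=> x0; rewrite /cut /flat ltNge x0. Qed.

Lemma cut_itv n x : 0 <= cut n x <= 1.
Proof.
have [x0|x0] := leP x 0; first by rewrite cut_eq0// lexx ler01.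
rewrite cutE// expR_ge0/= -expR0 ler_expR oppr_le0.
by rewrite mulr_ge0 ?ltW ?width_gt0 ?invr_gt0.
Qed.

Lemma cut_ge n x : 0 < x -> 1 - width n * x^-1 <= cut n x.
Proof. by move=> x0; rewrite cutE//; exact: expR_ge1Dx. Qed.

(** With [y = w / x], the quantity is [y exp (- y)], which lies between [0] and
both [y] and [1]. The factor [x] compensates the blow-up of the derivative. *)
Lemma x_dcut n x : 0 < x -> 0 <= x * dcut n x <= width n * x^-1 /\ x * dcut n x <= 1.
Proof.
move=> x0; have y0 : 0 < width n * x^-1 by rewrite mulr_gt0 ?width_gt0 ?invr_gt0.
have -> : x * dcut n x = (width n * x^-1) * expR (- (width n * x^-1)).
  by rewrite /dcut /flat x0 /dflat derivC subr0 !hornerE /=; field; rewrite gt_eqF.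
set y := width n * x^-1 in y0 *; split.
  apply/andP; split; first by rewrite mulr_ge0 ?expR_ge0// ltW.
  by rewrite ger_pMr// -expR0 ler_expR oppr_le0 ltW.
rewrite expRN ler_pdivrMr ?expR_gt0// mul1r; apply: le_trans (expR_ge1Dx y); lra.
Qed.

Lemma dcut_eq0 n x : x <= 0 -> dcut n x = 0.
Proof. by move=> x0; rewrite /dcut /flat ltNge x0. Qed.

Lemma is_derive_cut n x : is_derive x 1 (cut n) (dcut n x).
Proof. exact: is_derive_flat (width_gt0 n). Qed.

Lemma smooth1_cut n : smooth1 (cut n).
Proof. exact: smooth1_flat (width_gt0 n). Qed.

Lemma smooth1_continuous (g : R -> R) : smooth1 g -> continuous g.
Proof.
by move=> sg x; apply: differentiable_continuous; apply/derivable1_diffP; exact: (sg 0%N).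
Qed.

Lemma measurable_cut n : measurable_fun setT (cut n).
Proof. by apply: continuous_measurable_fun; apply: smooth1_continuous; exact: smooth1_cut. Qed.

Lemma measurable_dcut n : measurable_fun setT (dcut n).
Proof.
apply: continuous_measurable_fun; apply: smooth1_continuous.
exact: smooth1_flat (width_gt0 n).
Qed.

(** Approximates the indicator of [0, b], with support at positive times. *)
Definition window n b t := cut n (b - t) * cut n (t - width n).

(** Approximates [t |-> b - t] on [0, b]. The support is allowed to cross [t = 0],
where nothing is cut, so that testing with this profile involves the initial data.
The factor [b - t] makes the derivative [dmom] bounded uniformly in [n], which
a mere cut-off at [b] would not be; the limit of [dmom] is [-1]. *)
Definition mom n b t := (b - t) * (cut n (b - t) * cut n (t + 1)).

Definition dmom n b t := (b - t) * (cut n (b - t) * dcut n (t + 1) - dcut n (b - t) * cut n (t + 1))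
  - cut n (b - t) * cut n (t + 1).

Let meas_sub (g : R -> R) b : measurable_fun setT g -> measurable_fun setT (fun t => g (b - t)).
Proof. by move=> mg; apply: (measurableT_comp mg); exact: measurable_funB. Qed.

Let meas_add (g : R -> R) b : measurable_fun setT g -> measurable_fun setT (fun t => g (t + b)).
Proof. by move=> mg; apply: (measurableT_comp mg); exact: measurable_funD. Qed.

Lemma measurable_window n b : measurable_fun setT (window n b).
Proof.
apply: measurable_funM; first exact: meas_sub (measurable_cut n).
exact: meas_add (measurable_cut n).
Qed.

Lemma measurable_mom n b : measurable_fun setT (mom n b).
Proof.
apply: measurable_funM; first exact: measurable_funB.
by apply: measurable_funM; [exact: meas_sub (measurable_cut n)|exact: meas_add (measurable_cut n)].
Qed.

Lemma measurable_dmom n b : measurable_fun setT (dmom n b).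
Proof.
have m1 := meas_sub b (measurable_cut n); have m2 := meas_add 1 (measurable_cut n).
have m3 := meas_sub b (measurable_dcut n); have m4 := meas_add 1 (measurable_dcut n).
apply: measurable_funB; last exact: measurable_funM.
apply: measurable_funM; first exact: measurable_funB.
by apply: measurable_funB; exact: measurable_funM.
Qed.

Let elementary_time (g : R -> R) (al de : R) : smooth1 g ->
  elementary (fun z : R * (R * R) => g (al * z.1 + de)).
Proof.
move=> sg; have -> : (fun z : R * (R * R) => g (al * z.1 + de)) = g \o affine al 0 0 de.
  by apply/funext => z; rewrite /affine /= !mul0r !addr0.
exact: elementary_comp.
Qed.

Lemma elementary_window n b : elementary (fun z => window n b z.1).
Proof.
have -> : (fun z : R * (R * R) => window n b z.1) =
   (fun z => cut n (- 1 * z.1 + b)) * (fun z => cut n (1 * z.1 + - width n)).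
  apply/funext => z.
  rewrite -[RHS]/(cut n (- 1 * z.1 + b) * cut n (1 * z.1 + - width n)).
  by rewrite /window mulN1r mul1r [- _ + _]addrC.
by apply: elementaryM; apply: elementary_time; exact: smooth1_cut.
Qed.

Lemma elementary_mom n b : elementary (fun z => mom n b z.1).
Proof.
have -> : (fun z : R * (R * R) => mom n b z.1) =
   (fun z => (- 1 * (1 * z.1 + 0) + b)) *
   ((fun z => cut n (- 1 * z.1 + b)) * (fun z => cut n (1 * z.1 + 1))).
  apply/funext => z.
  rewrite -[RHS]/((- 1 * (1 * z.1 + 0) + b) * (cut n (- 1 * z.1 + b) * cut n (1 * z.1 + 1))).
  by rewrite /mom addr0 !mulN1r !mul1r [- _ + _]addrC.
have e1 := @elementary_time (fun x => - 1 * x + b) 1 0 (@smooth1_affine R (- 1) b).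
apply: elementaryM; first exact: e1.
by apply: elementaryM; apply: elementary_time; exact: smooth1_cut.
Qed.

Lemma is_derive_mom n b t : is_derive t 1 (mom n b) (dmom n b t).
Proof.
have d1 : is_derive t 1 (fun t => cut n (b - t)) (dcut n (b - t) * -1).
  by apply: (@is_derive1_comp _ (cut n) (fun t => b - t));
    [exact: is_derive_cut|apply: is_derive_eq; rewrite /=; ring].
have d2 : is_derive t 1 (fun t => cut n (t + 1)) (dcut n (t + 1) * 1).
  by apply: (@is_derive1_comp _ (cut n) (fun t => t + 1));
    [exact: is_derive_cut|apply: is_derive_eq; rewrite /=; ring].
have d0 : is_derive t 1 (fun t => b - t) (-1).
  by apply: is_derive_eq; rewrite /=; ring.
have H := is_deriveM d0 (is_deriveM d1 d2).
apply: (is_derive_eq H); rewrite /dmom /GRing.scale /=.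
rewrite -[((fun t => cut n (b - t)) * (fun t => cut n (t + 1))) t]/(cut n (b - t) * cut n (t + 1)).
ring.
Qed.

Lemma window_eq0 n b t : ~~ (width n <= t <= b) -> window n b t = 0.
Proof.
rewrite negb_and -!ltNge => /orP[h|h]; rewrite /window.
  by rewrite (@cut_eq0 _ (t - _)) ?mulr0// subr_le0 ltW.
by rewrite cut_eq0 ?mul0r// subr_le0 ltW.
Qed.

Lemma mom_eq0 n b t : ~~ (-1 <= t <= b) -> mom n b t = 0.
Proof.
rewrite negb_and -!ltNge => /orP[h|h]; rewrite /mom.
  by rewrite (@cut_eq0 _ (t + _)) ?mulr0//; lra.
by rewrite cut_eq0 ?mul0r ?mulr0// subr_le0 ltW.
Qed.

Lemma window_itv n b t : 0 <= window n b t <= 1.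
Proof.
have /andP[h1 h2] := cut_itv n (b - t); have /andP[h3 h4] := cut_itv n (t - width n).
by rewrite /window mulr_ge0//= mulr_ile1.
Qed.

Lemma cut_cvg1 x : 0 < x -> cut n x @[n --> \oo] --> (1 : R).
Proof.
move=> x0; apply: (@squeeze_cvgr _ _ _ _ (fun n => 1 - width n * x^-1) (cst 1)).
- by apply: nearW => n; rewrite cut_ge//=; case/andP: (cut_itv n x).
- rewrite -[X in _ --> X]subr0 -(mul0r x^-1); apply: cvgB; first exact: cvg_cst.
  by apply: cvgM; [exact: width_cvg0|exact: cvg_cst].
- exact: cvg_cst.
Qed.

Lemma window_cvg b t : 0 < t < b -> window n b t @[n --> \oo] --> (1 : R).
Proof.
move=> /andP[t0 tb]; rewrite -[X in _ --> X](mulr1 1); apply: cvgM.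
  by apply: cut_cvg1; rewrite subr_gt0.
have t20 : 0 < t / 2 by rewrite divr_gt0.
apply: (@squeeze_cvgr _ _ _ _ (fun n => 1 - width n * (t / 2)^-1) (cst 1)).
- have := width_cvg0; move=> /cvgrPdist_lt/(_ _ t20); apply: filterS => n.
  rewrite sub0r normrN (gtr0_norm (width_gt0 n)) => wt.
  have tw : t / 2 <= t - width n by lra.
  have tp : 0 < t - width n by lra.
  apply/andP; split; last by case/andP: (cut_itv n (t - width n)).
  apply: le_trans (cut_ge n tp); rewrite lerD2l lerN2 ler_pM2l ?width_gt0//.
  by rewrite lef_pV2 ?posrE.
- rewrite -[X in _ --> X]subr0 -(mul0r (t / 2)^-1); apply: cvgB; first exact: cvg_cst.
  by apply: cvgM; [exact: width_cvg0|exact: cvg_cst].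
- exact: cvg_cst.
Qed.

Lemma mom_bound n b t : 0 <= t <= b -> `|mom n b t| <= b.
Proof.
move=> /andP[t0 tb]; have /andP[h1 h2] := cut_itv n (b - t); have /andP[h3 h4] := cut_itv n (t + 1).
have p0 : 0 <= cut n (b - t) * cut n (t + 1) by rewrite mulr_ge0.
have p1 : cut n (b - t) * cut n (t + 1) <= 1 by rewrite mulr_ile1.
have bt : 0 <= b - t by rewrite subr_ge0.
by rewrite /mom ger0_norm ?mulr_ge0//; nra.
Qed.

Lemma mom_cvg b t : 0 < t < b -> mom n b t @[n --> \oo] --> b - t.
Proof.
move=> /andP[t0 tb]; rewrite -[X in _ --> X]mulr1; apply: cvgM; first exact: cvg_cst.
rewrite -[X in _ --> X](mulr1 1); apply: cvgM; apply: cut_cvg1; lra.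
Qed.

Lemma dcut_bound n t : 0 <= t -> 0 <= dcut n (t + 1) <= width n.
Proof.
move=> t0; have t1 : 0 < t + 1 by lra.
have [/andP[h1 h2] _] := x_dcut n t1; have w0 := width_gt0 n.
have i1 : (t + 1)^-1 <= 1 by rewrite invf_le1//; lra.
have h3 : width n * (t + 1)^-1 <= width n by rewrite ger_pMr.
nra.
Qed.

Lemma dmom_bound n b t : 0 <= t <= b -> `|dmom n b t| <= b + 2.
Proof.
move=> /andP[t0]; rewrite le_eqVlt => /predU1P[tb|tb].
  by rewrite /dmom tb subrr cut_eq0// !mul0r subr0 normr0 -tb; lra.
have /andP[h1 h2] := cut_itv n (b - t); have /andP[h3 h4] := cut_itv n (t + 1).
have bt : 0 < b - t by rewrite subr_gt0.
have [/andP[h5 _] h6] := x_dcut n bt; have /andP[h7 h8] := dcut_bound n t0.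
have w1 := width_le1 n.
rewrite /dmom; move: h1 h2 h3 h4 h5 h6 h7 h8 bt.
set c := cut n (b - t); set e := cut n (t + 1); set d := dcut n (b - t); set f := dcut n (t + 1).
set s := b - t => h1 h2 h3 h4 h5 h6 h7 h8 s0.
have sb : s <= b by rewrite /s; lra.
have a1 : 0 <= c * f <= 1 by rewrite mulr_ge0//= mulr_ile1//; lra.
have a2 : 0 <= (s * d) * e <= 1 by rewrite mulr_ge0//= mulr_ile1.
have a3 : 0 <= c * e <= 1 by rewrite mulr_ge0//= mulr_ile1.
have -> : s * (c * f - d * e) - c * e = s * (c * f) - (s * d) * e - c * e by ring.
have a4 : 0 <= s * (c * f) <= b by apply/andP; split; nra.
rewrite ler_norml; lra.
Qed.

Lemma dmom_cvg b t : 0 < t < b -> dmom n b t @[n --> \oo] --> (-1 : R).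
Proof.
move=> /andP[t0 tb]; have bt : 0 < b - t by rewrite subr_gt0.
have c1 := cut_cvg1 bt; have t1 : 0 < t + 1 by lra.
have c2 := cut_cvg1 t1.
have c3 : dcut n (t + 1) @[n --> \oo] --> (0 : R).
  apply: (@squeeze_cvgr _ _ _ _ (cst 0) width).
  - by apply: nearW => n; apply: dcut_bound; exact: ltW.
  - exact: cvg_cst.
  - exact: width_cvg0.
have c4 : (b - t) * dcut n (b - t) @[n --> \oo] --> (0 : R).
  apply: (@squeeze_cvgr _ _ _ _ (cst 0) (fun n => width n * (b - t)^-1)).
  - by apply: nearW => n; have [] := x_dcut n bt.
  - exact: cvg_cst.
  - by rewrite -(mul0r (b - t)^-1); apply: cvgM; [exact: width_cvg0|exact: cvg_cst].
have -> : dmom ^~ b ^~ t = (fun n => (b - t) * (cut n (b - t) * dcut n (t + 1)) -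
    ((b - t) * dcut n (b - t)) * cut n (t + 1) - cut n (b - t) * cut n (t + 1)).
  by apply/funext => n; rewrite /dmom; ring.
have -> : (-1 : R) = (b - t) * (1 * 0) - 0 * 1 - 1 * 1 by rewrite !mulr0 mul0r !sub0r mulr1 oppr0 add0r.
apply: cvgB; last exact: cvgM.
apply: cvgB; last exact: cvgM.
by apply: cvgM; [exact: cvg_cst|exact: cvgM].
Qed.

End cutoffs.

(** * Testing against a time profile times a mode *)

Section slicing.
Context {R : realType}.
Notation mu := (@lebesgue_measure R).
Notation space_time := (measurableTypeR R * (measurableTypeR R * measurableTypeR R))%type.
Implicit Types (w : R * (R * R) -> R) (b : R) (k : int * int) (eta : R -> R).

Definition strip b : set space_time := `[0, b] `*` cell.

Lemma measurable_strip b : measurable (strip b).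
Proof. by apply: measurableX; [exact: measurable_itv|exact: measurable_cell]. Qed.

Lemma measurable_half_cylinder : measurable (half_cylinder : set space_time).
Proof. by apply: measurableX; [exact: measurable_itv|exact: measurable_cell]. Qed.

Lemma strip_sub b : strip b `<=` half_cylinder.
Proof.
by move=> -[t x] [/= h xc]; split => //=; move: h; rewrite !in_itv/= andbT => /andP[].
Qed.

Definition strip_integrable w := forall b, leb3.-integrable (strip b) (EFin \o w).

Definition mode_coef w k (t : R) : R := coef (fun x => w (t, x)) k.

Lemma measurable_hart_snd k : measurable_fun setT (fun z : space_time => hart k z.2).
Proof. exact: (measurableT_comp (@measurable_hart R k setT) measurable_snd). Qed.

Section one_slice.
Variables (w : R * (R * R) -> R) (b : R) (eta : R -> R) (M : R) (k : int * int).
Hypothesis wi : strip_integrable w.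
Hypothesis meta : measurable_fun setT eta.
Hypothesis eta_le : forall t, 0 <= t <= b -> `|eta t| <= M.
Hypothesis eta_supp : forall t, 0 <= t -> b < t -> eta t = 0.

Let F z := w z * (eta z.1 * hart k z.2).

Let F_patch : (EFin \o F) \_ half_cylinder = (EFin \o F) \_ (strip b).
Proof.
apply/funext => -[t x]; rewrite !patchE.
have [[t0 xc]|nh] := pselect (half_cylinder (t, x)); last first.
  rewrite !memNset// => -[/= h xc]; apply: nh; split => //=.
  by move: h; rewrite !in_itv/= => /andP[->].
move: t0; rewrite /= in_itv/= andbT => t0.
rewrite mem_set; last by split => //=; rewrite in_itv/= t0.
have [tb|bt] := leP t b.
  by rewrite mem_set//; split => //=; rewrite in_itv/= t0.
rewrite memNset; first by rewrite /F /= eta_supp// mul0r mulr0.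
by move=> [/=]; rewrite in_itv/= => /andP[_]; rewrite leNgt bt.
Qed.

Let Fi_strip : leb3.-integrable (strip b) (EFin \o F).
Proof.
have wb := wi b.
have H := @integrable_mulb _ _ R leb3 (strip b) (measurable_strip b) w
  (fun z => eta z.1 * hart k z.2) (`|M| * 2) wb.
apply: H.
- apply: measurable_funTS; apply: measurable_funM; first exact: measurableT_comp.
  exact: measurable_hart_snd.
- move=> [t x] [/= ]; rewrite in_itv/= => tb _.
  rewrite normrM ler_pM//; last exact: hart_bound.
  by rewrite (le_trans (eta_le tb))// ler_norm.
Qed.

Lemma integrable_slice : leb3.-integrable half_cylinder (EFin \o F).
Proof.
have [_] := @integrable_mkcond _ _ R leb3 half_cylinder (EFin \o F) measurable_half_cylinder.
apply; rewrite F_patch.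
have [H _] := @integrable_mkcond _ _ R leb3 (strip b) (EFin \o F) (measurable_strip b).
exact: H Fi_strip.
Qed.

Lemma loc_integrable_mode_coef : loc_integrable (mode_coef w k).
Proof.
move=> c; have wc := wi c.
have H := @integrable_mulb _ _ R leb3 (strip c) (measurable_strip c) w
  (fun z => hart k z.2) 2 wc.
have {}H : leb3.-integrable (strip c) (EFin \o (fun z => w z * hart k z.2)).
  apply: H => [|z _]; last exact: hart_bound.
  by apply: measurable_funTS; exact: measurable_hart_snd.
exact: (@integrable_section_integral _ _ _ _ R mu leb2 _ _ _ (measurable_itv _) measurable_cell H).
Qed.

(** Fubini on the strip: testing [w] with a time profile times a mode amounts to
testing the coefficient of [w] with the profile. *)
Lemma Rintegral_slice :
  \int[leb3]_(z in half_cylinder) F z = \int[mu]_(t in `[0, b]) (eta t * mode_coef w k t).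
Proof.
transitivity (\int[leb3]_(z in strip b) F z).
  by rewrite /Rintegral [in LHS]integral_mkcond [in RHS]integral_mkcond F_patch.
have -> := @Rintegral_prod _ _ _ _ R mu leb2 _ _ _ (measurable_itv _) measurable_cell Fi_strip.
have i1 := @integrable_section_integral _ _ _ _ R mu leb2 _ _ _ (measurable_itv _) measurable_cell Fi_strip.
have i2 := loc_integrable_mode_coef b.
apply: ae_eq_Rintegral.
- exact: measurable_itv.
- by apply/measurable_EFinP; have /integrableP[] := i1.
- apply: measurable_funM; first exact: measurable_funTS.
  by apply/measurable_EFinP; have /integrableP[] := i2.
have := @ae_integrable_section _ _ _ _ R mu leb2 _ _ _ (measurable_itv _) measurable_cell (wi b).
apply: filterS => t /[apply] it; rewrite /mode_coef /coef /inner -RintegralZl.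
- by apply: eq_Rintegral => x _; rewrite /F /=; ring.
- exact: measurable_cell.
- have H := @integrable_mulb _ _ R leb2 cell measurable_cell _ (hart k) 2 it.
  by apply: H => [|x _]; [exact: measurable_hart|exact: hart_bound].
Qed.

End one_slice.

End slicing.

Section testing_in_time.
Context {R : realType}.
Notation mu := (@lebesgue_measure R).
Implicit Types (q V B eta : R -> R) (b : R).

Lemma integrable_oo q b : mu.-integrable `[0, b] (EFin \o q) ->
  mu.-integrable `]0, b[ (EFin \o q).
Proof.
move=> qb; have H := @integrableS _ _ R mu `[0, b] `]0, b[ (EFin \o q).
apply: H; [exact: measurable_itv|exact: measurable_itv| |exact: qb].
exact: subset_itv_oo_cc.
Qed.

Lemma Rintegral_oo q b : mu.-integrable `[0, b] (EFin \o q) ->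
  \int[mu]_(t in `[0, b]) q t = \int[mu]_(t in `]0, b[) q t.
Proof.
move=> ib.
have ico : mu.-integrable `[0, b[ (EFin \o q).
  have H := @integrableS _ _ R mu `[0, b] `[0, b[ (EFin \o q).
  apply: H; [exact: measurable_itv|exact: measurable_itv| |exact: ib].
  by clear; apply: subset_itvl; rewrite bnd_simp.
rewrite -(Rintegral_itv_bndo_bndc ico).
by rewrite -(Rintegral_itv_obnd_cbnd (integrable_oo ib)).
Qed.

Lemma Rintegral_cutoff_cvg q (eta_ : nat -> R -> R) eta b M : 0 < b -> loc_integrable q ->
  (forall n, measurable_fun setT (eta_ n)) -> measurable_fun setT eta ->
  (forall n t, 0 < t < b -> `|eta_ n t| <= M) ->
  (forall t, 0 < t < b -> eta_ n t @[n --> \oo] --> eta t) ->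
  \int[mu]_(t in `]0, b[) (eta_ n t * q t) @[n --> \oo] -->
  \int[mu]_(t in `]0, b[) (eta t * q t).
Proof.
move=> b0 iq meta_ meta etaM etac.
have mq : measurable_fun `]0, b[ q.
  by apply/measurable_EFinP; have /integrableP[] := integrable_oo (iq b).
have iqn := integrable_norm (integrable_oo (iq b)).
apply: (@Rdominated_cvg _ _ R mu _ (measurable_itv _) _ _ (fun t => M * `|q t|)).
- by move=> n; apply: measurable_funM; [apply: measurable_funTS; exact: meta_|exact: mq].
- by apply: measurable_funM; [apply: measurable_funTS; exact: meta|exact: mq].
- apply: aeW => t; rewrite /= in_itv/= => tb.
  by apply: cvgM; [exact: etac|exact: cvg_cst].
- by apply: integrableZR; [exact: measurable_itv|exact: iqn].
- apply: aeW => t; rewrite /= in_itv/= => tb n.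
  by rewrite normrM ler_wpM2r//; exact: etaM.
Qed.

(** As [n] grows the windows fill [0, b], so all the primitives of [q] vanish. *)
Lemma ae_eq0_of_window q : loc_integrable q ->
  (forall n b, 0 < b -> \int[mu]_(t in `[0, b]) (window n b t * q t) = 0) ->
  {ae mu, forall t, 0 <= t -> q t = 0}.
Proof.
move=> iq q0; apply: ae_eq0_of_primitive => // b b0.
have c : \int[mu]_(t in `]0, b[) (window n b t * q t) @[n --> \oo] -->
    \int[mu]_(t in `]0, b[) (1 * q t).
  apply: (@Rintegral_cutoff_cvg q (fun n => window n b) (fun=> 1) b 1 b0 iq).
  - by move=> n; exact: measurable_window.
  - exact: measurable_cst.
  - by move=> n t _; have /andP[h0 h1] := window_itv n b t; rewrite ger0_norm.
  - by move=> t tb; exact: window_cvg.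
rewrite (Rintegral_oo (iq b)).
transitivity (\int[mu]_(t in `]0, b[) (1 * q t)).
  by apply: eq_Rintegral => t _; rewrite mul1r.
rewrite -(cvg_lim _ c)// (_ : (fun n => _) = (fun=> 0)) ?lim_cst//.
apply/funext => n; rewrite -[RHS](q0 n b b0) Rintegral_oo//.
have H := @integrable_bmul _ _ R mu `[0, b] (measurable_itv _) q (window n b) 1 (iq b).
apply: H; first by apply: measurable_funTS; exact: measurable_window.
by move=> t _; have /andP[h0 h1] := window_itv n b t; rewrite ger0_norm.
Qed.

Lemma loc_integrable_primitive B : loc_integrable B ->
  loc_integrable (fun t => \int[mu]_(s in `[0, t]) B s).
Proof.
move=> iB b; have i1 := loc_integrable_cst 1 b.
have := integrable_triangle i1 (iB b).
by apply: eq_integrable; [exact: measurable_itv|move=> t _ /=; rewrite mul1r].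
Qed.

(** In the limit the hypothesis reads
[\int_0^b V = \int_0^b (b - t) B t dt], and the right-hand side is the
primitive at [b] of the primitive of [B]. Thus [V] and the primitive of [B] have the
same integral over each [0, b]. *)
Lemma ae_primitive_of_mom V B : loc_integrable V -> loc_integrable B ->
  (forall n b, 0 < b -> \int[mu]_(t in `]0, b[) (dmom n b t * V t) +
     \int[mu]_(t in `]0, b[) (mom n b t * B t) = 0) ->
  {ae mu, forall t, 0 <= t -> V t = \int[mu]_(s in `[0, t]) B s}.
Proof.
move=> iV iB VB; pose P t := \int[mu]_(s in `[0, t]) B s.
have iP : loc_integrable P by exact: loc_integrable_primitive.
have : {ae mu, forall t, 0 <= t -> V t - P t = 0}.
  apply: (@ae_eq0_of_primitive _ (fun t => V t - P t)).
    by move=> b; apply: integrableBR; [exact: measurable_itv|exact: iV|exact: iP].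
  move=> b b0; rewrite RintegralB; [|exact: measurable_itv|exact: iV|exact: iP].
  rewrite double_primitive//; apply/eqP; rewrite subr_eq0; apply/eqP.
  have c1 : \int[mu]_(t in `]0, b[) (dmom n b t * V t) @[n --> \oo] -->
      \int[mu]_(t in `]0, b[) (- 1 * V t).
    apply: (@Rintegral_cutoff_cvg V (fun n => dmom n b) (fun=> - 1) b (b + 2) b0 iV).
    - by move=> n; exact: measurable_dmom.
    - exact: measurable_cst.
    - by move=> n t /andP[t0 tb]; apply: dmom_bound; rewrite !ltW.
    - by move=> t tb; exact: dmom_cvg.
  have c2 : \int[mu]_(t in `]0, b[) (mom n b t * B t) @[n --> \oo] -->
      \int[mu]_(t in `]0, b[) ((b - t) * B t).
    apply: (@Rintegral_cutoff_cvg B (fun n => mom n b) (fun t => b - t) b b b0 iB).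
    - by move=> n; exact: measurable_mom.
    - exact: measurable_funB.
    - by move=> n t /andP[t0 tb]; apply: mom_bound; rewrite !ltW.
    - by move=> t tb; exact: mom_cvg.
  have c0 : (fun n : nat => 0 : R) @ \oo -->
      \int[mu]_(t in `]0, b[) (- 1 * V t) + \int[mu]_(t in `]0, b[) ((b - t) * B t).
    have -> : (fun n : nat => 0 : R) = (fun n => \int[mu]_(t in `]0, b[) (dmom n b t * V t) +
        \int[mu]_(t in `]0, b[) (mom n b t * B t)) by apply/funext => n; rewrite VB.
    exact: cvgD.
  have H : \int[mu]_(t in `]0, b[) (- 1 * V t) + \int[mu]_(t in `]0, b[) ((b - t) * B t) = 0.
    by rewrite -(cvg_lim _ c0)// lim_cst.
  rewrite (Rintegral_oo (iV b)).
  have -> : \int[mu]_(s in `[0, b]) ((b - s) * B s) = \int[mu]_(s in `]0, b[) ((b - s) * B s).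
    apply: Rintegral_oo.
    have H' := @integrable_bmul _ _ R mu `[0, b] (measurable_itv _) B (fun t => b - t) (`|b| + `|b|) (iB b).
    apply: H'; first exact: measurable_funB.
    move=> t; rewrite /= in_itv/= => /andP[t0 tc].
    by rewrite (le_trans (ler_normB _ _))// lerD2l ger0_norm// (le_trans tc)// ler_norm.
  have E : \int[mu]_(t in `]0, b[) (- 1 * V t) = - \int[mu]_(t in `]0, b[) V t.
    rewrite RintegralZl ?mulN1r//; exact: (integrable_oo (iV b)).
  by move: H; rewrite E; lra.
apply: filterS; first exact: (ae_filter_ringOfSetsType mu).
by move=> t /[apply] /eqP; rewrite subr_eq0 => /eqP.
Qed.

End testing_in_time.

(** * The equations satisfied by the coefficients *)

Section mode_equations.
Context {R : realType}.
Notation mu := (@lebesgue_measure R).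
Notation space_time := (measurableTypeR R * (measurableTypeR R * measurableTypeR R))%type.
Implicit Types (k : int * int) (b t : R).

Definition strip_sqint (w : R * (R * R) -> R) := forall b, sqint leb3 (strip b) w.

Lemma leb3_strip b : (leb3 (strip b : set space_time) < +oo)%E.
Proof.
have mc := @measurable_cell R.
have mi : measurable (`[0, b] : set (measurableTypeR R)) by exact: measurable_itv.
rewrite /leb3 /strip (product_measure1E mu leb2 mi mc).
apply: lte_mul_pinfty; first exact: measure_ge0.
- by rewrite ge0_fin_numE; [exact: lebesgue_itv_fin|exact: measure_ge0].
- exact: leb2_cell_fin.
Qed.

Lemma strip_integrable_of_sqint w : strip_sqint w -> strip_integrable w.
Proof. by move=> sw b; exact: (sqint_int (measurable_strip b) (leb3_strip b) (sw b)). Qed.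

Lemma strip_integrableM w w' : strip_sqint w -> strip_sqint w' ->
  strip_integrable (fun z => w z * w' z).
Proof. by move=> sw sw' b; exact: (sqint_mul (measurable_strip b) (sw b) (sw' b)). Qed.

Lemma Rintegral_slice_sum (I : Type) (s : seq I) (c : I -> R) (w : I -> R * (R * R) -> R)
    b (eta : R -> R) M k :
  (forall i, strip_integrable (w i)) -> measurable_fun setT eta ->
  (forall t, 0 <= t <= b -> `|eta t| <= M) -> (forall t, 0 <= t -> b < t -> eta t = 0) ->
  \int[leb3]_(z in half_cylinder) (\sum_(i <- s) c i * (w i z * (eta z.1 * hart k z.2))) =
  \int[mu]_(t in `[0, b]) (eta t * \sum_(i <- s) c i * mode_coef (w i) k t).
Proof.
move=> wi meta etaM eta0.
have iw i := integrable_slice k (wi i) meta etaM eta0.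
have mh := @measurable_half_cylinder R.
have mi : measurable (`[0, b] : set (measurableTypeR R)) by exact: measurable_itv.
rewrite Rintegral_sum//; last first.
  by move=> i; apply: integrableZR; [exact: mh|exact: iw].
have iq i : mu.-integrable `[0, b] (EFin \o (fun t => eta t * mode_coef (w i) k t)).
  have H := @integrable_bmul _ _ R mu `[0, b] mi (mode_coef (w i) k) eta M.
  apply: H; [exact: (loc_integrable_mode_coef k (wi i))|exact: measurable_funTS|].
  by move=> t; rewrite /= in_itv/=; exact: etaM.
transitivity (\sum_(i <- s) c i * \int[mu]_(t in `[0, b]) (eta t * mode_coef (w i) k t)).
  apply: eq_bigr => i _; rewrite RintegralZl; [|exact: mh|exact: iw].
  by congr (_ * _); exact: (Rintegral_slice k (wi i) meta etaM eta0).
transitivity (\int[mu]_(t in `[0, b]) (\sum_(i <- s) c i * (eta t * mode_coef (w i) k t))).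
  rewrite Rintegral_sum; [|exact: mi|].
    by apply: eq_bigr => i _; rewrite RintegralZl; [|exact: mi|exact: iq].
  by move=> i; apply: integrableZR; [exact: mi|exact: iq].
by apply: eq_Rintegral => t _; rewrite mulr_sumr; apply: eq_bigr => i _; ring.
Qed.

Lemma loc_integrable_sum (I : Type) (s : seq I) (c : I -> R) (q : I -> R -> R) :
  (forall i, loc_integrable (q i)) -> loc_integrable (fun t => \sum_(i <- s) c i * q i t).
Proof.
move=> iq b; apply: integrable_sumR; first exact: measurable_itv.
by move=> i; apply: integrableZR; [exact: measurable_itv|exact: iq].
Qed.

Lemma test_window n b k : test_function `]0, +oo[ (mode (window n b) k).
Proof.
apply: (@test_mode _ _ (width n) b).
- move=> t /=; rewrite !in_itv/= andbT => /andP[h _].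
  by rewrite (lt_le_trans _ h)// width_gt0.
- exact: elementary_window.
- by move=> t; exact: window_eq0.
Qed.

Let window_bound n b t : 0 <= t <= b -> `|window n b t| <= 1.
Proof. by move=> _; have /andP[h0 h1] := window_itv n b t; rewrite ger0_norm. Qed.

Let window_supp n b t : 0 <= t -> b < t -> window n b t = 0.
Proof. by move=> t0 bt; apply: window_eq0; rewrite negb_and -!ltNge bt orbT. Qed.

Section fluid.
Variables (u : 'I_2 -> R * (R * R) -> R) (omega : R * (R * R) -> R).
Hypothesis hu : weak_euler u (fun _ _ => 0).
Hypothesis hcurl : weak_curl u omega.
Hypothesis omega_sq : strip_sqint omega.

Lemma velocity_sqint i : strip_sqint (u i).
Proof.
move=> b; split; last exact: weak_euler_L2loc hu i b.
have mi := weak_euler_measurable hu i.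
exact: (@measurable_funS _ _ space_time R half_cylinder (strip b) (u i)
  (@measurable_half_cylinder R) (@strip_sub R b) mi).
Qed.

Let iu i : strip_integrable (u i).
Proof. exact: strip_integrable_of_sqint (velocity_sqint i). Qed.

Let iuu (p : 'I_2 * 'I_2) : strip_integrable (fun z => u p.1 z * u p.2 z).
Proof. exact: strip_integrableM (velocity_sqint _) (velocity_sqint _). Qed.

Definition velocity_coef i k t : R := mode_coef (u i) k t.

Definition stress_coef i j k t : R := mode_coef (fun z => u i z * u j z) k t.

(** The equation is tested with the mode [- k], whose derivatives are multiples of
the mode [k]. *)
Lemma ae_divergence_free k :
  {ae mu, forall t, 0 <= t -> \sum_(j < 2) wave j k * velocity_coef j k t = 0}.
Proof.
have p2 : 2 * pi != 0 :> R by rewrite mulf_neq0// gt_eqF// pi_gt0.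
have : {ae mu, forall t, 0 <= t ->
    \sum_(j < 2) (2 * pi * wave j (- k)) * velocity_coef j k t = 0}.
  apply: (@ae_eq0_of_window R (fun t => \sum_(j < 2) (2 * pi * wave j (- k)) * velocity_coef j k t)).
    by apply: loc_integrable_sum => j; exact: (loc_integrable_mode_coef k (iu j)).
  move=> n b b0; have := weak_euler_div hu (test_window n b (- k)).
  have -> : \int[leb3]_(z in half_cylinder) (\sum_(j < 2) u j z * dx j (mode (window n b) (- k)) z) =
    \int[leb3]_(z in half_cylinder) (\sum_(j < 2) (2 * pi * wave j (- k)) *
       (u j z * (window n b z.1 * hart k z.2))).
    apply: eq_Rintegral => z _; apply: eq_bigr => j _.
    by rewrite dx_mode opprK; ring.
  by rewrite (@Rintegral_slice_sum _ _ (fun j => 2 * pi * wave j (- k)) u b (window n b) 1 k iu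
    (measurable_window n b) (@window_bound n b) (@window_supp n b)).
apply: filterS; first exact: (ae_filter_ringOfSetsType mu).
move=> t /[apply] H; apply: (mulfI p2); rewrite mulr0 -[RHS]oppr0 -[X in - X]H mulr_sumr -sumrN.
by apply: eq_bigr => j _; rewrite waveN; ring.
Qed.

Lemma ae_vorticity_coef k :
  {ae mu, forall t, 0 <= t -> mode_coef omega k t =
    - (2 * pi * (wave 0 k * velocity_coef 1 (- k) t - wave 1 k * velocity_coef 0 (- k) t))}.
Proof.
have iom := strip_integrable_of_sqint omega_sq.
pose c (j : 'I_2) : R := 2 * pi * (if j == 0 then - wave 1 k else wave 0 k).
pose q t : R := 1 * mode_coef omega k t + \sum_(j < 2) c j * velocity_coef j (- k) t.
have iq1 : loc_integrable (fun t => \sum_(j < 2) c j * velocity_coef j (- k) t).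
  by apply: loc_integrable_sum => j; exact: (loc_integrable_mode_coef (- k) (iu j)).
have iq0 : loc_integrable (fun t => 1 * mode_coef omega k t).
  move=> b; apply: integrableZR; first exact: measurable_itv.
  exact: (loc_integrable_mode_coef k iom).
have : {ae mu, forall t, 0 <= t -> q t = 0}.
  apply: ae_eq0_of_window.
    by move=> b; apply: integrableDR; [exact: measurable_itv|exact: iq0|exact: iq1].
  move=> n b b0; have := hcurl (test_window n b k).
  have s0 := @Rintegral_slice_sum 'I_1 [:: ord0] (fun=> 1) (fun=> omega) b (window n b) 1 k
    (fun=> iom) (measurable_window n b) (@window_bound n b) (@window_supp n b).
  have s1 := @Rintegral_slice_sum _ (index_enum 'I_2) c u b (window n b) 1 (- k) iu
    (measurable_window n b) (@window_bound n b) (@window_supp n b).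
  have -> : \int[leb3]_(z in half_cylinder) (omega z * mode (window n b) k z) =
      \int[mu]_(t in `[0, b]) (window n b t * (1 * mode_coef omega k t)).
    transitivity (\int[leb3]_(z in half_cylinder) (\sum_(i <- [:: ord0 : 'I_1]) 1 *
        (omega z * (window n b z.1 * hart k z.2)))).
      by apply: eq_Rintegral => z _; rewrite big_seq1 mul1r.
    by rewrite s0; apply: eq_Rintegral => t _; rewrite big_seq1.
  have -> : \int[leb3]_(z in half_cylinder)
        (u 1 z * dx 0 (mode (window n b) k) z - u 0 z * dx 1 (mode (window n b) k) z) =
      \int[mu]_(t in `[0, b]) (window n b t * \sum_(j < 2) c j * velocity_coef j (- k) t).
    rewrite -s1; apply: eq_Rintegral => z _; rewrite !dx_mode sum_ord2 /c /=; ring.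
  move=> H; have mi : measurable (`[0, b] : set (measurableTypeR R)) by exact: measurable_itv.
  have wm (p : R -> R) : loc_integrable p ->
      mu.-integrable `[0, b] (EFin \o (fun t => window n b t * p t)).
    move=> ip; have H' := @integrable_bmul _ _ R mu `[0, b] mi p (window n b) 1 (ip b).
    apply: H'; first exact: measurable_funTS (measurable_window n b).
    by move=> t; rewrite /= in_itv/=; exact: window_bound.
  transitivity (\int[mu]_(t in `[0, b]) (window n b t * (1 * mode_coef omega k t) +
      window n b t * \sum_(j < 2) c j * velocity_coef j (- k) t)).
    by apply: eq_Rintegral => t _; rewrite /q; ring.
  by rewrite RintegralD; [rewrite H addNr|exact: mi|exact: wm iq0|exact: wm iq1].
apply: filterS; first exact: (ae_filter_ringOfSetsType mu).
move=> t /[apply]; rewrite /q mul1r => /eqP; rewrite addr_eq0 => /eqP ->.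
rewrite sum_ord2 /c /=; ring.
Qed.

(** The initial-value formulation is tested with the field of components
[c i * mom n b t * hart k x]. It is divergence-free as [c] is orthogonal to [k], and
the contribution of the initial data is zero. *)
Lemma ae_momentum (c : 'I_2 -> R) k : \sum_(j < 2) c j * wave j k = 0 ->
  {ae mu, forall t, 0 <= t -> \sum_(i < 2) c i * velocity_coef i k t =
    \int[mu]_(s in `[0, t])
      (\sum_(i < 2) \sum_(j < 2) c i * (2 * pi * wave j k) * stress_coef i j (- k) s)}.
Proof.
move=> ck; pose d (p : 'I_2 * 'I_2) : R := c p.1 * (2 * pi * wave p.2 k).
pose V t : R := \sum_(i < 2) c i * velocity_coef i k t.
pose B s : R := \sum_(p <- index_enum ('I_2 * 'I_2)%type) d p * stress_coef p.1 p.2 (- k) s.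
have iV : loc_integrable V.
  by apply: loc_integrable_sum => j; exact: (loc_integrable_mode_coef k (iu j)).
have iB : loc_integrable B.
  by apply: loc_integrable_sum => p; exact: (loc_integrable_mode_coef (- k) (iuu p)).
have BE s : B s = \sum_(i < 2) \sum_(j < 2) c i * (2 * pi * wave j k) * stress_coef i j (- k) s.
  by rewrite [RHS]pair_bigA /B; apply: eq_bigr => -[i j] _.
have : {ae mu, forall t, 0 <= t -> V t = \int[mu]_(s in `[0, t]) B s}.
  apply: ae_primitive_of_mom => // n b b0.
  pose phi i := mode (fun t => c i * mom n b t) k.
  have tphi i : test_function setT (phi i).
    apply: (@test_mode _ _ (-1) b) => //.
    - by apply: (@elementaryM _ (fun=> c i)); [exact: elementary_cst|exact: elementary_mom].
    - by move=> t /mom_eq0 ->; rewrite mulr0.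
  have dphi z : divergence phi z = 0.
    rewrite /divergence; under eq_bigr do rewrite dx_mode.
    transitivity (2 * pi * (mom n b z.1 * hart (- k) z.2) * \sum_(j < 2) c j * wave j k).
      by rewrite mulr_sumr; apply: eq_bigr => j _; ring.
    by rewrite ck mulr0.
  have := weak_euler_init hu tphi dphi.
  have -> : \int[leb2]_(x in cell) (\sum_(i < 2) 0 * phi i (0, x)) = 0.
    transitivity (\int[leb2]_(x in cell) (0 : R)).
      by apply: eq_Rintegral => x _; rewrite big1// => i _; rewrite mul0r.
    by rewrite Rintegral_cst ?mul0r//; exact: measurable_cell.
  rewrite addr0 /euler_pairing.
  have mom_le t : 0 <= t <= b -> `|mom n b t| <= b by exact: mom_bound.
  have dmom_le t : 0 <= t <= b -> `|dmom n b t| <= b + 2 by exact: dmom_bound.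
  have mom0 t : 0 <= t -> b < t -> mom n b t = 0.
    by move=> t0 bt; apply: mom_eq0; rewrite negb_and -!ltNge bt orbT.
  have dmom0 t : 0 <= t -> b < t -> dmom n b t = 0.
    move=> t0 bt; have h : b - t <= 0 by rewrite subr_le0 ltW.
    by rewrite /dmom (cut_eq0 n h) (dcut_eq0 n h) !mul0r; ring.
  have s1 := @Rintegral_slice_sum _ (index_enum 'I_2) c u b (dmom n b) (b + 2) k iu
    (measurable_dmom n b) dmom_le dmom0.
  have s2 := @Rintegral_slice_sum _ (index_enum ('I_2 * 'I_2)%type) d
    (fun p z => u p.1 z * u p.2 z) b (mom n b) b (- k) iuu (measurable_mom n b) mom_le mom0.
  have E z : \sum_(i < 2) u i z * dt (phi i) z + \sum_(i < 2) \sum_(j < 2) u i z * u j z * dx j (phi i) z =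
     \sum_(i < 2) c i * (u i z * (dmom n b z.1 * hart k z.2)) +
     \sum_(p <- index_enum ('I_2 * 'I_2)%type) d p * (u p.1 z * u p.2 z * (mom n b z.1 * hart (- k) z.2)).
    congr (_ + _).
      apply: eq_bigr => i _.
      have D t : is_derive t 1 (fun t => c i * mom n b t) (c i * dmom n b t).
        have H := is_deriveM (is_derive_cst (c i) t (1 : R)) (is_derive_mom n b t).
        by apply: (is_derive_eq H); rewrite scaler0 addr0.
      by rewrite (dt_mode k z D); ring.
    rewrite pair_bigA; apply: eq_bigr => -[i j] _.
    by rewrite dx_mode /d /=; ring.
  have mh := @measurable_half_cylinder R.
  have ih1 : leb3.-integrable half_cylinder (EFin \o
      (fun z => \sum_(i < 2) c i * (u i z * (dmom n b z.1 * hart k z.2)))).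
    apply: integrable_sumR; first exact: mh.
    move=> i; apply: integrableZR; first exact: mh.
    exact: (integrable_slice k (iu i) (measurable_dmom n b) dmom_le dmom0).
  have ih2 : leb3.-integrable half_cylinder (EFin \o
      (fun z => \sum_(p <- index_enum ('I_2 * 'I_2)%type)
        d p * (u p.1 z * u p.2 z * (mom n b z.1 * hart (- k) z.2)))).
    apply: integrable_sumR; first exact: mh.
    move=> p; apply: integrableZR; first exact: mh.
    exact: (integrable_slice (- k) (iuu p) (measurable_mom n b) mom_le mom0).
  have -> : \int[leb3]_(z in half_cylinder)
      (\sum_(i < 2) u i z * dt (phi i) z + \sum_(i < 2) \sum_(j < 2) u i z * u j z * dx j (phi i) z) =
    \int[leb3]_(z in half_cylinder)
      (\sum_(i < 2) c i * (u i z * (dmom n b z.1 * hart k z.2)) +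
       \sum_(p <- index_enum ('I_2 * 'I_2)%type) d p * (u p.1 z * u p.2 z * (mom n b z.1 * hart (- k) z.2))).
    by apply: eq_Rintegral => z _; exact: E.
  rewrite RintegralD; [|exact: mh|exact: ih1|exact: ih2].
  rewrite s1 s2 => H.
  have i1 : mu.-integrable `[0, b] (EFin \o (fun t => dmom n b t * V t)).
    have H1 := @integrable_bmul _ _ R mu `[0, b] (measurable_itv _) V (dmom n b) (b + 2) (iV b).
    by apply: H1; [exact: measurable_funTS (measurable_dmom n b)|move=> t; rewrite /= in_itv/=; exact: dmom_le].
  have i2 : mu.-integrable `[0, b] (EFin \o (fun t => mom n b t * B t)).
    have H2 := @integrable_bmul _ _ R mu `[0, b] (measurable_itv _) B (mom n b) b (iB b).
    by apply: H2; [exact: measurable_funTS (measurable_mom n b)|move=> t; rewrite /= in_itv/=; exact: mom_le].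
  by rewrite -(Rintegral_oo i1) -(Rintegral_oo i2); exact: H.
apply: filterS; first exact: (ae_filter_ringOfSetsType mu).
by move=> t /[apply]; rewrite /V => ->; apply: eq_Rintegral => s _; exact: BE.
Qed.

End fluid.

End mode_equations.

(** * Bound on the enstrophy *)

Section vorticity_bound.
Context {R : realType}.
Notation mu := (@lebesgue_measure R).
Notation plane := (measurableTypeR R * measurableTypeR R)%type.
Notation space_time := (measurableTypeR R * plane)%type.
Variables (p : R) (omega : R * (R * R) -> R).
Hypotheses (hp : 2 <= p) (homega : Linfty_Lp p omega).

Lemma sqr_le1_powR (y : R) : y ^+ 2 <= 1 + `|y| `^ p.
Proof.
have [y1|y1] := leP 1 `|y|.
  rewrite -real_normK ?num_real// -powR_mulrn//.
  by rewrite (le_trans (ler_powR y1 hp))// lerDr.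
rewrite (@le_trans _ _ 1)// ?lerDl ?powR_ge0//.
by rewrite -real_normK ?num_real// expr_le1// ltW.
Qed.

Lemma half_cylinder_section (t : R) : 0 <= t ->
  measurable_fun (cell : set plane) (fun x => omega (t, x)).
Proof.
move=> t0; have [_ mo _] := homega.
have H := @measurable_section _ _ (measurableTypeR R) plane R `[0, +oo[ cell omega
  (measurable_itv _) (@measurable_cell R) mo t.
by apply: H; rewrite /= in_itv/= t0.
Qed.

(** Since [y^2 <= 1 + |y|^p] and the cell has measure one, the bound is [1 + m ^ p]
for [m] an upper bound of the essential supremum of the [L^p] norms. *)
Lemma ae_enstrophy_bound : exists2 K : R, 0 <= K & {ae mu, forall t, 0 <= t ->
  (\int[leb2]_(x in cell) ((omega (t, x)) ^+ 2)%:E <= K%:E)%E}.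
Proof.
have NE (g : R -> \bar R) : ('N[mu]_+oo[g] = ess_sup mu (abse \o g))%E.
  rewrite unlock ifT//; apply: (@lt_le_trans _ _ (mu `[0, 1])).
    by rewrite /= lebesgue_measure_itv/= lte_fin ltr01 oppr0 adde0.
  by apply: le_measure; rewrite ?inE.
have [_ mo] := homega; rewrite NE.
set g := (X in ess_sup _ X); move=> goo.
have [m gm] : exists m : R, (ess_sup mu g <= m%:E)%E.
  by case: (ess_sup mu g) goo => [m _|//|_]; [exists m|exists 0; rewrite leNye].
exists (1 + m `^ p); first by rewrite addr_ge0// powR_ge0.
have := ess_sup_ge mu g; apply: filterS => t gt t0.
have p_gt0 : 0 < p := lt_le_trans (ltr0n R 2) hp.
have p0 : p != 0 by rewrite gt_eqF.
have Nm : ('N[leb2]_(p%:E)[(fun x => (omega (t, x))%:E) \_ cell] <= m%:E)%E.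
  apply: le_trans gm; apply: le_trans gt; rewrite /g /= patchE mem_set ?lee_abs//.
  by rewrite /= in_itv/= t0.
have m0 : 0 <= m by rewrite -lee_fin; apply: le_trans Nm; exact: Lnorm_ge0.
have mc := @measurable_cell R; have ms := half_cylinder_section t0.
have mn : measurable_fun (cell : set plane) (fun x => `|omega (t, x)| `^ p).
  have H := measurableT_comp (measurable_powR p) (measurableT_comp (@normr_measurable R setT) ms).
  exact: H.
apply: (@le_trans _ _ (\int[leb2]_(x in cell) (1 + (`|omega (t, x)| `^ p)%:E))%E).
  apply: ge0_le_integral => //.
  - by move=> x _; rewrite lee_fin sqr_ge0.
  - by apply/measurable_EFinP; exact: measurable_funX.
  - by apply/measurable_EFinP; exact: measurable_funD.
  - by move=> x _; rewrite -EFinD lee_fin sqr_le1_powR.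
rewrite ge0_integralD//; last exact/measurable_EFinP.
have -> : (\int[leb2]_(_ in @cell R) 1 = 1)%E.
  by rewrite integral_cst// mul1e; exact: leb2_cell.
rewrite EFinD leeD2l//.
have <- : ('N[leb2]_(p%:E)[(fun x => (omega (t, x))%:E) \_ cell] `^ p =
    \int[leb2]_(x in cell) (`|omega (t, x)| `^ p)%:E)%E.
  rewrite poweR_Lnorm// [RHS]integral_mkcond; apply: eq_integral => x _; rewrite !patchE.
  by case: ifP => //= _; rewrite normr0 powR0.
rewrite -poweR_EFin; apply: gt0_ler_poweR => //; first exact: ltW.
- by rewrite in_itv /= Lnorm_ge0 leey.
- by rewrite in_itv /= lee_fin m0 leey.
Qed.

(** Joint square integrability follows from the bound at almost every time by
Tonelli's theorem. *)
Lemma vorticity_strip_sqint : strip_sqint omega.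
Proof.
have [_ mo _] := homega; have [K K0 oK] := ae_enstrophy_bound; move=> b.
have mi : measurable (`[0, b] : set (measurableTypeR R)) by exact: measurable_itv.
have mos := @measurable_funS _ _ space_time R half_cylinder (strip b) omega
  (@measurable_half_cylinder R) (@strip_sub R b) mo.
split; first exact: mos.
have mo2 : measurable_fun (strip b) (fun z => omega z ^+ 2) by exact: measurable_funX.
apply/integrableP; split; first exact/measurable_EFinP.
have -> : (\int[leb3]_(z in strip b) `|(omega z ^+ 2)%:E| =
    \int[leb3]_(z in strip b) (omega z ^+ 2)%:E)%E.
  by apply: eq_integral => z _; rewrite /= ger0_norm ?sqr_ge0.
have H := @integral_prod_ge0 _ _ (measurableTypeR R) plane R mu leb2 `[0, b] cell
  (fun z => omega z ^+ 2) mi (@measurable_cell R) mo2 (fun z _ => sqr_ge0 _).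
rewrite /leb3 /strip H.
apply: (@le_lt_trans _ _ (\int[mu]_(t in `[0%R, b]) K%:E)%E); last first.
  rewrite integral_cst//; apply: lte_mul_pinfty; [by rewrite lee_fin|by []|].
  exact: lebesgue_itv_fin.
have H2 := @measurable_section_integral _ _ (measurableTypeR R) plane R leb2 `[0, b] cell
  (fun z => omega z ^+ 2) mi (@measurable_cell R) mo2 (fun z _ => sqr_ge0 _).
apply: ae_ge0_le_integral => //.
- by move=> t _; apply: integral_ge0 => x _; rewrite lee_fin sqr_ge0.
- apply: filterS oK; first exact: (ae_filter_ringOfSetsType mu).
  by move=> t tK; rewrite /= in_itv/= => /andP[t0 _]; exact: tK.
Qed.

End vorticity_bound.

(** * Conservation of energy *)

Section energy.
Context {R : realType}.
Notation mu := (@lebesgue_measure R).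
Notation plane := (measurableTypeR R * measurableTypeR R)%type.
Notation sq := (sqint (@leb2 R) cell).
Implicit Types (k : int * int) (t : R).

Lemma ae_forall_countable (I : countType) (P : I -> R -> Prop) :
  (forall i, {ae mu, forall t, P i t}) -> {ae mu, forall t, forall i, P i t}.
Proof.
move=> aeP; pose Q n t := if @unpickle I n is Some i then P i t else True.
have : {ae mu, forall t, forall n, Q n t}.
  apply/ae_foralln => n; rewrite /Q; case: unpickle => [i|]; first exact: aeP.
  exact: aeW.
apply: filterS; first exact: (ae_filter_ringOfSetsType mu).
by move=> t H i; have := H (pickle i); rewrite /Q pickleK.
Qed.

Lemma ae_sqint_section (w : R * (R * R) -> R) : strip_sqint w ->
  {ae mu, forall t, 0 <= t -> sq (fun x => w (t, x))}.
Proof.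
move=> sw.
have : {ae mu, forall t, forall n : nat, [set` `[0, n%:R]] t ->
    leb2.-integrable cell (fun x => ((w (t, x)) ^+ 2)%:E)}.
  apply: ae_forall_countable => n; have [_ wi] := sw n%:R.
  exact: (@ae_integrable_section _ _ _ _ R mu leb2 _ _ _ (measurable_itv _) measurable_cell wi).
apply: filterS; first exact: (ae_filter_ringOfSetsType mu).
move=> t H t0.
have tn : [set` `[0, (Num.bound t)%:R]] t.
  by rewrite /= in_itv/= t0/= ltW// archi_boundP.
split; last exact: H tn.
have [mw _] := sw (Num.bound t)%:R.
have M := @measurable_section _ _ (measurableTypeR R) plane R `[0, (Num.bound t)%:R] cell w
  (measurable_itv _) (@measurable_cell R) mw t.
exact: M tn.
Qed.

Section fluid_energy.
Variables (p : R) (u : 'I_2 -> R * (R * R) -> R) (omega : R * (R * R) -> R).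
Hypotheses (hp : 2 <= p) (hu : weak_euler u (fun _ _ => 0)).
Hypotheses (hcurl : weak_curl u omega) (homega : Linfty_Lp p omega).

Let omega_sq : strip_sqint omega.
Proof. exact: vorticity_strip_sqint hp homega. Qed.

Let velocity t i x := u i (t, x).

Let circ k t := circulation (velocity t) k.

Let forcing k t : R := \sum_(i < 2) \sum_(j < 2)
  perp i k * (2 * pi * wave j k) * coef (fun x => velocity t i x * velocity t j x) (- k).

(** The properties that the velocity has at almost every time, for all modes at
once. *)
Record regular (A : R) t : Prop := Regular {
  regular_sqint : forall i, sq (velocity t i) ;
  regular_mean : forall i, coef (velocity t i) 0 = 0 ;
  regular_div : forall k, \sum_(j < 2) wave j k * coef (velocity t j) k = 0 ;
  regular_h1 : forall i, h1_bounded A (velocity t i) ;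
  regular_circ : forall k, circ k t = \int[mu]_(s in `[0, t]) forcing k s }.

(** For [k = 0] every [c] is allowed in [ae_momentum], and the nonlinear term
vanishes: the mean momentum is conserved. *)
Lemma ae_mean_velocity i : {ae mu, forall t, 0 <= t -> coef (velocity t i) 0 = 0}.
Proof.
have w0 j : wave j 0 = 0 :> R by rewrite /wave if_same.
have := @ae_momentum _ _ hu (fun j => (j == i)%:R) 0.
have -> : \sum_(j < 2) (j == i)%:R * wave j 0 = 0 :> R.
  by rewrite big1// => j _; rewrite w0 mulr0.
move=> /(_ erefl); apply: filterS; first exact: (ae_filter_ringOfSetsType mu).
move=> t /[apply]; rewrite (bigD1 i)//= eqxx mul1r big1 ?addr0; last first.
  by move=> j /negPf ->; rewrite mul0r.
move=> H; rewrite -[LHS]/(velocity_coef u i 0 t) H.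
transitivity (\int[mu]_(s in `[0, t]) (0 : R)).
  apply: eq_Rintegral => s _; rewrite big1// => a _; rewrite big1// => b _.
  by rewrite w0 !(mulr0, mul0r).
by rewrite Rintegral_cst ?mul0r//; exact: measurable_itv.
Qed.

Lemma ae_regular : exists A, {ae mu, forall t, 0 <= t -> regular A t}.
Proof.
have [A A0 omA] := ae_enstrophy_bound hp homega; exists A.
have a1 : {ae mu, forall t, forall i, 0 <= t -> sq (velocity t i)}.
  by apply: ae_forall_countable => i; apply: ae_sqint_section; exact: velocity_sqint hu i.
have a2 : {ae mu, forall t, forall i, 0 <= t -> coef (velocity t i) 0 = 0}.
  by apply: ae_forall_countable => i; exact: ae_mean_velocity.
have a3 : {ae mu, forall t, forall k, 0 <= t ->
    \sum_(j < 2) wave j k * coef (velocity t j) k = 0}.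
  by apply: ae_forall_countable => k; exact: ae_divergence_free hu k.
have a4 : {ae mu, forall t, forall k, 0 <= t -> coef (fun x => omega (t, x)) k =
    - (2 * pi * (wave 0 k * coef (velocity t 1) (- k) - wave 1 k * coef (velocity t 0) (- k)))}.
  by apply: ae_forall_countable => k; exact: ae_vorticity_coef hu hcurl omega_sq k.
have a5 : {ae mu, forall t, forall k, 0 <= t -> circ k t = \int[mu]_(s in `[0, t]) forcing k s}.
  by apply: ae_forall_countable => k; exact: (ae_momentum hu (sum_perp_wave k)).
have a6 := ae_sqint_section omega_sq.
have FF : Filter (nbhs (almost_everywhere mu)) := ae_filter_ringOfSetsType mu.
have I A B := @filterI _ _ FF A B.
have := I _ _ (I _ _ (I _ _ a1 a2) (I _ _ a3 a4)) (I _ _ (I _ _ a5 a6) omA).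
apply: filterS.
move=> t [[[b1 b2] [b3 b4]] [[b5 b6] b7]] t0.
have sv i : sq (velocity t i) by exact: b1.
have dv k : \sum_(j < 2) wave j k * coef (velocity t j) k = 0 by exact: b3.
have v0 i : coef (velocity t i) 0 = 0 by exact: b2.
have so := b6 t0.
split; [exact: sv|exact: v0|exact: dv| |by move=> k; exact: b5].
move=> i N; apply: le_trans (h1_bounded_of_curl v0 dv so (fun k => b4 k t0) i N) _.
rewrite -lee_fin; apply: le_trans (b7 t0); rewrite /inner.
have [_ io2] := so.
rewrite fineK; last exact: (@integrable_fin_num _ _ R leb2 cell measurable_cell _ io2).
by [].
Qed.

Lemma loc_integrable_forcing k : loc_integrable (forcing k).
Proof.
move=> b; apply: integrable_sumR => [|i]; first exact: measurable_itv.
apply: integrable_sumR => [|j]; first exact: measurable_itv.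
apply: integrableZR; first exact: measurable_itv.
have H := @loc_integrable_mode_coef _ (fun z => u i z * u j z) (- k) _ b; apply: H.
exact: strip_integrableM (velocity_sqint hu i) (velocity_sqint hu j).
Qed.

Let V k t := \int[mu]_(s in `[0, t]) forcing k s.

(** Half the time derivative of the sum of the squares of the coefficients in the box,
with the circulation replaced by its integral expression [V], which makes sense at
all times. *)
Definition production N t : R := \sum_(k <- box N) (wave_sq k)^-1 * (forcing k t * V k t).

Lemma integrable_production k b :
  mu.-integrable `[0, b] (EFin \o (fun t => (wave_sq k)^-1 * (forcing k t * V k t))).
Proof.
apply: integrableZR; first exact: measurable_itv.
exact: integrable_triangle (loc_integrable_forcing k b) (loc_integrable_forcing k b).
Qed.

Lemma loc_integrable_production N : loc_integrable (production N).
Proof.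
move=> b; apply: integrable_sumR; first exact: measurable_itv.
by move=> k; exact: integrable_production.
Qed.

Lemma energy_balance N A t : 0 <= t -> regular A t ->
  \sum_(k <- box N) \sum_(i < 2) coef (velocity t i) k ^+ 2 =
  2 * \int[mu]_(s in `[0, t]) production N s.
Proof.
move=> t0 [st mt dt' _ ct].
rewrite Rintegral_sum; [|exact: measurable_itv|by move=> k; exact: integrable_production].
rewrite mulr_sumr; apply: eq_bigr => k _; rewrite (sum_sqr_coef mt dt').
rewrite -[circulation _ k]/(circ k t) ct (sqr_primitive (loc_integrable_forcing k) t0).
rewrite RintegralZl; [by rewrite mulrC mulrCA|exact: measurable_itv|].
exact: integrable_triangle (loc_integrable_forcing k t) (loc_integrable_forcing k t).
Qed.

Lemma production_flux N A t : regular A t -> production N t = flux N (velocity t).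
Proof.
move=> [st mt dt' _ ct]; rewrite (flux_circulation st mt dt').
apply: eq_bigr => k _; rewrite -[circulation _ k]/(circ k t) ct -/(V k t) -/(forcing k t).
ring.
Qed.

(** Almost everywhere the production is the flux of the velocity, which tends to zero
and is dominated by a constant that only depends on the enstrophy bound. *)
Lemma production_cvg0 A b : {ae mu, forall t, 0 <= t -> regular A t} ->
  \int[mu]_(t in `[0, b]) production N t @[N --> \oo] --> (0 : R).
Proof.
move=> reg; pose K := 16 * (A * A * (400 * ((2 * pi) ^+ 2 * A))).
have mi : measurable (`[0, b] : set (measurableTypeR R)) by exact: measurable_itv.
have E0 : \int[mu]_(t in `[0, b]) (0 : R) = 0 by rewrite Rintegral_cst ?mul0r.
rewrite -[X in _ --> X]E0.
apply: (@Rdominated_cvg _ _ R mu `[0, b] mi production (fun=> 0) (fun=> 1 + K)).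
- by move=> N; apply/measurable_EFinP; have /integrableP[] := loc_integrable_production N b.
- exact: measurable_cst.
- apply: filterS reg; first exact: (ae_filter_ringOfSetsType mu).
  move=> t rt; rewrite /= in_itv/= => /andP[/rt r _].
  rewrite (_ : (fun N => _) = (fun N => flux N (velocity t))).
    by case: r => st mt dt' ht _; exact: flux_cvg0 st mt ht dt'.
  by apply/funext => N; exact: production_flux r.
- exact: loc_integrable_cst.
- apply: filterS reg; first exact: (ae_filter_ringOfSetsType mu).
  move=> t rt; rewrite /= in_itv/= => /andP[/rt r _] N.
  rewrite (production_flux N r); case: r => st mt _ ht _.
  have := flux_bound st mt ht N; rewrite -/K -real_normK ?num_real//.
  (* The flux is bounded through its square: [x <= 1 + x^2]. *)
  by set x := `|_|; have := sqr_ge0 (x - 1); nra.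
Qed.

(** The energy in a box only grows with the box, and it equals a quantity that tends
to zero. *)
Lemma ae_velocity_eq0 : {ae mu, forall t, 0 <= t -> forall i,
  (\int[leb2]_(x in cell) ((u i (t, x)) ^+ 2)%:E = 0)%E}.
Proof.
have [A reg] := ae_regular; have c b := production_cvg0 b reg.
apply: filterS reg; first exact: (ae_filter_ringOfSetsType mu).
move=> t /[swap] t0 /(_ t0) rt i.
have c2 : 2 * \int[mu]_(s in `[0, t]) production N s @[N --> \oo] --> (0 : R).
  by rewrite -[X in _ --> X](mulr0 2); apply: cvgM; [exact: cvg_cst|exact: c].
have ck k : coef (velocity t i) k = 0.
  apply/eqP; rewrite -sqrf_eq0 eq_le sqr_ge0 andbT.
  rewrite -(cvg_lim _ c2)//; apply: limr_ge; first exact: cvgP c2.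
  (* As soon as the box contains [k], the square of its coefficient is one of the terms. *)
  exists (maxn `|k.1| `|k.2|)%N => // N /= kN.
  rewrite -(energy_balance N t0 rt) (big_rem k)/=; last first.
    by rewrite mem_box -geq_max.
  rewrite (bigD1 i)//= -addrA lerDl addr_ge0//.
    by apply: sumr_ge0 => j _; exact: sqr_ge0.
  by apply: sumr_ge0 => l _; apply: sumr_ge0 => j _; exact: sqr_ge0.
have si := regular_sqint rt i; have := coef_eq0_inner si ck.
have [_ i2] := si; rewrite /inner => u0.
rewrite -[LHS]fineK; last exact: (@integrable_fin_num _ _ R leb2 cell measurable_cell _ i2).
by congr EFin; exact: u0.
Qed.

(** Tonelli on each strip passes from almost every time to almost every point; the
strips exhaust the half-cylinder. *)
Lemma ae_eq0_half_cylinder i : {ae leb3, forall z, half_cylinder z -> u i z = 0}.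
Proof.
have : {ae leb3, forall z, forall n : nat, strip n%:R z -> u i z = 0}.
  apply/ae_foralln => n.
  have [mui _] := velocity_sqint hu i n%:R.
  have mi : measurable (`[0, n%:R] : set (measurableTypeR R)) by exact: measurable_itv.
  have mui2 : measurable_fun (strip n%:R) (fun z => u i z ^+ 2) by exact: measurable_funX.
  have H := @integral_prod_ge0 _ _ (measurableTypeR R) plane R mu leb2 `[0, n%:R] cell
    (fun z => u i z ^+ 2) mi (@measurable_cell R) mui2 (fun z _ => sqr_ge0 _).
  have M := @measurable_section_integral _ _ (measurableTypeR R) plane R leb2 `[0, n%:R] cell
    (fun z => u i z ^+ 2) mi (@measurable_cell R) mui2 (fun z _ => sqr_ge0 _).
  have E0 : (\int[leb3]_(z in strip n%:R) `|(u i z ^+ 2)%:E| = 0)%E.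
    transitivity (\int[leb3]_(z in strip n%:R) (u i z ^+ 2)%:E)%E.
      by apply: eq_integral => z _; rewrite /= ger0_norm ?sqr_ge0.
    rewrite /leb3 /strip H.
    transitivity (\int[mu]_(t in `[0%R, n%:R]) 0%E)%E; last exact: integral0.
    apply: ae_eq_integral => //.
    apply: filterS ae_velocity_eq0; first exact: (ae_filter_ringOfSetsType mu).
    by move=> t ut; rewrite /= in_itv/= => /andP[t0 _]; exact: ut.
  have [K _] := @ae_eq_integral_abs _ _ R leb3 (strip n%:R) (measurable_strip n%:R)
    (fun z => (u i z ^+ 2)%:E) ((measurable_EFinP _ _).2 mui2).
  have := K E0; apply: filterS.
  by move=> z Kz /Kz /= [] /eqP; rewrite sqrf_eq0 => /eqP.
apply: filterS.
move=> -[t x] H [/= t0 xc]; apply: (H (Num.bound t)).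
by split => //=; move: t0; rewrite !in_itv/= andbT => t0; rewrite t0/= ltW// archi_boundP.
Qed.

End fluid_energy.

End energy.

Theorem theorem8 (R : realType) (p : R) (hp : 2 <= p)
    (u : 'I_2 -> R * (R * R) -> R) (omega : R * (R * R) -> R)
    (hu : weak_euler u (fun _ _ => 0))
    (hcurl : weak_curl u omega)
    (homega : Linfty_Lp p omega) :
  forall i : 'I_2, {ae leb3, forall z, half_cylinder z -> u i z = 0}.
Proof. exact: (ae_eq0_half_cylinder hp hu hcurl homega). Qed.
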